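(* Let $k,n\ge1$ be integers and let $B^H$ be a fractional Brownian $(k,n)$-field with Hurst index $0<H<1$ over a probability space $(\Omega,\mathcal{F},\mathbb{P})$. (i) If $\alpha>0$ and $n-\frac{k}{2H}<\alpha<n$, then there is an event $\Omega_0\in\mathcal{F}$ with $\mathbb{P}(\Omega_0)=1$ such that for any $\omega\in\Omega_0$ we have $U^\alpha\mu_{B^H(\cdot,\omega)}\in C_\infty(\mathbb{R}^n)$ for the occupation measure $\mu_{B^H(\cdot,\omega)}$ of $B^H(\cdot,\omega)$. In particular, $U^\alpha\mu_{B^H(\cdot,\omega)}$ is bounded for such $\omega$. (ii) If $n<\frac{k}{2H}$, then there is an event $\Omega_0\in\mathcal{F}$ with $\mathbb{P}(\Omega_0)=1$ such that for any $\omega\in\Omega_0$ the function $B^H(\cdot,\omega)$ has local times $L_{B^H(\cdot,\omega)}\in C_\infty(\mathbb{R}^n)$. In particular, $L_{B^H(\cdot,\omega)}$ is bounded for such $\omega$.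
   Context: A fractional Brownian $(k,1)$-field $b^H$ with Hurst index $H\in(0,1)$ is a centered Gaussian random field $b^H:[0,+\infty)^k\times\Omega\to\mathbb{R}$ with $b^H(0)=0$ $\mathbb{P}$-a.s. and $\mathbb{E}|b^H(t)-b^H(s)|^2=|t-s|^{2H}$ for $s,t\in[0,+\infty)^k$. A fractional Brownian $(k,n)$-field is $B^H=(b^H_1,\dots,b^H_n)$ with $b_1^H,\dots,b_n^H$ independent copies of $b^H$; it is taken to be a modification with continuous paths. The occupation measure of a Borel function $X:[0,1]^k\to\mathbb{R}^n$ is $\mu_X(B)=\mathcal{L}^k(\{t\in[0,1]^k:X(t)\in B\})$, $B\subset\mathbb{R}^n$ Borel, where $\mathcal{L}^k$ is $k$-dimensional Lebesgue measure; for $B^H(\cdot,\omega)$ it refers to the restriction to $[0,1]^k$. If $\mu_X$ is absolutely continuous with respect to $\mathcal{L}^n$, its density $L_X=\frac{d\mu_X}{d\mathcal{L}^n}$ is called the local time of $X$. For $0<\alpha<n$ the Riesz potential is $U^\alpha\mu(x)=\int_{\mathbb{R}^n}|x-y|^{\alpha-n}\mu(dy)$. $C_\infty(\mathbb{R}^n)$ is the space of continuous functions on $\mathbb{R}^n$ vanishing at infinity. *)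

(* Defs.v *)
From HB Require Import structures.
From mathcomp Require Import all_boot all_order all_algebra.
From mathcomp Require Import all_classical all_reals all_analysis.

Set Implicit Arguments.
Unset Strict Implicit.
Unset Printing Implicit Defensive.

Import Order.TTheory GRing.Theory Num.Theory.
Import numFieldNormedType.Exports.

Local Open Scope classical_set_scope.
Local Open Scope ring_scope.

Definition borel_mx_display : measure_display.
Proof. exact: default_measure_display. Qed.

(* ['M[R]_(m, n)], hence ['rV[R]_n], carries its Borel sigma-algebra. *)
Section borel_matrix.
Context {R : realType} (m n : nat).

Definition borel_mx : set (set 'M[R]_(m, n)) := <<s @open 'M[R]_(m, n) >>.

Lemma borel_mx0 : borel_mx set0.
Proof. exact: sigma_algebra0. Qed.

Lemma borel_mxC A : borel_mx A -> borel_mx (~` A).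
Proof. exact: sigma_algebraC. Qed.

Lemma borel_mx_bigcup (F : (set 'M[R]_(m, n))^nat) :
  (forall i, borel_mx (F i)) -> borel_mx (\bigcup_i F i).
Proof. exact: sigma_algebra_bigcup. Qed.

HB.instance Definition _ :=
  @isMeasurable.Build borel_mx_display 'M[R]_(m, n) borel_mx
    borel_mx0 borel_mxC borel_mx_bigcup.

Lemma open_mx_measurable (A : set 'M[R]_(m, n)) : open A -> measurable A.
Proof. exact: sub_sigma_algebra. Qed.

Lemma measurable_coord (i : 'I_m) (j : 'I_n) :
  measurable_fun setT (fun x : 'M[R]_(m, n) => x i j).
Proof.
apply: (@measurability _ _ 'M[R]_(m, n) (measurableTypeR R) _ _
  (@measurable_realfun.RGenOpens.G R)).
  exact: measurable_realfun.RGenOpens.measurableE.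
move=> _ [_ [a [b ->]] <-]; rewrite setTI; apply: open_mx_measurable.
apply: open_comp; last exact: itv_open.
by move=> x _; exact: coord_continuous.
Qed.

Lemma measurable_fun_mx d (T : measurableType d) (f : T -> 'M[R]_(m, n)) :
  (forall i j, measurable_fun setT (fun t => f t i j)) -> measurable_fun setT f.
Proof.
move=> mf; apply: (measurability (@open 'M[R]_(m, n))) => // _ [U oU <-].
rewrite setTI.
pose box (p : 'M[rat]_(m, n) * 'M[rat]_(m, n)) : set 'M[R]_(m, n) :=
  [set x | forall i j, ratr (p.1 i j) < x i j < ratr (p.2 i j)].
pose F k : set T := if pickle_inv k is Some p then
  if `[< box p `<=` U >] then f @^-1` box p else set0 else set0.
have -> : f @^-1` U = \bigcup_k F k.
  apply/seteqP; split => t; last first.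
    case=> k _; rewrite /F; case: pickle_inv => // p.
    by case: asboolP => // pU; exact: pU.
  move=> /= Ut; have : nbhs (f t) U by exact: open_nbhs_nbhs.
  move=> /nbhs_ballP[e /= e0 eU].
  have ha i j : exists q : rat, f t i j - e < ratr q < f t i j.
    have /rat_in_itvoo[q] : f t i j - e < f t i j by rewrite gtrBl.
    by rewrite in_itv /= => ?; exists q.
  have hb i j : exists q : rat, f t i j < ratr q < f t i j + e.
    have /rat_in_itvoo[q] : f t i j < f t i j + e by rewrite ltrDl.
    by rewrite in_itv /= => ?; exists q.
  pose a := \matrix_(i, j) xchoose (ha i j).
  pose b := \matrix_(i, j) xchoose (hb i j).
  exists (pickle (a, b)) => //; rewrite /F pickleK_inv.
  case: asboolP => [_ i j /=|]; last first.
    case=> x bx; apply: eU; split=> // i j; have := bx i j.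
    rewrite !mxE => /andP[xa xb].
    have /andP[a1 a2] := xchooseP (ha i j); have /andP[b1 b2] := xchooseP (hb i j).
    rewrite /ball /= ltr_distlC (lt_trans a1 xa) /=.
    exact: (lt_trans xb b2).
  rewrite !mxE.
  have /andP[_ ->] := xchooseP (ha i j).
  by have /andP[-> _] := xchooseP (hb i j).
apply: bigcupT_measurable => k; rewrite /F; case: pickle_inv => // p.
case: asboolP => // _.
rewrite (_ : _ @^-1` _ = \bigcap_i \bigcap_j
    (fun t => f t i j) @^-1` `]ratr (p.1 i j), ratr (p.2 i j)[); last first.
  apply/seteqP; split => t /= ht i; first by move=> _ j _ /=; rewrite in_itv /=.
  by move=> j; have := ht i Logic.I j Logic.I; rewrite /= in_itv.
apply: fin_bigcap_measurable => // i _; apply: fin_bigcap_measurable => // j _.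
by rewrite -[X in measurable X]setTI; apply: mf.
Qed.

End borel_matrix.

Section lebesgue_rV.
Context {R : realType}.

Definition cons_rV n (p : R * 'rV[R]_n) : 'rV[R]_n.+1 :=
  \row_i if unlift ord0 i is Some j then p.2 ord0 j else p.1.

Definition uncons_rV n (x : 'rV[R]_n.+1) : R * 'rV[R]_n :=
  (x ord0 ord0, \row_j x ord0 (lift ord0 j)).

Lemma uncons_rVK n : cancel (@uncons_rV n) (@cons_rV n).
Proof.
by move=> x; apply/rowP => i; rewrite mxE /=; case: unliftP => [j|] ->; rewrite ?mxE.
Qed.

Lemma cons_rVK n : cancel (@cons_rV n) (@uncons_rV n).
Proof.
move=> [r v]; rewrite /uncons_rV mxE unlift_none; congr pair.
by apply/rowP => i; rewrite !mxE liftK.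
Qed.

Lemma measurable_cons_rV n :
  measurable_fun [set: R * 'rV[R]_n] (@cons_rV n).
Proof.
apply: measurable_fun_mx => i j.
case: (unliftP ord0 j) => [l|] ->.
  rewrite (_ : (fun t => _) = (fun x : 'rV[R]_n => x ord0 l) \o snd); last first.
    by apply/funext => t; rewrite /= mxE liftK.
  by apply: measurableT_comp => //; exact: measurable_coord.
rewrite (_ : (fun t => _) = fst) //.
by apply/funext => t; rewrite mxE unlift_none.
Qed.

Lemma measurable_uncons_rV n :
  measurable_fun [set: 'rV[R]_n.+1] (@uncons_rV n).
Proof.
apply/measurable_fun_pair; first exact: measurable_coord.
apply: measurable_fun_mx => i j; under eq_fun do rewrite mxE.
exact: measurable_coord.
Qed.

Section cons_measure.
Variables (n : nat) (mu : {sigma_finite_measure set 'rV[R]_n -> \bar R}).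

Definition cons_measure : set 'rV[R]_n.+1 -> \bar R :=
  pushforward (lebesgue_measure \x mu)%E (@cons_rV n).

Let pushforward_cons :=
  measure_function_pushforward__canonical__measure_function_Measure
    (lebesgue_measure \x mu)%E (@measurable_cons_rV n).

Let cons_measure0 : cons_measure set0 = 0%E.
Proof. exact: (measure0 pushforward_cons). Qed.

Let cons_measure_ge0 A : (0 <= cons_measure A)%E.
Proof. exact: (measure_ge0 pushforward_cons). Qed.

Let cons_measure_sigma_additive : semi_sigma_additive cons_measure.
Proof. exact: (@measure_semi_sigma_additive _ _ _ pushforward_cons). Qed.

HB.instance Definition _ := isMeasure.Build _ _ _ cons_measure
  cons_measure0 cons_measure_ge0 cons_measure_sigma_additive.

Lemma cons_measureX (A : set R) (B : set 'rV[R]_n) :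
  measurable A -> measurable B ->
  cons_measure (@uncons_rV n @^-1` (A `*` B)) = (lebesgue_measure A * mu B)%E.
Proof.
move=> mA mB; rewrite -product_measure1E // /cons_measure /pushforward.
rewrite -comp_preimage (_ : _ \o _ = id) //.
by apply/funext => x /=; rewrite cons_rVK.
Qed.

Let cons_measure_sigma_finite : sigma_finite setT cons_measure.
Proof.
have /sigma_finiteP[F [TF ndF Foo]] := sigma_finiteT (@lebesgue_measure R).
have /sigma_finiteP[G [TG ndG Goo]] := sigma_finiteT mu.
exists (fun k => @uncons_rV n @^-1` (F k `*` G k)).
  apply/esym; rewrite -subTset => x _.
  have [i _ Fi] : (\bigcup_i F i) (uncons_rV x).1 by rewrite -TF.
  have [j _ Gj] : (\bigcup_i G i) (uncons_rV x).2 by rewrite -TG.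
  exists (maxn i j) => //; split.
    by move: Fi; exact/subsetPset/ndF/leq_maxl.
  by move: Gj; exact/subsetPset/ndG/leq_maxr.
move=> k; have [mF Fk] := Foo k; have [mG Gk] := Goo k; split.
  rewrite -[X in measurable X]setTI; apply: measurable_uncons_rV => //.
  exact: measurableX.
by rewrite cons_measureX// lte_mul_pinfty// ge0_fin_numE.
Qed.

HB.instance Definition _ := Measure_isSigmaFinite.Build _ _ _ cons_measure
  cons_measure_sigma_finite.

End cons_measure.

Fixpoint lebesgue_rV n : {sigma_finite_measure set 'rV[R]_n -> \bar R} :=
  match n with
  | 0 => dirac (0 : 'rV[R]_0)
  | m.+1 => cons_measure (lebesgue_rV m)
  end.

Lemma lebesgue_rV_box n (A : 'I_n -> set R) :
  (forall i, measurable (A i)) ->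
  lebesgue_rV n [set x | forall i, A i (x ord0 i)] =
  (\prod_(i < n) lebesgue_measure (A i))%E.
Proof.
elim: n A => [|n IH] A mA.
  by rewrite big_ord0 /= diracE mem_set // => -[].
pose B : set 'rV[R]_n := [set x | forall i, A (lift ord0 i) (x ord0 i)].
have mB : measurable B.
  rewrite (_ : B = \bigcap_i (fun x => x ord0 i) @^-1` A (lift ord0 i)).
    apply: fin_bigcap_measurable => // i _.
    by rewrite -[X in measurable X]setTI; apply: measurable_coord.
  by apply/seteqP; split => x /= Bx i; [move=> _|]; exact: Bx.
rewrite big_ord_recl -(IH (fun i => A (lift ord0 i))) // -/B.
rewrite /= -cons_measureX //.
congr (cons_measure _ _); apply/seteqP; split => x /=.
  by move=> Ax; split => [|i]; rewrite /= ?mxE; exact: Ax.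
case=> A0 Bx i; case: (unliftP ord0 i) => [j|] -> //.
by have := Bx j; rewrite mxE.
Qed.

End lebesgue_rV.

Section random_fields.
Context {R : realType} {d : measure_display} {Omega : measurableType d}.
Variable P : probability Omega R.

(* [normal_prob m 0] is not the Dirac measure at [m] in the library, so the
   degenerate Gaussian law is singled out. *)
Definition gaussian_rv (X : Omega -> R) : Prop :=
  measurable_fun setT X /\
  exists m s : R, 0 <= s /\
    forall A : set R, measurable A ->
      P (X @^-1` A) = if s == 0 then \d_m A else normal_prob m s A.

(* A field indexed by [D] is a total function on [I]; its values outside [D]
   are irrelevant. *)
Definition gaussian_field (I : Type) (D : set I) (X : I -> Omega -> R) : Prop :=
  forall (m : nat) (t : 'I_m -> I) (c : 'I_m -> R), (forall j, D (t j)) ->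
    gaussian_rv (fun w => \sum_(j < m) c j * X (t j) w).

Definition centered_field (I : Type) (D : set I) (X : I -> Omega -> R) : Prop :=
  forall t, D t -> ('E_P[X t] = 0)%E.

Definition field_sigma_algebra (I : Type) (D : set I) (X : I -> Omega -> R) :
    set (set Omega) :=
  <<s \bigcup_(t in D) preimage_set_system setT (X t) measurable >>.

Definition independent_fields (I : Type) (D : set I) (n : nat)
    (X : 'I_n -> I -> Omega -> R) : Prop :=
  forall (J : {set 'I_n}) (E : 'I_n -> set Omega),
    (forall i, i \in J -> field_sigma_algebra D (X i) (E i)) ->
    P (\bigcap_(i in [set i | i \in J]) E i) = (\prod_(i in J) P (E i))%E.

End random_fields.

Section euclidean_space.
Context {R : realType}.

(* The library's norm on ['rV[R]_n] is the sup norm. *)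
Definition enorm (n : nat) (x : 'rV[R]_n) : R :=
  Num.sqrt (\sum_(i < n) x ord0 i ^+ 2).

Definition orthant (k : nat) : set 'rV[R]_k :=
  [set t | forall i, 0 <= t ord0 i].

Definition unit_cube (k : nat) : set 'rV[R]_k :=
  [set t | forall i, 0 <= t ord0 i <= 1].

End euclidean_space.
Arguments orthant {R} k _.
Arguments unit_cube {R} k _.

Section fractional_brownian.
Context {R : realType} {d : measure_display} {Omega : measurableType d}.
Variable P : probability Omega R.

Record fractional_brownian_field1 (k : nat) (H : R)
    (b : 'rV[R]_k -> Omega -> R) : Prop := {
  fbf1_gaussian : gaussian_field P (orthant k) b ;
  fbf1_centered : centered_field P (orthant k) b ;
  fbf1_origin : {ae P, forall w, b 0 w = 0} ;
  fbf1_increment : forall s t, orthant k s -> orthant k t ->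
    ('E_P[fun w => (`|b t w - b s w| ^+ 2)%R] =
      (enorm (t - s) `^ (2 * H))%R%:E)%E }.

(* The components have the same law: the law of a centered Gaussian field that
   vanishes a.s. at 0 is determined by the variances of its increments. *)
Record fractional_brownian_field (k n : nat) (H : R)
    (B : 'rV[R]_k -> Omega -> 'rV[R]_n) : Prop := {
  fbf_component : forall i : 'I_n,
    fractional_brownian_field1 H (fun t w => B t w ord0 i) ;
  fbf_independent :
    independent_fields P (orthant k) (fun (i : 'I_n) t w => B t w ord0 i) ;
  fbf_continuous : forall w, {within orthant k, continuous (B ^~ w)} }.

End fractional_brownian.

Section occupation.
Context {R : realType}.

(* Only the values of [X] on the unit cube matter. *)
Definition occupation_measure (k n : nat) (X : 'rV[R]_k -> 'rV[R]_n) :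
    set 'rV[R]_n -> \bar R :=
  fun B => lebesgue_rV k (unit_cube k `&` X @^-1` B).

(* For [alpha < n] the kernel is [+oo] at the origin, whereas the library's
   [0 `^ (alpha - n)] is [0]. *)
Definition riesz_kernel (n : nat) (alpha : R) (x : 'rV[R]_n) : \bar R :=
  if x == 0 then +oo%E else (enorm x `^ (alpha - n%:R))%:E.

Definition riesz_potential (n : nat) (alpha : R) (mu : set 'rV[R]_n -> \bar R)
    (x : 'rV[R]_n) : \bar R :=
  (\int[mu]_y riesz_kernel alpha (x - y))%E.

Record density d (T : measurableType d) (mu nu : set T -> \bar R)
    (f : T -> R) : Prop := {
  density_measurable : measurable_fun setT f ;
  density_ge0 : forall x, 0 <= f x ;
  densityE : forall A, measurable A -> mu A = (\int[nu]_(x in A) (f x)%:E)%E }.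

Definition local_time (k n : nat) (X : 'rV[R]_k -> 'rV[R]_n)
    (L : 'rV[R]_n -> R) : Prop :=
  occupation_measure X `<< lebesgue_rV n /\
  density (occupation_measure X) (lebesgue_rV n) L.

Definition C_infty (n : nat) : set ('rV[R]_n -> R) :=
  [set f | continuous f /\
    forall e : R, 0 < e ->
      exists2 K : set 'rV[R]_n, compact K & forall x, ~ K x -> `|f x| < e].

End occupation.
Arguments C_infty {R} n _.

(* Main.v *)
(* Let [mu] be the occupation measure, [F] its Fourier transform and [M = |F|].
   Subordination writes both the Riesz kernel and its Fourier transform as
   mixtures of Gaussians, so the Riesz potential (resp. the density) of [mu] is
   up to a constant the inverse Fourier transform of [|xi| ^ (- alpha) F xi]
   (resp. of [F xi]), and it is in [C_infty] as soon as that function is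
   integrable, [mu] having bounded support. By Fubini and the Gaussian law of
   the increments,
     [E (M xi ^ 2) = \int\int exp (- |xi|^2 |t - s| ^ (2 H) / 2) dt ds],
   which is at most [1] and at most a constant times [|xi| ^ (- k / H)]. With
   [c xi ^ 2] one of these two bounds, AM-GM gives
   [M <= (M ^ 2 / c + c) / 2], a function of [xi] whose expectation is at most
   [c xi = O (|xi| ^ (- k / (2 H)))]; hence it is almost surely integrable
   against [|xi| ^ (- alpha)] when [alpha + k / (2 H) > n], and with [alpha = 0]
   when [k / (2 H) > n]. Sine and cosine transforms are kept real, and [1] is
   added to cosines so that Tonelli applies to nonnegative integrands. *)
Require Import Defs.
From HB Require Import structures.
From mathcomp Require Import all_boot all_order all_algebra.
From mathcomp Require Import all_classical all_reals all_analysis.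
From mathcomp Require Import ring lra measurable_realfun.

Set Implicit Arguments.
Unset Strict Implicit.
Unset Printing Implicit Defensive.

Import Order.TTheory GRing.Theory Num.Theory.
Import numFieldNormedType.Exports.

Local Open Scope classical_set_scope.
Local Open Scope ring_scope.

(** * Gaussian integrals *)

(** All pathwise estimates use one dominating function [D] of the frequency alone. In
    [fourier_cos m X x xi] the point [x] is only a phase, so a bound on the modulus of the transform
    serves every [x]: continuity and boundedness reduce to dominated convergence, and one event
    suffices for all [x]. Square integrability of the transform would hold already for [n < k / H],
    but only yields a square integrable density; asking for an integrable modulus is what costs the
    factor 2. AM-GM is preferred to Jensen because its outcome is affine in the energy, so that
    measurability and expectation are inherited from the energy. No inversion theorem is invoked.
    For the Riesz potential the representation is an identity between mixtures of Gaussians. For the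
    density, the measure is smoothed by Gaussians of deviation tending to 0; the smoothed densities
    converge boundedly to the inverse transform, and Chebyshev's inequality compares their mass on a
    box with that of slightly smaller and larger boxes. Exhausting boxes from inside then requires
    nothing about the mass of their boundaries. *)

Section improper_FTC.
Context {R : realType}.
Local Notation mu := (@lebesgue_measure R).

(** Integration by parts on the line: the fundamental theorem on [[- n, n]], then dominated
    convergence. The Gaussian moments and Stein's identity below follow by exhibiting a primitive
    that vanishes at both ends. *)
Lemma integrable_derive_eq0 (F f : R -> R) :
  (forall x : R, is_derive x 1 F (f x)) -> continuous f ->
  mu.-integrable setT (EFin \o f) ->
  F n%:R @[n --> \oo] --> 0 -> F (- n%:R) @[n --> \oo] --> 0 ->
  \int[mu]_x f x = 0.
Proof.
move=> dF cf intf Fy FNy.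
have mf : measurable_fun setT f by exact: continuous_measurable_fun.
pose I n : set R := [set` `[- n%:R : R, n%:R : R]].
have cF : continuous F.
  move=> x; apply: differentiable_continuous; apply/derivable1_diffP.
  by case: (dF x).
have intI n : (\int[mu]_x (EFin \o (f \_ (I n))) x)%E = (F n%:R - F (- n%:R))%:E.
  rewrite -restrict_EFin -integral_mkcond.
  case: n => [|n].
    by rewrite /I oppr0 set_itv1 integral_set1 subrr.
  rewrite /I (@continuous_FTC2 _ f F); first by rewrite EFinB.
  - by rewrite -subr_gt0 opprK -natrD ltr0n.
  - exact: continuous_subspaceT.
  - split => [x _||].
    + by case: (dF x).
    + exact/cvg_at_right_filter/cF.
    + exact/cvg_at_left_filter/cF.
  - by move=> x _; rewrite derive1E; apply: derive_val.
have mI n : measurable_fun setT (EFin \o (f \_ (I n))).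
  apply/measurable_EFinP; rewrite -(measurable_restrictT _ (measurable_itv _)).
  exact: measurable_funTS.
have [_ _ cv] : [/\ mu.-integrable setT (EFin \o f),
    [sequence (\int[mu]_x `|(f \_ (I n)) x - f x|%:E)%E]_n @ \oo --> 0%E &
    [sequence (\int[mu]_x (EFin \o (f \_ (I n))) x)%E]_n @ \oo --> (\int[mu]_x (EFin \o f) x)%E].
  apply: (@dominated_convergence _ _ _ mu setT measurableT
    (fun n => EFin \o (f \_ (I n))) (EFin \o f) (fun x => `|f x|%:E)) => //.
  - by apply/measurable_EFinP.
  - apply: aeW => x _; apply: cvg_near_cst.
    exists (Num.truncn `|x|).+1 => // m /= xm.
    rewrite patchE mem_set // /I /= in_itv /= -ler_norml.
    by apply: ltW; apply: (lt_le_trans (truncnS_gt _)); rewrite ler_nat.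
  - exact: integrable_norm.
  - apply: aeW => x n _ /=; rewrite lee_fin patchE.
    by case: ifPn => // _; rewrite normr0.
have : (EFin \o (fun n => F n%:R - F (- n%:R))) @ \oo --> 0%E.
  apply: cvg_EFin; first exact: nearW.
  rewrite -[X in _ --> X](subr0 0); exact: cvgB.
have -> : EFin \o (fun n => F n%:R - F (- n%:R)) =
   [sequence (\int[mu]_x (EFin \o (f \_ (I n))) x)%E]_n.
  by apply/funext => n /=; rewrite intI.
move=> /(cvg_unique (@ereal_hausdorff R) cv) /(congr1 fine).
by rewrite /Rintegral.
Qed.

End improper_FTC.

Section normal_moments.
Context {R : realType}.
Local Notation mu := (@lebesgue_measure R).

Lemma cvg_natr_of_quadratic_decay (h : R -> R) (K m : R) :
  (forall x, `|h x| * (1 + (x - m) ^+ 2) <= K) ->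
  h n%:R @[n --> \oo] --> 0 /\ h (- n%:R) @[n --> \oo] --> 0.
Proof.
move=> hK; have K0 : 0 <= K.
  by apply: le_trans (hK 0); rewrite mulr_ge0// addr_ge0// sqr_ge0.
have small (e : R) : 0 < e -> exists N : nat, forall x : R, N%:R <= `|x| -> `|h x| < e.
  move=> e0; have Ke0 : 0 <= K / e by rewrite divr_ge0// ltW.
  (* This makes [|x - m|] at least [K / e + 1], so that its square already exceeds [K / e]. *)
  exists (Num.truncn (`|m| + K / e + 1)).+1 => x Nx.
  have big : K / e < (x - m) ^+ 2.
    have lo : K / e + 1 <= `|x - m|.
      have := lerB_dist x m.
      have := ltW (truncnS_gt (`|m| + K / e + 1)); lra.
    rewrite -real_normK ?num_real//; nra.
  have Ke : K < e * (1 + (x - m) ^+ 2).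
    by rewrite mulrDr mulr1 ltr_wpDl ?ltW// -ltr_pdivrMl// mulrC.
  have := le_lt_trans (hK x) Ke; rewrite ltr_pM2r//.
  by rewrite ltr_pwDl// sqr_ge0.
split; apply/cvgr0Pnorm_lt => e /small[N hN]; near=> n; apply: hN;
  rewrite ?normrN normr_nat ler_nat; near: n; exact: nbhs_infty_ge.
Unshelve. all: by end_near. Qed.

Variables (m s : R).
Hypothesis s0 : s != 0.
Local Notation phi := (normal_pdf m s).

Lemma normal_pdf_expR x :
  phi x = normal_peak s * expR (- (x - m) ^+ 2 / (s ^+ 2 *+ 2)).
Proof. by rewrite normal_pdfE. Qed.

Lemma is_derive_normal_pdf (x : R) :
  is_derive x (1 : R) (phi : R -> R) (- ((x - m) / s ^+ 2) * phi x).
Proof.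
rewrite normal_pdfE //.
have -> : (fun x => normal_peak s * normal_fun m s x) =
   normal_peak s *: (expR \o (fun x => - (x - m) ^+ 2 / (s ^+ 2 *+ 2))).
  by apply/funext => y.
apply: is_derive_eq.
rewrite /=.
transitivity (normal_peak s * (expR (- (x - m) ^+ 2 / (s ^+ 2 *+ 2)) *
  (- (x - m) ^+ 2 * 0 + (s ^+ 2 *+ 2)^-1 * - ((x - m) * (1 - 0) + (x - m) * (1 - 0))))); first by [].
rewrite /normal_fun -[s ^+ 2 *+ 2]mulr_natr.
set E := expR _.
by field.
Qed.

(** Half of the exponent pays for the polynomial. With [y = (x - m) ^ 2 / (4 s ^ 2)] the density is
    a multiple of [exp (- 2 y)]; one factor [exp (- y)] absorbs [1 + y], the other is a Gaussian of
    deviation [sqrt 2 * s], hence integrable. *)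
Lemma normal_pdf_quadratic_bound : exists2 C : R, 0 < C &
  forall x, (1 + (x - m) ^+ 2) * phi x <= C * normal_pdf m (Num.sqrt 2 * s) x.
Proof.
have t0 : Num.sqrt 2 * s != 0 :> R by rewrite mulf_neq0// gt_eqF// sqrtr_gt0.
have p0 := normal_peak_gt0 s0; have q0 := normal_peak_gt0 t0.
have ss0 : 0 < s ^+ 2 by rewrite exprn_even_gt0.
exists ((1 + s ^+ 2 *+ 4) * normal_peak s / normal_peak (Num.sqrt 2 * s)).
  by rewrite divr_gt0// mulr_gt0// addr_gt0// mulrn_wgt0.
move=> x; rewrite normal_pdf_expR (normal_pdfE _ t0) /normal_fun.
rewrite exprMn sqr_sqrtr//.
set y := (x - m) ^+ 2 / (s ^+ 2 *+ 4).
have -> : - (x - m) ^+ 2 / (s ^+ 2 *+ 2) = - y - y.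
  by rewrite /y -[_ *+ 4]mulr_natr -[_ *+ 2]mulr_natr; field.
have -> : - (x - m) ^+ 2 / (2 * s ^+ 2 *+ 2) = - y.
  by rewrite /y -[_ *+ 4]mulr_natr -[_ *+ 2]mulr_natr; field.
have -> : (x - m) ^+ 2 = y * (s ^+ 2 *+ 4) by rewrite divfK// gt_eqF// mulrn_wgt0.
rewrite expRD.
have y0 : 0 <= y by rewrite divr_ge0 ?sqr_ge0// mulrn_wge0// ltW.
have ey : (1 + y) * expR (- y) <= 1.
  by rewrite expRN ler_pdivrMr ?expR_gt0// mul1r expR_ge1Dx.
have E0 := expR_gt0 (- y).
set E := expR (- y) in ey E0 *.
have -> : (1 + s ^+ 2 *+ 4) * normal_peak s / normal_peak (Num.sqrt 2 * s) *
  (normal_peak (Num.sqrt 2 * s) * E) = (1 + s ^+ 2 *+ 4) * E * normal_peak s.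
  by field; rewrite gt_eqF.
rewrite [leLHS](_ : _ = ((1 + y * (s ^+ 2 *+ 4)) * E) * E * normal_peak s); last by ring.
rewrite ler_pM2r// ler_pM2r//.
have yE : y * E <= 1 by nra.
have E1 : E <= 1 by nra.
have : y * E * (s ^+ 2 *+ 4) <= 1 * (s ^+ 2 *+ 4) by rewrite ler_wpM2r// mulrn_wge0// ltW.
lra.
Qed.

Lemma normal_pdf_decay : exists K : R,
  forall x, phi x * (1 + (x - m) ^+ 2) <= K.
Proof.
have [C C0 hC] := normal_pdf_quadratic_bound.
exists (C * normal_peak (Num.sqrt 2 * s)) => x.
rewrite mulrC; apply: (le_trans (hC x)); rewrite ler_pM2l// normal_pdf_ub//.
by rewrite mulf_neq0// gt_eqF// sqrtr_gt0.
Qed.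

Lemma integrable_quadratic_normal_pdf (h : R -> R) (K : R) :
  measurable_fun setT h -> (forall x, `|h x| <= K * (1 + (x - m) ^+ 2)) ->
  mu.-integrable setT (fun x => (h x * phi x)%:E).
Proof.
move=> mh hK; have [C C0 hC] := normal_pdf_quadratic_bound.
apply: (@le_integrable _ _ _ mu setT measurableT _
  (fun x => (K * C)%:E * (normal_pdf m (Num.sqrt 2 * s) x)%:E)%E).
- by apply/measurable_EFinP; apply: measurable_funM => //; exact: measurable_normal_pdf.
- move=> x _ /=; rewrite lee_fin normrM (ger0_norm (normal_pdf_ge0 _ _ _)).
  apply: le_trans (ler_norm _); rewrite -mulrA.
  have K0 : 0 <= K.
    have := hK m; rewrite subrr expr0n addr0 mulr1; exact: le_trans.
  apply: le_trans (ler_wpM2l K0 (hC x)).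
  by rewrite mulrA ler_wpM2r// normal_pdf_ge0.
- by apply: integrableZl => //; exact: integrable_normal_pdf.
Qed.

End normal_moments.

Section normal_integrals.
Context {R : realType}.
Local Notation mu := (@lebesgue_measure R).
Variables (m s : R).
Hypothesis s0 : s != 0.
Local Notation phi := (normal_pdf m s).

(** The integrand is the derivative of [- s ^+ 2 * phi]. *)
Lemma integral_center_normal_pdf : (\int[mu]_x ((x - m) * phi x)%:E = 0)%E.
Proof.
have i1 : mu.-integrable setT (fun x => ((x - m) * phi x)%:E).
  apply: (@integrable_quadratic_normal_pdf _ m s s0 (fun x => x - m) 1).
    exact: measurable_funB.
  move=> x; rewrite mul1r -(real_normK (num_real (x - m))).
  by have := sqr_ge0 (`|x - m| - 1); nra.
suff : \int[mu]_x ((x - m) * phi x) = 0.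
  rewrite /Rintegral => h; rewrite -[LHS]fineK ?h//.
  exact: integrable_fin_num.
have [K hK] := normal_pdf_decay m s0.
have /(@cvg_natr_of_quadratic_decay _ (fun x => - s ^+ 2 * phi x))[c1 c2] :
    forall x, `|- s ^+ 2 * phi x| * (1 + (x - m) ^+ 2) <= s ^+ 2 * K => [x|].
  rewrite normrM normrN (ger0_norm (normal_pdf_ge0 _ _ _)) ger0_norm ?sqr_ge0//.
  by rewrite -mulrA ler_wpM2l ?sqr_ge0.
apply: (integrable_derive_eq0 _ _ i1 c1 c2).
- move=> x; have hd := is_derive_normal_pdf m s0 x.
  have := @is_deriveZ _ _ _ _ (- s ^+ 2) _ _ _ hd.
  move=> /is_derive_eq; apply.
  transitivity (- s ^+ 2 * (- ((x - m) / s ^+ 2) * phi x)); first by [].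
  by field.
- move=> x; apply: cvgM; last exact: continuous_normal_pdf.
  by apply: cvgB; [exact: cvg_id|exact: cvg_cst].
Qed.

(** The derivative of [(x - m) * phi x] is [phi x - (x - m) ^+ 2 / s ^+ 2 * phi x]; it integrates to
    0, and its first term to 1. *)
Lemma integral_sqr_center_normal_pdf :
  (\int[mu]_x ((x - m) ^+ 2 * phi x)%:E = (s ^+ 2)%:E)%E.
Proof.
have i2 : mu.-integrable setT (fun x => ((x - m) ^+ 2 * phi x)%:E).
  apply: (@integrable_quadratic_normal_pdf _ m s s0 (fun x => (x - m) ^+ 2) 1).
    by apply: measurable_funX; exact: measurable_funB.
  by move=> x; rewrite ger0_norm ?sqr_ge0// mul1r lerDr.
pose f x := phi x - (x - m) ^+ 2 / s ^+ 2 * phi x.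
have iphi : mu.-integrable setT (fun x => (phi x)%:E) by exact: integrable_normal_pdf.
have i3 : mu.-integrable setT (fun x => ((s ^+ 2)^-1%:E * ((x - m) ^+ 2 * phi x)%:E)%E).
  exact: integrableZl.
have fE x : ((f x)%:E = (phi x)%:E - (s ^+ 2)^-1%:E * ((x - m) ^+ 2 * phi x)%:E)%E.
  by rewrite -EFinM -EFinB /f; congr (_%:E); congr (_ - _); ring.
have i4 : mu.-integrable setT (EFin \o f).
  have -> : EFin \o f = (fun x => ((phi x)%:E - (s ^+ 2)^-1%:E * ((x - m) ^+ 2 * phi x)%:E)%E).
    by apply/funext => x /=; rewrite fE.
  exact: integrableB.
have f0 : \int[mu]_x f x = 0.
  have [C C0 hC] := normal_pdf_quadratic_bound m s0.
  have t0 : Num.sqrt 2 * s != 0 :> R by rewrite mulf_neq0// gt_eqF// sqrtr_gt0.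
  have [K hK] := normal_pdf_decay m t0.
  have /(@cvg_natr_of_quadratic_decay _ (fun x => (x - m) * phi x))[c1 c2] :
      forall x, `|(x - m) * phi x| * (1 + (x - m) ^+ 2) <= C * K => [x|].
    rewrite normrM (ger0_norm (normal_pdf_ge0 _ _ _)).
    apply: (@le_trans _ _ ((C * normal_pdf m (Num.sqrt 2 * s) x) * (1 + (x - m) ^+ 2))); last first.
      by rewrite -mulrA ler_pM2l.
    rewrite ler_wpM2r ?addr_ge0 ?sqr_ge0//; apply: le_trans (hC x).
    rewrite ler_wpM2r ?normal_pdf_ge0//.
    rewrite -(real_normK (num_real (x - m))).
    by have := sqr_ge0 (`|x - m| - 1); nra.
  apply: (integrable_derive_eq0 _ _ i4 c1 c2).
  - move=> x; have hd := is_derive_normal_pdf m s0 x.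
    have hx : is_derive x (1 : R) (fun x : R => x - m) (1 : R).
      by apply: is_derive_eq; rewrite subr0.
    have := @is_deriveM _ _ _ _ _ _ _ _ hx hd; move=> /is_derive_eq; apply.
    transitivity ((x - m) * (- ((x - m) / s ^+ 2) * phi x) + phi x * 1); first by [].
    by rewrite /f; field.
  - move=> x; apply: cvgB; first exact: continuous_normal_pdf.
    apply: cvgM; last exact: continuous_normal_pdf.
    apply: cvgM; last exact: cvg_cst.
    apply: (@cvg_comp _ _ _ (fun x => x - m) (fun x => x ^+ 2)); last exact: sqr_continuous.
    by apply: cvgB; [exact: cvg_id|exact: cvg_cst].
have f0' : (\int[mu]_x (f x)%:E = 0)%E.
  by rewrite -[LHS]fineK ?(f0 : fine _ = 0)//; exact: integrable_fin_num.
have v := integrable_fin_num measurableT i2.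
move: f0'; under eq_integral do rewrite fE.
rewrite integralB// integral_normal_pdf integralZl//.
rewrite -(fineK v) -EFinM -EFinB => -[] h.
congr (_%:E); move/eqP: h; rewrite subr_eq0 => /eqP h.
by rewrite -[RHS]mulr1 h mulVKf// sqrf_eq0.
Qed.

End normal_integrals.

Lemma normal_prob_chebyshev (R : realType) (m s e : R) (A : set R) :
  s != 0 -> 0 < e -> measurable A ->
  (forall x, A x -> e <= `|x - m|) ->
  (normal_prob m s A <= ((s / e) ^+ 2)%:E)%E.
Proof.
move=> s0 e0 mA Ae; rewrite /normal_prob.
have mf : measurable_fun setT (fun x : R => ((x - m) ^+ 2 * normal_pdf m s x)%:E).
  apply/measurable_EFinP; apply: measurable_funM; last exact: measurable_normal_pdf.
  by apply: measurable_funX; exact: measurable_funB.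
apply: (@le_trans _ _ (\int[lebesgue_measure]_(x in A) ((e ^+ 2)^-1%:E * ((x - m) ^+ 2 * normal_pdf m s x)%:E)))%E.
  apply: ge0_le_integral => //.
  - by move=> x _; rewrite lee_fin normal_pdf_ge0.
  - by apply/measurable_EFinP/measurable_funTS; exact: measurable_normal_pdf.
  - by apply: measurable_funTS; apply: emeasurable_funM.
  - move=> x /Ae ex; rewrite -EFinM lee_fin mulrA ler_peMl ?normal_pdf_ge0//.
    rewrite mulrC ler_pdivlMr ?exprn_gt0// mul1r -[leRHS]real_normK ?num_real//.
    by rewrite lerXn2r// nnegrE ltW.
rewrite ge0_integralZl//; last 2 first.
- by move=> x _; rewrite lee_fin mulr_ge0 ?sqr_ge0 ?normal_pdf_ge0.
- by rewrite lee_fin invr_ge0 sqr_ge0.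
- rewrite expr_div_n mulrC EFinM lee_wpmul2l// ?lee_fin ?invr_ge0 ?sqr_ge0//.
  rewrite -(integral_sqr_center_normal_pdf m s0).
  apply: ge0_subset_integral => //.
  by move=> x _; rewrite lee_fin mulr_ge0 ?sqr_ge0 ?normal_pdf_ge0.
- exact: measurable_funTS.
Qed.

Section normal_characteristic_function.
Context {R : realType}.
Local Notation mu := (@lebesgue_measure R).
Variable s : R.
Hypothesis s0 : s != 0.
Local Notation phi := (normal_pdf 0 s).
Variable a : R.

(** The phase [a] prepares the induction on the dimension, where the coordinates not yet integrated
    enter as a phase. It stands in for the multiplicativity of the complex exponential. *)
Let J (xi : R) := \int[mu]_x (cos (a + xi * x) * phi x).

Lemma measurable_cos_affine (b : R) : measurable_fun setT (fun x : R => cos (a + b * x)).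
Proof.
apply: measurableT_comp; first exact: continuous_measurable_fun (@continuous_cos R).
by apply: measurable_funD => //; exact: measurable_funM.
Qed.

Let intJ xi : mu.-integrable setT (fun x => (cos (a + xi * x) * phi x)%:E).
Proof.
apply: (@integrable_quadratic_normal_pdf _ 0 s s0 (fun x => cos (a + xi * x)) 1).
  exact: measurable_cos_affine.
by move=> x; rewrite mul1r (le_trans (cos_max _))// lerDl sqr_ge0.
Qed.

Let dJ (xi x : R) : is_derive xi (1 : R) (fun xi => cos (a + xi * x) * phi x)
  (- sin (a + xi * x) * x * phi x).
Proof.
apply: is_derive_eq.
transitivity (cos (a + xi * x) * 0 + phi x * (- sin (a + xi * x) * ((0 + 1) * (xi * 0 + x * 1)))); first by [].
ring.
Qed.

Let int_sin xi : mu.-integrable setT (fun x => (sin (a + xi * x) * x * phi x)%:E).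
Proof.
apply: (@integrable_quadratic_normal_pdf _ 0 s s0 (fun x => sin (a + xi * x) * x) 1).
  apply: measurable_funM => //; apply: measurableT_comp.
    exact: continuous_measurable_fun (@continuous_sin R).
  by apply: measurable_funD => //; exact: measurable_funM.
move=> x; rewrite subr0 mul1r normrM.
apply: (@le_trans _ _ (1 * `|x|)); first by rewrite ler_wpM2r// sin_max.
rewrite -(real_normK (num_real x)).
by have := sqr_ge0 (`|x| - 1); nra.
Qed.

(** Stein's identity: the derivative of [sin (a + xi * x) * phi x] has integral zero. *)
Let stein xi : \int[mu]_x (sin (a + xi * x) * x * phi x) = s ^+ 2 * xi * J xi.
Proof.
pose f x := xi * (cos (a + xi * x) * phi x) - (s ^+ 2)^-1 * (sin (a + xi * x) * x * phi x).
have fE : EFin \o f = (fun x => xi%:E * (cos (a + xi * x) * phi x)%:E -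
    ((s ^+ 2)^-1)%:E * (sin (a + xi * x) * x * phi x)%:E)%E.
  by apply/funext => x.
have i4 : mu.-integrable setT (EFin \o f).
  by rewrite fE; apply: integrableB => //; exact: integrableZl.
have f0 : \int[mu]_x f x = 0.
  have [K hK] := normal_pdf_decay 0 s0.
  have /(@cvg_natr_of_quadratic_decay _ (fun x => sin (a + xi * x) * phi x))[c1 c2] :
      forall x, `|sin (a + xi * x) * phi x| * (1 + (x - 0) ^+ 2) <= K => [x|].
    apply: le_trans (hK x); rewrite ler_wpM2r ?addr_ge0 ?sqr_ge0//.
    rewrite normrM (ger0_norm (normal_pdf_ge0 _ _ _)) ler_piMl ?normal_pdf_ge0//.
    exact: sin_max.
  apply: (integrable_derive_eq0 _ _ i4 c1 c2).
  - move=> x; have hd := is_derive_normal_pdf 0 s0 x.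
    have hs : is_derive x (1 : R) (fun x : R => sin (a + xi * x)) (cos (a + xi * x) * xi).
      apply: is_derive_eq.
      transitivity (cos (a + xi * x) * ((0 + 1) * (xi * 1))); [by []|ring].
    have := @is_deriveM _ _ _ _ _ _ _ _ hs hd; move=> /is_derive_eq; apply.
    transitivity (sin (a + xi * x) * (- ((x - 0) / s ^+ 2) * phi x) +
       phi x * (cos (a + xi * x) * xi)); first by [].
    by rewrite /f; field.
  - have cphi : continuous phi by exact: continuous_normal_pdf.
    have caff x : (fun x => a + xi * x) @ x --> a + xi * x.
      by apply: cvgD; [exact: cvg_cst|apply: cvgM; [exact: cvg_cst|exact: cvg_id]].
    move=> x; apply: cvgB; (apply: cvgM; first exact: cvg_cst).
      apply: cvgM; last exact: cphi.
      by apply: cvg_comp (caff x) _; exact: continuous_cos.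
    apply: cvgM; last exact: cphi.
    apply: cvgM; last exact: cvg_id.
    by apply: cvg_comp (caff x) _; exact: continuous_sin.
move: f0; rewrite RintegralB//; last 2 first.
- exact: (integrableZl measurableT xi (intJ xi)).
- exact: (integrableZl measurableT (s ^+ 2)^-1 (int_sin xi)).
rewrite (RintegralZl _ measurableT (intJ xi)) (RintegralZl _ measurableT (int_sin xi)).
rewrite -/(J xi) => /eqP; rewrite subr_eq0 => /eqP h.
by rewrite -mulrA h mulVKf// sqrf_eq0.
Qed.

(** Differentiation under the integral, dominated by [|x| * phi x], produces the sine integral of
    [stein], which closes into the linear equation [J' = - s ^ 2 xi J]. *)
Let is_derive_J xi : is_derive xi (1 : R) (J : R -> R) (- (s ^+ 2 * xi) * J xi).
Proof.
have Ixi : `]xi - 1, xi + 1[%classic xi by rewrite /= in_itv /=; apply/andP; split; lra.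
pose G x := `|x| * phi x.
have G0 x : 0 <= G x by rewrite mulr_ge0// normal_pdf_ge0.
have intG : mu.-integrable setT (EFin \o G).
  apply: (@integrable_quadratic_normal_pdf _ 0 s s0 (fun x => `|x|) 1).
    exact: measurableT_comp.
  move=> x; rewrite subr0 mul1r normr_id -(real_normK (num_real x)).
  by have := sqr_ge0 (`|x| - 1); nra.
have dE x y : partial1of2 (fun xi x : R => cos (a + xi * x) * phi x) x y =
    - sin (a + x * y) * y * phi y.
  by rewrite partial1of2E; case: (dJ x y).
have dbound (x y : R) : `]xi - 1, xi + 1[%classic x -> setT y ->
    `|partial1of2 (fun xi x : R => cos (a + xi * x) * phi x) x y| <= G y.
  move=> _ _; rewrite dE !normrM normrN (ger0_norm (normal_pdf_ge0 _ _ _)).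
  rewrite ler_wpM2r ?normal_pdf_ge0// ler_piMl// sin_max//.
have der (x y : R) : `]xi - 1, xi + 1[%classic x -> [set: R] y ->
    derivable (fun xi : R => cos (a + xi * y) * phi y) x (1 : R).
  by move=> _ _; case: (dJ x y).
apply: DeriveDef.
  by apply: (derivable_under_integral measurableT Ixi (fun x _ => intJ x) der G0 intG dbound).
rewrite -derive1E.
rewrite (differentiation_under_integral measurableT Ixi (fun x _ => intJ x) der G0 intG dbound).
under eq_Rintegral do rewrite dE -mulrA mulNr mulrA -mulN1r.
by rewrite (RintegralZl _ measurableT (int_sin xi)) stein; ring.
Qed.

(** The integrating factor [exp (s ^ 2 x ^ 2 / 2)] makes [J] constant; the constant is read off at
    0. *)
Lemma integral_cos_normal_pdf xi :
  \int[mu]_x (cos (a + xi * x) * phi x) = cos a * expR (- (s ^+ 2 * xi ^+ 2) / 2).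
Proof.
pose h (x : R) := J x * expR (s ^+ 2 * x ^+ 2 / 2).
have dh x : is_derive x (1 : R) (h : R -> R) 0.
  have h1 := is_derive_J x.
  have h2 : is_derive x (1 : R) (fun x : R => expR (s ^+ 2 * x ^+ 2 / 2))
      (expR (s ^+ 2 * x ^+ 2 / 2) * (s ^+ 2 * x)).
    apply: is_derive_eq.
    transitivity (expR (s ^+ 2 * x ^+ 2 / 2) * (s ^+ 2 * x ^+ 2 * (- 2 ^- 2 * 0) +
      2^-1 * (s ^+ 2 * (x * 1 + x * 1)))); first by [].
    by field.
  have := @is_deriveM _ _ _ _ _ _ _ _ h1 h2; move=> /is_derive_eq; apply.
  transitivity (J x * (expR (s ^+ 2 * x ^+ 2 / 2) * (s ^+ 2 * x)) +
    expR (s ^+ 2 * x ^+ 2 / 2) * (- (s ^+ 2 * x) * J x)); first by [].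
  ring.
have := is_derive_0_is_cst xi 0 dh.
have -> : h 0 = cos a.
  rewrite /h expr0n /= mulr0 mul0r expR0 mulr1 /J.
  under eq_Rintegral do rewrite mul0r addr0.
  rewrite (RintegralZl _ measurableT (integrable_normal_pdf 0 s)).
  by rewrite /Rintegral integral_normal_pdf mulr1.
rewrite /h -/(J xi) mulNr expRN => <-.
by rewrite mulfK// gt_eqF// expR_gt0.
Qed.

Lemma integrable_cos_normal_pdf xi :
  mu.-integrable setT (fun x => (cos (a + xi * x) * phi x)%:E).
Proof. exact: intJ. Qed.

End normal_characteristic_function.

(** * Subordination of power kernels *)

Section subordination.
Context {R : realType}.
Local Notation mu := (@lebesgue_measure R).

Lemma integral_expR_Nnorm (b : R) : 0 < b ->
  (\int[mu]_x (expR (- (b * `|x|)))%:E < +oo)%E.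
Proof.
move=> b0; rewrite ge0_symfun_integralT.
- have -> : [set x : R | 0 <= x] = `[0, +oo[%classic.
    by apply/seteqP; split => x /=; rewrite in_itv /= andbT.
  rewrite (_ : (\int[mu]_(x in _) _ = \int[mu]_(x in `[0%R, +oo[) (expR (- b * x))%:E)%E); last first.
    apply: eq_integral => x; rewrite inE /= in_itv /= andbT => x0.
    by rewrite ger0_norm// mulNr.
  rewrite (@ge0_continuous_FTC2y _ _ (fun x => - b^-1 * expR (- b * x)) 0 0).
  + by rewrite -EFinB -EFinM ltry.
  + by move=> x _; exact: expR_ge0.
  + apply: continuous_subspaceT => x.
    apply: (@cvg_comp _ _ _ (fun x => - b * x) expR); last exact: continuous_expR.
    by apply: cvgM; [exact: cvg_cst|exact: cvg_id].
  + rewrite -(mulr0 (- b^-1)); apply: cvgM; first exact: cvg_cst.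
    have := @cvgr_expR R.
    under [X in _ -> X @ _ --> _]eq_fun do rewrite mulNr.
    move=> h; apply: (@cvg_comp _ _ _ (fun x => b * x) (fun x => expR (- x))); last exact: h.
    by apply: gt0_cvgMry => //; exact: cvg_id.
  + by move=> x _; apply: derivableM => //; apply: diff_derivable.
  + apply: cvg_at_right_filter; apply: cvgM; first exact: cvg_cst.
    apply: (@cvg_comp _ _ _ (fun x => - b * x) expR); last exact: continuous_expR.
    by apply: cvgM; [exact: cvg_cst|exact: cvg_id].
  + move=> x _; rewrite derive1E.
    have h : is_derive x (1 : R) (fun x : R => - b^-1 * expR (- b * x)) (expR (- b * x)).
      apply: is_derive_eq.
      transitivity (- b^-1 * (expR (- b * x) * (- b * 1))); first by [].
      by field; rewrite gt_eqF.
    by case: h.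
- by move=> x; exact: expR_ge0.
- move=> x; apply: (@cvg_comp _ _ _ (fun x => - (b * `|x|)) expR); last exact: continuous_expR.
  by apply: cvgN; apply: cvgM; [exact: cvg_cst|exact: norm_continuous].
- by move=> x /=; rewrite normrN.
Qed.

(* With [r = exp u], a mixture of the Gaussians [exp (- (r y) ^ 2 / 2)] if
   [e = 1], and of their Fourier transforms in [y] (up to a power of [r]) if
   [e = - 1]; both are multiples of [y ^ (- a)]. *)
Definition subordination (a e y : R) : \bar R :=
  (\int[mu]_u (expR (e * a * u - y ^+ 2 * expR (2 * e * u) / 2))%:E)%E.

Lemma continuous_subordination (a e y : R) :
  continuous (fun u => expR (e * a * u - y ^+ 2 * expR (2 * e * u) / 2)).
Proof.
move=> u; apply: (@cvg_comp _ _ _ (fun u => e * a * u - y ^+ 2 * expR (2 * e * u) / 2) expR); last exact: continuous_expR.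
apply: cvgB; first by apply: cvgM; [exact: cvg_cst|exact: cvg_id].
apply: cvgM; last exact: cvg_cst.
apply: cvgM; first exact: cvg_cst.
apply: (@cvg_comp _ _ _ (fun u => 2 * e * u) expR); last exact: continuous_expR.
by apply: cvgM; [exact: cvg_cst|exact: cvg_id].
Qed.

Lemma measurable_subordination (a e y : R) :
  measurable_fun setT (fun u => expR (e * a * u - y ^+ 2 * expR (2 * e * u) / 2)).
Proof. by apply: continuous_measurable_fun; exact: continuous_subordination. Qed.

(** Translate [u] by [e * ln y]. As [e ^+ 2 = 1], the inner exponential is multiplied by
    [y ^ (- 2)], which cancels [y ^+ 2], and the linear term contributes the factor [y ^ (- a)]. *)
Lemma subordination_scale (a e y : R) : e ^+ 2 = 1 -> 0 < y ->
  subordination a e y = ((y `^ (- a))%:E * subordination a e 1)%E.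
Proof.
move=> e1 y0; rewrite /subordination.
pose F u := u - e * ln y.
have dF u : is_derive u (1 : R) (F : R -> R) (1 : R).
  by apply: is_derive_eq; rewrite subr0.
have F'E : F^`()%classic = cst 1.
  by apply/funext => u; rewrite derive1E; apply: derive_val.
rewrite (@increasing_ge0_integration_by_substitutionT _ F); last 9 first.
- by move=> u v uv; rewrite /F ltrD2r.
- by rewrite F'E; exact: cst_continuous.
- by rewrite F'E; exact: is_cvg_cst.
- by rewrite F'E; exact: is_cvg_cst.
- by move=> u; case: (dF u).
- exact: cvg_addrr_Ny.
- exact: cvg_addrr.
- exact: continuous_subordination.
- by move=> u; exact: expR_ge0.
rewrite -ge0_integralZl//; last 2 first.
- apply/measurable_EFinP; apply: measurable_subordination.
- by rewrite lee_fin powR_ge0.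
apply: eq_integral => u _; rewrite F'E /= -EFinM; congr (_%:E).
rewrite !fctE mulr1 /F /powR gt_eqF// -expRD; congr expR.
have -> : e * a * (u - e * ln y) = e * a * u + - a * ln y.
  by rewrite mulrBr -[X in _ - X]mulrA [a * _]mulrCA (mulrA e e) -expr2 e1; ring.
have -> : 2 * e * (u - e * ln y) = 2 * e * u - 2 * ln y.
  by rewrite mulrBr mulrA -[_ * e * e]mulrA -expr2 e1 mulr1.
rewrite expRD expRN.
have -> : expR (2 * ln y) = y ^+ 2.
  by rewrite expRM_natl lnK// posrE.
rewrite expr1n mul1r.
have -> : y ^+ 2 * (expR (2 * e * u) / y ^+ 2) = expR (2 * e * u).
  by rewrite mulrCA divff ?mulr1// sqrf_eq0 gt_eqF.
ring.
Qed.

(** Put [v = e * u]. For [v < 0] the linear term [a * v] decays by itself. For [v >= 0] the inner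
    exponential is at least [v ^ 2], and completing the square in [(a + 1) * v - v ^ 2 / 2] gives
    the constant [(a + 1) ^ 2 / 2], leaving a decay [- v]. *)
Lemma subordination_lty (a e : R) : 0 < a -> e ^+ 2 = 1 ->
  (subordination a e 1 < +oo)%E.
Proof.
move=> a0 e1; set b := Num.min a 1.
have b0 : 0 < b by rewrite lt_min a0 ltr01.
have ba : b <= a by rewrite ge_min lexx.
have b1 : b <= 1 by rewrite ge_min lexx orbT.
apply: (@le_lt_trans _ _ (\int[mu]_x ((expR ((a + 1) ^+ 2 / 2))%:E * (expR (- (b * `|x|)))%:E))%E).
  apply: ge0_le_integral => //.
  - apply/measurable_EFinP; apply: measurable_subordination.
  - apply/measurable_EFinP; apply: measurable_funM => //; apply: measurableT_comp => //.
    apply: measurableT_comp => //; apply: measurable_funM => //; exact: measurableT_comp.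
  - move=> u _; rewrite -EFinM lee_fin -expRD ler_expR expr1n mul1r -mulrA -mulrA.
    have -> : e * (a * u) = a * (e * u) by ring.
    have -> : `|u| = `|e * u|.
      have : `|e| ^+ 2 = 1 by rewrite real_normK ?num_real.
      by move=> /eqP; rewrite sqrp_eq1// => /eqP ee; rewrite normrM ee mul1r.
    set v := e * u.
    have [v0|v0] := leP 0 v.
      have ev : 1 + v <= expR v by exact: expR_ge1Dx.
      rewrite expRM_natl ger0_norm//.
      have : v ^+ 2 <= expR v ^+ 2 by rewrite lerXn2r ?nnegrE ?expR_ge0//; lra.
      have := sqr_ge0 (v - (a + 1)).
      have : b * v <= v by rewrite ler_piMl.
      nra.
    rewrite ltr0_norm//.
    have := expR_ge0 (2 * v); have := sqr_ge0 (a + 1).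
    have : b * (- v) <= a * (- v) by rewrite ler_pM2r// oppr_gt0.
    lra.
rewrite ge0_integralZl//.
- by rewrite lte_mul_pinfty ?lee_fin ?expR_ge0// integral_expR_Nnorm.
- apply/measurable_EFinP; apply: measurableT_comp => //.
  apply: measurableT_comp => //; apply: measurable_funM => //; exact: measurableT_comp.
Qed.

Lemma subordination_gt0 (a : R) : 0 < a -> (0 < subordination a 1 1)%E.
Proof.
move=> a0; rewrite /subordination.
apply: (@lt_le_trans _ _ (\int[mu]_(x in `[0%R, 1%R]) (cst (expR (- (expR 2 / 2)))%:E x))%E).
  by rewrite integral_cst//= lebesgue_measure_itv/= lte_fin ltr01 sube0 mule1 lte_fin expR_gt0.
apply: (@le_trans _ _ (\int[mu]_(u in `[0%R, 1%R]) (expR (1 * a * u - 1 ^+ 2 * expR (2 * 1 * u) / 2))%:E)%E).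
  apply: ge0_le_integral => //.
  - by move=> u _; rewrite lee_fin expR_ge0.
  - by apply/measurable_EFinP/measurable_funTS; exact: measurable_subordination.
  - move=> u; rewrite /= in_itv /= => /andP[u0 u1]; rewrite lee_fin ler_expR expr1n !mul1r mulr1.
    have : expR (2 * u) <= expR 2 by rewrite ler_expR ler_piMr.
    have : 0 <= a * u by rewrite mulr_ge0// ltW.
    lra.
apply: ge0_subset_integral => //.
- apply/measurable_EFinP; apply: measurable_subordination.
Qed.

(** With [y = 0] only the growing exponential remains. The value agrees with the Riesz kernel at the
    origin, so the kernel identity below holds without exception. *)
Lemma subordination0 (a : R) : 0 < a -> subordination a 1 0 = +oo%E.
Proof.
move=> a0; apply/eqP; rewrite eq_le leey /=.
have <- : (\int[mu]_(x in `[0%R, +oo[) (cst 1%E x) = +oo)%E.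
  by rewrite integral_cst//= lebesgue_measure_itv/= ltry mul1e.
apply: (@le_trans _ _ (\int[mu]_(u in `[0%R, +oo[) (expR (1 * a * u - 0 ^+ 2 * expR (2 * 1 * u) / 2))%:E)%E).
  apply: ge0_le_integral => //.
  - by apply/measurable_EFinP/measurable_funTS; exact: measurable_subordination.
  - move=> u; rewrite /= in_itv /= andbT => u0; rewrite lee_fin expr0n /= !mul0r subr0 mul1r.
    by rewrite -expR0 ler_expR mulr_ge0// ltW.
apply: ge0_subset_integral => //.
- apply/measurable_EFinP; apply: measurable_subordination.
Qed.

End subordination.

Definition dotv (R : realType) (n : nat) (x y : 'rV[R]_n) : R :=
  \sum_(j < n) x ord0 j * y ord0 j.

(** * Integration over row vectors *)

Section lebesgue_rV_integrals.
Context {R : realType}.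
Local Notation mu := (@lebesgue_measure R).

Lemma ge0_integral_cons_rV n (f : 'rV[R]_n.+1 -> \bar R) :
  measurable_fun setT f -> (forall x, 0 <= f x)%E ->
  (\int[lebesgue_rV n.+1]_x f x =
   \int[mu]_r \int[lebesgue_rV n]_v f (cons_rV (r, v)))%E.
Proof.
move=> mf f0.
transitivity (\int[mu \x lebesgue_rV n]_p (f \o @cons_rV R n) p)%E.
  have mc : measurable_fun [set: measurableTypeR R * 'rV[R]_n] (@cons_rV R n).
    exact: measurable_cons_rV.
  have := @ge0_integral_pushforward _ _ _ _ R _ mc (mu \x lebesgue_rV n)%E setT f measurableT mf.
  by rewrite preimage_setT; apply.
apply: (@fubini_tonelli1 _ _ (measurableTypeR R) _ R mu (lebesgue_rV n) (f \o @cons_rV R n)).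
  by apply: measurableT_comp => //; exact: measurable_cons_rV.
by move=> p; exact: f0.
Qed.

Lemma cons_rV0 n (r : R) (v : 'rV[R]_n) : cons_rV (r, v) ord0 ord0 = r.
Proof. by rewrite mxE unlift_none. Qed.

Lemma cons_rVS n (r : R) (v : 'rV[R]_n) j :
  cons_rV (r, v) ord0 (lift ord0 j) = v ord0 j.
Proof. by rewrite mxE liftK. Qed.

Lemma measurable_prod_coord n (g : 'I_n -> R -> R) :
  (forall j, measurable_fun setT (g j)) ->
  measurable_fun setT (fun x : 'rV[R]_n => \prod_(j < n) g j (x ord0 j)).
Proof.
move=> mg; apply: measurable_prod => j _.
by apply: (measurableT_comp (mg j)); exact: measurable_coord.
Qed.

Lemma ge0_integral_prod_rV n (g : 'I_n -> R -> R) :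
  (forall j, measurable_fun setT (g j)) -> (forall j r, 0 <= g j r) ->
  (\int[lebesgue_rV n]_x (\prod_(j < n) g j (x ord0 j))%:E =
   \prod_(j < n) \int[mu]_r (g j r)%:E)%E.
Proof.
elim: n g => [|n IH] g mg g0.
  under eq_integral do rewrite big_ord0.
  by rewrite big_ord0 /= integral_dirac// diracE mem_set// mul1e.
rewrite ge0_integral_cons_rV; last 2 first.
- by apply/measurable_EFinP; apply: measurable_prod_coord.
- by move=> x; rewrite lee_fin prodr_ge0.
rewrite big_ord_recl -(IH (fun j => g (lift ord0 j)))//.
rewrite -ge0_integralZr//; last 3 first.
- by apply/measurable_EFinP; exact: mg.
- by move=> r _; rewrite lee_fin.
- by apply: integral_ge0 => x _; rewrite lee_fin prodr_ge0.
apply: eq_integral => r _; rewrite -ge0_integralZl//.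
- apply: eq_integral => v _; rewrite big_ord_recl cons_rV0 EFinM; congr (_ * _%:E)%E.
  by apply: eq_bigr => j _; rewrite cons_rVS.
- by apply/measurable_EFinP; apply: (measurable_prod_coord (g := fun j => g (lift ord0 j))).
- by move=> x _; rewrite lee_fin prodr_ge0.
- by rewrite lee_fin.
Qed.

Lemma measurable_dotv n (z : 'rV[R]_n) : measurable_fun setT (dotv z).
Proof.
apply: measurable_sum => j; apply: measurable_funM => //; exact: measurable_coord.
Qed.

Definition gauss_rV n (s : R) (x : 'rV[R]_n) : R :=
  \prod_(j < n) normal_pdf 0 s (x ord0 j).

Lemma gauss_rV_ge0 n s (x : 'rV[R]_n) : 0 <= gauss_rV s x.
Proof. by apply: prodr_ge0 => j _; exact: normal_pdf_ge0. Qed.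

Lemma measurable_gauss_rV n s : measurable_fun setT (@gauss_rV n s).
Proof.
apply: (measurable_prod_coord (g := fun=> normal_pdf 0 s)) => j.
exact: measurable_normal_pdf.
Qed.

Lemma integral_gauss_rV n s : (\int[lebesgue_rV n]_x (gauss_rV s x)%:E = 1)%E.
Proof.
rewrite (ge0_integral_prod_rV (g := fun=> normal_pdf 0 s)).
- by apply: big1 => j _; exact: integral_normal_pdf.
- by move=> j; exact: measurable_normal_pdf.
- by move=> j r; exact: normal_pdf_ge0.
Qed.

Lemma measurable_1Dcos_dotv n (a : R) (z : 'rV[R]_n) :
  measurable_fun setT (fun x => 1 + cos (a + dotv z x)).
Proof.
apply: measurable_funD => //; apply: measurableT_comp.
  exact: continuous_measurable_fun (@continuous_cos R).
by apply: measurable_funD => //; exact: measurable_dotv.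
Qed.

Lemma cos_ge0D1 (x : R) : 0 <= 1 + cos x.
Proof. by have := cos_geN1 x; lra. Qed.

(** Induction on [n], with [a] general: once the first coordinate is fixed, it joins the phase, the
    induction hypothesis integrates the others, and a one-dimensional cosine integral is left. *)
Lemma integral_1Dcos_gauss_rV n (s a : R) (z : 'rV[R]_n) : s != 0 ->
  (\int[lebesgue_rV n]_x (gauss_rV s x * (1 + cos (a + dotv z x)))%:E =
   (1 + cos a * expR (- (s ^+ 2 * dotv z z) / 2))%:E)%E.
Proof.
move=> s0; elim: n a z => [|n IH] a z.
  rewrite /dotv big_ord0 mulr0 oppr0 mul0r expR0 mulr1.
  under eq_integral do rewrite /gauss_rV /dotv !big_ord0 mul1r addr0.
  by rewrite /= integral_cst//= diracE mem_set// mule1.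
pose z' : 'rV[R]_n := \row_j z ord0 (lift ord0 j).
rewrite ge0_integral_cons_rV; last 2 first.
- apply/measurable_EFinP; apply: measurable_funM; first exact: measurable_gauss_rV.
  exact: measurable_1Dcos_dotv.
- by move=> x; rewrite lee_fin mulr_ge0 ?gauss_rV_ge0 ?cos_ge0D1.
set E := expR (- (s ^+ 2 * dotv z' z') / 2).
transitivity (\int[mu]_r ((normal_pdf 0 s r)%:E +
    E%:E * (cos (a + z ord0 ord0 * r) * normal_pdf 0 s r)%:E)%E)%E.
  apply: eq_integral => r _.
  transitivity (\int[lebesgue_rV n]_v ((normal_pdf 0 s r)%:E *
     (gauss_rV s v * (1 + cos ((a + z ord0 ord0 * r) + dotv z' v)))%:E)%E)%E.
    apply: eq_integral => v _; rewrite -EFinM; congr (_%:E).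
    rewrite /gauss_rV big_ord_recl cons_rV0 -mulrA; congr (_ * (_ * _)).
      by apply: eq_bigr => j _; rewrite cons_rVS.
    rewrite /dotv big_ord_recl cons_rV0 addrA; congr (1 + cos (_ + _)).
    by apply: eq_bigr => j _; rewrite cons_rVS mxE.
  rewrite ge0_integralZl//; last 3 first.
  - apply/measurable_EFinP; apply: measurable_funM; first exact: measurable_gauss_rV.
    exact: measurable_1Dcos_dotv.
  - by move=> x _; rewrite lee_fin mulr_ge0 ?gauss_rV_ge0 ?cos_ge0D1.
  - by rewrite lee_fin normal_pdf_ge0.
  by rewrite IH -!EFinM -EFinD -/E; congr (_%:E); ring.
have ic := integrable_cos_normal_pdf s0 a (z ord0 ord0).
rewrite integralD//; last 2 first.
- exact: integrable_normal_pdf.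
- exact: integrableZl.
rewrite integral_normal_pdf integralZl//.
have := integral_cos_normal_pdf s0 a (z ord0 ord0).
rewrite /Rintegral => h.
rewrite -[X in (_ * X)%E]fineK; last exact: integrable_fin_num.
rewrite h -EFinM -EFinD; congr (1 + _)%:E.
rewrite mulrC -mulrA -expRD; congr (_ * expR _).
have -> : dotv z z = z ord0 ord0 ^+ 2 + dotv z' z'.
  rewrite /dotv big_ord_recl expr2; congr (_ + _).
  by apply: eq_bigr => j _; rewrite !mxE.
by field.
Qed.

(** Closed balls of the sup norm. Their volume is explicit, so Euclidean layers are enlarged to
    cubes at the cost of a constant. *)
Definition cubev n (r : 'rV[R]_n) (rho : R) : set 'rV[R]_n :=
  [set x | forall i, `|x ord0 i - r ord0 i| <= rho].

Lemma lebesgue_rV_cubev n (r : 'rV[R]_n) (rho : R) : 0 <= rho ->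
  lebesgue_rV n (cubev r rho) = ((2 * rho) ^+ n)%:E.
Proof.
move=> rho0; pose I i : set R := [set` `[r ord0 i - rho, r ord0 i + rho]].
have -> : cubev r rho = [set x | forall i, I i (x ord0 i)].
  by apply/seteqP; split => x /= h i; have := h i; rewrite /I /= in_itv /= ler_distl.
rewrite lebesgue_rV_box//.
  rewrite (eq_bigr (fun=> (2 * rho)%:E)).
    by rewrite prodEFin prodr_const card_ord.
  move=> i _; rewrite lebesgue_measure_itv /= lte_fin; case: ifPn => h.
    by rewrite -EFinB; congr (_%:E); ring.
  by congr (_%:E); move: h; rewrite -leNgt; lra.
by move=> i; exact: measurable_itv.
Qed.

Lemma measurable_cubev n (r : 'rV[R]_n) (rho : R) : measurable (cubev r rho).
Proof.
pose I i : set R := [set` `[r ord0 i - rho, r ord0 i + rho]].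
have -> : cubev r rho = \bigcap_(i in [set: 'I_n]) (fun x : 'rV[R]_n => x ord0 i) @^-1` (I i).
  apply/seteqP; split => x /= h i; [move=> _|]; have := h i.
    by rewrite /I /= in_itv /= ler_distl.
  by move=> /(_ Logic.I); rewrite /I /= in_itv /= ler_distl.
apply: fin_bigcap_measurable => // i _.
rewrite -[X in measurable X]setTI; apply: measurable_coord => //.
exact: measurable_itv.
Qed.

End lebesgue_rV_integrals.

(** * Open boxes as a generating class *)

Section open_boxes.
Context {R : realType}.

Definition obox n (a b : 'I_n -> R) : set 'rV[R]_n :=
  [set x | forall i, a i < x ord0 i < b i].

Lemma measurable_obox n (a b : 'I_n -> R) : measurable (obox a b).
Proof.
have -> : obox a b = \bigcap_(i in [set: 'I_n])
    (fun x : 'rV[R]_n => x ord0 i) @^-1` [set` `]a i, b i[].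
  apply/seteqP; split => x /= h i; [move=> _|]; have := h i.
    by rewrite /= in_itv.
  by move=> /(_ Logic.I); rewrite /= in_itv.
apply: fin_bigcap_measurable => // i _.
by rewrite -[X in measurable X]setTI; apply: measurable_coord.
Qed.

Lemma setI_closed_obox n :
  setI_closed [set B | exists a b : 'I_n -> R, B = obox a b].
Proof.
move=> _ _ [a [b ->]] [c [e ->]].
exists (fun i => Num.max (a i) (c i)), (fun i => Num.min (b i) (e i)).
apply/seteqP; split => x /=.
  by move=> [h1 h2] i; rewrite gt_max lt_min;
    have /andP[-> ->] := h1 i; have /andP[-> ->] := h2 i.
move=> h; split => i; have := h i; rewrite gt_max lt_min => /andP[/andP[? ?] /andP[? ?]];
  exact/andP.
Qed.

Lemma obox_cover n : \bigcup_k obox (fun=> - k%:R) (fun=> k%:R) = [set: 'rV[R]_n].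
Proof.
apply/seteqP; split => // x _.
exists (Num.truncn (\sum_i `|x ord0 i|)).+1 => // i; rewrite -ltr_norml.
apply: le_lt_trans (truncnS_gt _).
by rewrite (bigD1 i)//= lerDl sumr_ge0.
Qed.

(** For the nontrivial inclusion, the identity from the space carrying the box sigma-algebra is
    measurable, since measurability into matrices can be checked on coordinates. *)
Lemma measurable_rV_obox n :
  @measurable _ 'rV[R]_n = <<s [set B | exists a b : 'I_n -> R, B = obox a b] >>.
Proof.
set G := [set B | _]; apply/seteqP; split; last first.
  apply: smallest_sub; first exact: sigma_algebra_measurable.
  by move=> _ [a [b ->]]; exact: measurable_obox.
suff mid : measurable_fun [set: g_sigma_algebraType G] (id : g_sigma_algebraType G -> 'rV[R]_n).
  by move=> A mA; have := mid measurableT A mA; rewrite setTI.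
apply: measurable_fun_mx => i j; rewrite (ord1 i) => {i}.
apply: (@measurability _ _ (g_sigma_algebraType G) (measurableTypeR R) _ _
  (@measurable_realfun.RGenOpens.G R)).
  exact: measurable_realfun.RGenOpens.measurableE.
move=> _ [_ [a [b ->]] <-]; rewrite setTI.
(* A strip in one coordinate is the countable union of boxes whose other sides are []- k, k[]. *)
pose l k i : R := if i == j then a else - k%:R.
pose u k i : R := if i == j then b else k%:R.
have -> : (fun t : 'rV[R]_n => t ord0 j) @^-1` `]a, b[ = \bigcup_k obox (l k) (u k).
  apply/seteqP; split => x /=.
    rewrite in_itv /= => xab.
    have [k _ kx] : (\bigcup_k obox (fun=> - k%:R) (fun=> k%:R)) x by rewrite obox_cover.
    by exists k => // i; rewrite /l /u; case: eqP => [->//|_]; exact: kx.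
  by move=> [k _ /(_ j)]; rewrite /l /u eqxx in_itv.
apply: bigcupT_measurable => k; apply: sub_sigma_algebra.
by exists (l k), (u k).
Qed.

Lemma measure_unique_obox n (m1 m2 : {measure set 'rV[R]_n -> \bar R}) :
  (forall a b, m1 (obox a b) = m2 (obox a b)) ->
  (m1 setT < +oo)%E -> forall A, measurable A -> m1 A = m2 A.
Proof.
move=> h m1oo; apply: (@measure_unique _ _ _ _
  (fun k => obox (fun=> - k%:R) (fun=> k%:R)) (measurable_rV_obox n) (@setI_closed_obox n)).
- by move=> k; eexists; eexists.
- exact: obox_cover.
- by move=> _ [a [b ->]].
- move=> k; apply: le_lt_trans m1oo; rewrite le_measure ?inE//.
  exact: measurable_obox.
Qed.

End open_boxes.

(** * Layer estimates and integrability of powers of the norm *)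

Section layers.
Context {R : realType}.

Lemma ereal_geometric_lty (K c : R) : 0 <= K -> 0 < c ->
  (\sum_(0 <= m <oo) (K * expR (- (c * m%:R)))%:E < +oo)%E.
Proof.
move=> K0 c0; have r1 : `|expR (- c)| < 1.
  by rewrite ger0_norm ?expR_ge0// -expR0 ltr_expR oppr_lt0.
have cv := @is_cvg_geometric_series R K _ r1.
rewrite (_ : (fun n => _) = EFin \o series (geometric K (expR (- c)))); last first.
  apply/funext => n /=; rewrite sumEFin /series /=; congr (_%:E).
  by apply: eq_bigr => i _; rewrite /geometric /= -expRM_natl; congr (_ * expR _); ring.
by rewrite EFin_lim// ltry.
Qed.

(** [f] lies below the sum of the functions equal to [a m] on the [m]-th cube. Each point only has
    to find one suitable layer, so the cubes need be neither disjoint nor nested. *)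
Lemma le_integral_layers n (D : set 'rV[R]_n) (r : 'rV[R]_n) (f : 'rV[R]_n -> \bar R)
    (a rho : nat -> R) :
  measurable D -> measurable_fun D f -> (forall x, D x -> 0 <= f x)%E ->
  (forall m, 0 <= a m) -> (forall m, 0 <= rho m) ->
  (forall x, D x -> exists2 m, cubev r (rho m) x & (f x <= (a m)%:E)%E) ->
  (\int[lebesgue_rV n]_(x in D) f x <=
    \sum_(0 <= m <oo) (a m * (2 * rho m) ^+ n)%:E)%E.
Proof.
move=> mD mf f0 a0 rho0 fa.
pose g m (x : 'rV[R]_n) := ((a m)%:E * (\1_(cubev r (rho m)) x)%:E)%E.
have g0 m x : (0 <= g m x)%E by rewrite mule_ge0 ?lee_fin.
have mg m : measurable_fun setT (g m).
  apply: emeasurable_funM => //; apply/measurable_EFinP; apply: measurable_indic.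
  exact: measurable_cubev.
apply: (@le_trans _ _ (\int[lebesgue_rV n]_(x in D) \sum_(0 <= m <oo) g m x)%E).
  apply: ge0_le_integral => //.
  - apply: measurable_funTS; apply: ge0_emeasurable_sum => // m x _ _; exact: g0.
  - move=> x /fa[m mx fm].
    apply: (le_trans fm); apply: le_trans (nneseries_lim_ge m.+1 _); last by [].
    rewrite big_nat_recr//= -[leLHS]add0e leeD ?sume_ge0//.
    by rewrite /g indicE mem_set// mule1.
apply: (@le_trans _ _ (\int[lebesgue_rV n]_x \sum_(0 <= m <oo) g m x)%E).
  apply: ge0_subset_integral => //.
  - apply: ge0_emeasurable_sum => // m x _ _; exact: g0.
  - by move=> x _; exact: nneseries_ge0.
rewrite integral_nneseries//.
apply: lee_nneseries => [m _ _|m _].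
  by apply: integral_ge0 => x _; exact: g0.
rewrite /g ge0_integralZl//.
- have mc := measurable_cubev r (rho m).
  suff -> : (\int[lebesgue_rV n]_x (\1_(cubev r (rho m)) x)%:E = ((2 * rho m) ^+ n)%:E)%E.
    by rewrite EFinM.
  by rewrite -(lebesgue_rV_cubev r (rho0 m)) integral_indic// setIT.
- by apply/measurable_EFinP; apply: measurable_indic; exact: measurable_cubev.
- by rewrite lee_fin.
Qed.

End layers.

Section enorm_theory.
Context {R : realType} (n : nat).
Implicit Types x y : 'rV[R]_n.

Lemma enorm_ge0 x : 0 <= enorm x. Proof. exact: sqrtr_ge0. Qed.

Lemma sqr_enorm x : enorm x ^+ 2 = dotv x x.
Proof.
rewrite sqr_sqrtr; last by rewrite sumr_ge0// => i _; exact: sqr_ge0.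
by apply: eq_bigr => i _; rewrite expr2.
Qed.

Lemma ler_coord_enorm x i : `|x ord0 i| <= enorm x.
Proof.
rewrite -sqrtr_sqr ler_wsqrtr// (bigD1 i)//= lerDl sumr_ge0// => j _.
exact: sqr_ge0.
Qed.

Lemma enorm_eq0 x : (enorm x == 0) = (x == 0).
Proof.
apply/idP/eqP => [/eqP x0|->].
  apply/rowP => i; rewrite mxE; apply/eqP; rewrite -normr_le0 -x0.
  exact: ler_coord_enorm.
by rewrite /enorm big1 ?sqrtr0// => i _; rewrite mxE expr0n.
Qed.

Lemma enorm0 : enorm (0 : 'rV[R]_n) = 0.
Proof. by apply/eqP; rewrite enorm_eq0. Qed.

Lemma measurable_enorm : measurable_fun setT (@enorm R n).
Proof.
apply: measurableT_comp; first exact: continuous_measurable_fun (@sqrt_continuous R).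
by apply: measurable_sum => i; apply: measurable_funX; exact: measurable_coord.
Qed.

End enorm_theory.

Section finiteness.
Context {R : realType}.

Lemma powR_le_expR (p : R) : 0 < p ->
  exists2 C : R, 0 < C & forall y, 0 < y -> y `^ p <= C * expR (y / 2).
Proof.
(* [c] is chosen so that [p * c = 1 / 2]; the bound is [ln (c * y) <= c * y - 1] multiplied by
   [p]. *)
move=> p0; pose c := (2 * p)^-1; have c0 : 0 < c by rewrite invr_gt0 mulr_gt0.
exists (expR (- p - p * ln c)); first exact: expR_gt0.
move=> y y0; rewrite /powR gt_eqF// -expRD ler_expR.
have cy : 0 < c * y by rewrite mulr_gt0.
have : ln (c * y) <= c * y - 1.
  by rewrite -ler_expR lnK ?posrE//; have := expR_ge1Dx (c * y - 1); lra.
rewrite lnM ?posrE// => h.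
have : p * (ln c + ln y) <= p * (c * y - 1) by rewrite ler_pM2l.
have -> : p * (c * y - 1) = y / 2 - p by rewrite /c; field; rewrite gt_eqF.
lra.
Qed.

(* Layer-cake estimate: [l * |x - r| ^ h] lies in [[i, i + 1[] only on a cube of
   half-side [((i + 1) / l) ^ (1 / h)]. *)
Lemma integral_expR_Nenorm_powR_le k (h : R) : (0 < k)%N -> 0 < h ->
  exists2 C : R, 0 < C & forall (l : R) (r : 'rV[R]_k), 0 < l ->
    (\int[lebesgue_rV k]_x (expR (- (l * enorm (x - r) `^ h)))%:E <=
      (C * l `^ (- (k%:R / h)))%:E)%E.
Proof.
move=> k0 h0; set p := k%:R / h.
have p0 : 0 < p by rewrite divr_gt0// ltr0n.
have [C C0 hC] := powR_le_expR p0.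
(* Majorant of the layer series once the power of [l] and the factor [2 ^+ k] are taken out:
   [exp (- m) * (m + 1) ^ p] is at most [C * exp (1 / 2) * exp (- m / 2)]. *)
pose S : \bar R := (\sum_(0 <= m <oo) (2 ^+ k * C * expR (2^-1) * expR (- (2^-1 * m%:R)))%:E)%E.
have K0 : 0 <= 2 ^+ k * C * expR (2^-1).
  by rewrite !mulr_ge0 ?expR_ge0 ?exprn_ge0// ltW.
have Soo : (S < +oo)%E by apply: ereal_geometric_lty => //; rewrite invr_gt0.
have S0 : (0 <= S)%E.
  by apply: nneseries_ge0 => m _ _; rewrite lee_fin mulr_ge0 ?expR_ge0.
exists (fine S + 1); first by rewrite ltr_wpDl// fine_ge0.
move=> l r l0; pose rho m : R := ((m%:R + 1) / l) `^ (h^-1).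
have lp0 : 0 <= l `^ (- p) by exact: powR_ge0.
apply: (@le_trans _ _ (\sum_(0 <= m <oo) (expR (- m%:R) * (2 * rho m) ^+ k)%:E)%E).
  apply: (@le_integral_layers _ k setT r _ (fun m => expR (- m%:R)) rho) => //.
  - apply/measurable_EFinP; apply: measurableT_comp => //.
    apply: measurableT_comp => //; apply: measurable_funM => //.
    apply: (measurableT_comp (measurable_powR _)).
    apply: (measurableT_comp (@measurable_enorm R k)).
    apply: measurable_fun_mx => i j; under eq_fun do rewrite !mxE.
    by apply: measurable_funB => //; exact: measurable_coord.
  - by move=> m; exact: powR_ge0.
  - move=> x _; set v := l * enorm (x - r) `^ h.
    have v0 : 0 <= v by rewrite mulr_ge0 ?powR_ge0// ltW.
    exists (Num.truncn v).
      move=> i; have -> : x ord0 i - r ord0 i = (x - r) ord0 i by rewrite !mxE.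
      apply: (le_trans (ler_coord_enorm _ _)).
      have -> : enorm (x - r) = (enorm (x - r) `^ h) `^ (h^-1).
        by rewrite -powRrM divff ?powRr1 ?enorm_ge0// gt_eqF.
      apply: ge0_ler_powR; rewrite ?nnegrE ?powR_ge0 ?invr_ge0 ?divr_ge0 ?addr_ge0//; try exact: ltW.
      rewrite ler_pdivlMr// mulrC -/v natr1; exact: ltW (truncnS_gt _).
    by rewrite lee_fin ler_expR lerN2 truncn_le.
apply: (@le_trans _ _ ((l `^ (- p))%:E * S)%E).
  rewrite -nneseriesZl//; last by move=> m _; rewrite lee_fin mulr_ge0 ?expR_ge0.
  apply: lee_nneseries => [m _ _|m _].
    by rewrite lee_fin mulr_ge0 ?expR_ge0// exprn_ge0// mulr_ge0// powR_ge0.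
  rewrite -EFinM lee_fin exprMn.
  have m1 : 0 < m%:R + 1 :> R by rewrite ltr_wpDl.
  have -> : rho m ^+ k = (m%:R + 1) `^ p * l `^ (- p).
    have pE : h^-1 * k%:R = p by rewrite mulrC.
    rewrite /rho -powR_mulrn ?powR_ge0// -powRrM pE powRM ?invr_ge0 ?(ltW l0) ?(ltW m1)//.
    by congr (_ * _); rewrite -powR_inv1 ?(ltW l0)// -powRrM mulN1r.
  have -> : expR (- m%:R) * (2 ^+ k * ((m%:R + 1) `^ p * l `^ (- p))) =
    l `^ (- p) * (2 ^+ k * expR (- m%:R) * (m%:R + 1) `^ p) by ring.
  rewrite ler_wpM2l//.
  apply: (@le_trans _ _ (2 ^+ k * expR (- m%:R) * (C * expR ((m%:R + 1) / 2)))).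
    by rewrite ler_wpM2l ?mulr_ge0 ?expR_ge0 ?exprn_ge0//; exact: hC.
  have -> : 2 ^+ k * expR (- m%:R) * (C * expR ((m%:R + 1) / 2)) =
      2 ^+ k * C * (expR (- m%:R) * expR ((m%:R + 1) / 2)) by ring.
  rewrite -[leRHS]mulrA -!expRD.
  rewrite ler_wpM2l ?mulr_ge0 ?exprn_ge0 ?(ltW C0)// ler_expR; lra.
rewrite mulrC EFinM lee_wpmul2l ?lee_fin//.
rewrite -[leLHS]fineK ?ge0_fin_numE// lee_fin lerDl//.
Qed.

Lemma lebesgue_rV_set0 n : (0 < n)%N -> lebesgue_rV n [set (0 : 'rV[R]_n)] = 0%E.
Proof.
move=> n0; have -> : [set (0 : 'rV[R]_n)] = cubev 0 0.
  apply/seteqP; split => x /=.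
    by move=> -> i; rewrite subrr normr0.
  move=> h; apply/rowP => i; apply/eqP.
  by have := h i; rewrite normr_le0 subr_eq0.
by rewrite lebesgue_rV_cubev// mulr0 expr0n gtn_eqF.
Qed.

(** Layers are cut by the integer part of [|ln |x||]. Near the origin the layer of half-side
    [exp (- m)] contributes a multiple of [exp (- (n - alpha) m)], far away that of half-side
    [exp (m + 1)] contributes a multiple of [exp (- (gamma - n) m)]; both series are geometric. The
    origin, where [f] may be infinite, is a null set because [n > 0]. *)
Lemma integral_enorm_powR_lty n (alpha gamma A : R) (f : 'rV[R]_n -> \bar R) :
  (0 < n)%N -> 0 <= alpha -> alpha < n%:R -> n%:R < gamma -> 0 <= A ->
  measurable_fun setT f -> (forall x, 0 <= f x)%E ->
  (forall x, x != 0 -> enorm x <= 1 -> (f x <= (A * enorm x `^ (- alpha))%:E)%E) ->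
  (forall x, 1 < enorm x -> (f x <= (A * enorm x `^ (- gamma))%:E)%E) ->
  (\int[lebesgue_rV n]_x f x < +oo)%E.
Proof.
move=> n0 al0 aln ngam A0 mf f0 fsmall fbig.
have gam0 : 0 <= gamma by apply: ltW; apply: le_lt_trans ngam.
pose D1 : set 'rV[R]_n := [set x | enorm x <= 1] `\` [set 0].
pose D2 : set 'rV[R]_n := [set x | 1 < enorm x].
have mZ : measurable [set (0 : 'rV[R]_n)].
  have -> : [set (0 : 'rV[R]_n)] = cubev 0 0.
    apply/seteqP; split => x /=.
      by move=> -> i; rewrite subrr normr0.
    move=> h; apply/rowP => i; apply/eqP.
    by have := h i; rewrite normr_le0 subr_eq0.
  exact: measurable_cubev.
have mD2 : measurable D2.
  have -> : D2 = @enorm R n @^-1` `]1, +oo[.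
    by apply/seteqP; split => x; rewrite /D2 /= in_itv /= andbT.
  by rewrite -[X in measurable X]setTI; apply: measurable_enorm.
have mD1 : measurable D1.
  apply: measurableD => //.
  have -> : [set x | enorm x <= 1] = @enorm R n @^-1` `]-oo, 1].
    by apply/seteqP; split => x; rewrite /= in_itv.
  by rewrite -[X in measurable X]setTI; apply: measurable_enorm.
have epos x : x != 0 :> 'rV[R]_n -> 0 < enorm x.
  by move=> x0; rewrite lt_neqAle enorm_ge0 andbT eq_sym enorm_eq0.
have I1 : (\int[lebesgue_rV n]_(x in D1) f x < +oo)%E.
  apply: (@le_lt_trans _ _ (\sum_(0 <= m <oo)
     (A * expR alpha * expR (alpha * m%:R) * (2 * expR (- m%:R)) ^+ n)%:E)%E).
    apply: (@le_integral_layers _ n D1 0 _ (fun m => A * expR alpha * expR (alpha * m%:R))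
      (fun m => expR (- m%:R))) => //.
    - exact: measurable_funTS.
    - by move=> m; rewrite !mulr_ge0 ?expR_ge0.
      - move=> x [/= x1 /eqP x0]; have e0 := epos _ x0.
      have l0 : 0 <= - ln (enorm x) by rewrite oppr_ge0 ln_le0.
      exists (Num.truncn (- ln (enorm x))).
        move=> i; rewrite mxE subr0; apply: (le_trans (ler_coord_enorm _ _)).
        rewrite -[leLHS]lnK ?posrE// ler_expR lerNr.
        by rewrite truncn_le.
      apply: (le_trans (fsmall _ x0 x1)); rewrite lee_fin -mulrA ler_wpM2l// -expRD.
      rewrite /powR gt_eqF// ler_expR mulNr -mulrN -[X in X + _]mulr1 -mulrDr ler_wpM2l//.
      by rewrite addrC natr1 ltW// truncnS_gt.
  rewrite (_ : (fun m => _) = (fun m => \sum_(0 <= i < m)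
      (A * expR alpha * 2 ^+ n * expR (- ((n%:R - alpha) * i%:R)))%:E)%E).
    by apply: ereal_geometric_lty; rewrite ?subr_gt0// !mulr_ge0 ?expR_ge0 ?exprn_ge0.
  apply/funext => m; apply: eq_bigr => i _; congr (_%:E).
  rewrite exprMn -expRM_natl -!mulrA; congr (_ * (_ * _)).
  by rewrite mulrCA -expRD; congr (_ * expR _); ring.
have I2 : (\int[lebesgue_rV n]_(x in D2) f x < +oo)%E.
  apply: (@le_lt_trans _ _ (\sum_(0 <= m <oo)
     (A * expR (- (gamma * m%:R)) * (2 * expR (m%:R + 1)) ^+ n)%:E)%E).
    apply: (@le_integral_layers _ n D2 0 _ (fun m => A * expR (- (gamma * m%:R)))
      (fun m => expR (m%:R + 1))) => //.
    - exact: measurable_funTS.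
    - by move=> m; rewrite !mulr_ge0 ?expR_ge0.
      - move=> x /= x1; have e0 : 0 < enorm x by apply: lt_trans x1.
      have l0 : 0 <= ln (enorm x) by rewrite ln_ge0// ltW.
      exists (Num.truncn (ln (enorm x))).
        move=> i; rewrite mxE subr0; apply: (le_trans (ler_coord_enorm _ _)).
        by rewrite -[leLHS]lnK ?posrE// ler_expR natr1 ltW// truncnS_gt.
      apply: (le_trans (fbig _ x1)); rewrite lee_fin ler_wpM2l//.
      by rewrite /powR gt_eqF// ler_expR mulNr lerN2 ler_wpM2l// truncn_le.
  rewrite (_ : (fun m => _) = (fun m => \sum_(0 <= i < m)
      (A * (2 ^+ n * expR n%:R) * expR (- ((gamma - n%:R) * i%:R)))%:E)%E).
    by apply: ereal_geometric_lty; rewrite ?subr_gt0// !mulr_ge0 ?expR_ge0 ?exprn_ge0.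
  apply/funext => m; apply: eq_bigr => i _; congr (_%:E).
  rewrite exprMn -expRM_natl -!mulrA; congr (_ * _).
  by rewrite mulrCA -!expRD; congr (_ * expR _); ring.
have TE : [set: 'rV[R]_n] = (D1 `|` D2) `|` [set 0].
  apply/seteqP; split => // x _.
  have [->|/eqP x0] := eqVneq x 0; [by right|left].
  by have [h|h] := leP (enorm x) 1; [left|right].
have mD12 : measurable (D1 `|` D2) by exact: measurableU.
have dis : [disjoint D1 `|` D2 & [set (0 : 'rV[R]_n)]].
  apply/disj_setPS => x [[[_ ?]|/= x1] /= x0] //.
  by move: x1; rewrite /D2 /= x0 enorm0 ltr10.
have dis2 : [disjoint D1 & D2].
  by apply/disj_setPS => x [[/= + _] /=]; rewrite leNgt => /negP.
rewrite TE ge0_integral_setU//; last by rewrite -TE.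
rewrite [X in (_ + X)%E](_ : _ = 0%E); last first.
  apply: null_set_integral => //; last exact: lebesgue_rV_set0.
  exact: measurable_funTS.
rewrite adde0 ge0_integral_setU//; last exact: measurable_funTS.
exact: lte_add_pinfty.
Qed.

End finiteness.

(** * Regularity of Riesz potentials from the Fourier transform *)

Section continuity_metric.
Context {R : realType}.

(** Dominated convergence speaks of sequences, so continuity is proved by contradiction: a failure
    at [x] yields points [y k] in the balls of radius [1 / (k + 1)] whose integrals stay [e]
    away. *)
Lemma continuous_integral (V : pseudoMetricType R) d (T : measurableType d)
    (m : {measure set T -> \bar R}) (f : V -> T -> R) (g : T -> \bar R) :
  (forall x, measurable_fun setT (f x)) ->
  (forall t, continuous (f ^~ t)) ->
  (forall x t, (`|f x t|%:E <= g t)%E) -> m.-integrable setT g ->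
  continuous (fun x => \int[m]_t f x t).
Proof.
move=> mf cf fg ig x; apply/cvgrPdist_lt => e e0; apply: contrapT => H.
have /choice[y hy] : forall k : nat, exists y, ball x (k.+1%:R^-1) y /\
    e <= `|\int[m]_t f x t - \int[m]_t f y t|.
  move=> k; apply: contrapT => h; apply: H; apply/nbhs_ballP.
  exists k.+1%:R^-1; first by rewrite /= invr_gt0 ltr0n.
  move=> z Bz /=; rewrite ltNge; apply/negP => le; apply: h; by exists z.
have yx : y @ \oo --> x.
  apply/cvg_ballP => r r0; near=> k; apply: (@le_ball _ _ _ k.+1%:R^-1); last by have [] := hy k.
  rewrite -[leRHS]invrK lef_pV2 ?posrE ?invr_gt0 ?ltr0n//.
  apply: (@le_trans _ _ (Num.truncn r^-1).+1%:R); first exact: ltW (truncnS_gt _).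
  by rewrite ler_nat ltnS; near: k; exact: nbhs_infty_ge.
have [_ _ cv] : [/\ m.-integrable setT (EFin \o f x),
    [sequence (\int[m]_t `|(f (y k) t)%:E - (f x t)%:E|)%E]_k @ \oo --> 0%E &
    [sequence (\int[m]_t (f (y k) t)%:E)%E]_k @ \oo --> (\int[m]_t (f x t)%:E)%E].
  apply: (@dominated_convergence _ _ _ m setT measurableT
    (fun k t => (f (y k) t)%:E) (EFin \o f x) g) => //.
  - by move=> k; apply/measurable_EFinP.
  - by apply/measurable_EFinP.
  - apply: aeW => t _; apply: cvg_EFin; first exact: nearW.
    apply: (@cvg_comp _ _ _ y (f ^~ t)); [exact: yx|exact: cf].
  - by apply: aeW => t k _; exact: fg.
have fin z : (\int[m]_t (f z t)%:E)%E \is a fin_num.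
  apply: integrable_fin_num => //; apply: le_integrable ig => //.
    by apply/measurable_EFinP.
  by move=> t _; apply: le_trans (fg z t) (lee_abs _).
have : (fun k => \int[m]_t f (y k) t) @ \oo --> \int[m]_t f x t.
  by apply: fine_cvg; rewrite fineK.
move=> /cvgrPdist_lt /(_ e e0) [N _ /(_ N (leqnn N))] /=.
by rewrite ltNge => /negP; apply; have [] := hy N.
Unshelve. all: by end_near. Qed.

End continuity_metric.

Section vector_measurability.
Context {R : realType} {n : nat} {d : measure_display} {T : measurableType d}.
Implicit Types f g : T -> 'rV[R]_n.

Lemma measurable_fun_coord f j : measurable_fun setT f ->
  measurable_fun setT (fun t => f t ord0 j).
Proof. by move=> mf; apply: (measurableT_comp (measurable_coord ord0 j)). Qed.

Lemma measurable_fun_dotv f g : measurable_fun setT f -> measurable_fun setT g ->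
  measurable_fun setT (fun t => dotv (f t) (g t)).
Proof.
by move=> mf mg; apply: measurable_sum => j; apply: measurable_funM; exact: measurable_fun_coord.
Qed.

Lemma measurable_fun_subv f g : measurable_fun setT f -> measurable_fun setT g ->
  measurable_fun setT (fun t => f t - g t).
Proof.
move=> mf mg; apply: measurable_fun_mx => i j; rewrite (ord1 i).
under eq_fun do rewrite !mxE.
by apply: measurable_funB; exact: measurable_fun_coord.
Qed.

End vector_measurability.

Lemma bounded_integrable (R : realType) d (T : measurableType d)
    (m : {finite_measure set T -> \bar R}) (f : T -> R) (c : R) :
  measurable_fun setT f -> (forall t, `|f t| <= c) -> m.-integrable setT (EFin \o f).
Proof.
move=> mf fc; apply: (@le_integrable _ _ _ m setT measurableT _ (cst c%:E)).
- by apply/measurable_EFinP.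
- by move=> t _ /=; rewrite lee_fin (le_trans (fc t))// ler_norm.
- exact: finite_measure_integrable_cst.
Qed.

Section fourier_of_occupation.
Context {R : realType} {n : nat} {d : measure_display} {T : measurableType d}.
Variables (m : {finite_measure set T -> \bar R}) (X : T -> 'rV[R]_n).
Hypothesis mX : measurable_fun setT X.

(** Real part of [exp (i <xi, x>)] times the conjugate Fourier transform at [xi] of the image of [m]
    under [X]: the integrand of Fourier inversion at [x]. *)
Definition fourier_cos (x xi : 'rV[R]_n) : R :=
  \int[m]_t cos (dotv xi (x - X t)).

(** Convolution with an unnormalised Gaussian; [s] is the inverse of its standard deviation. *)
Definition heat_potential (s : R) (x : 'rV[R]_n) : R :=
  \int[m]_t expR (- (s ^+ 2 * dotv (x - X t) (x - X t)) / 2).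

Let mcos (f : R -> R) (x xi : 'rV[R]_n) : measurable_fun setT f ->
  measurable_fun setT (fun t => f (dotv xi (x - X t))).
Proof.
by move=> mf; apply: (measurableT_comp mf); apply: measurable_fun_dotv => //;
  exact: measurable_fun_subv.
Qed.

Let measurable_cosR : measurable_fun [set: R] (@cos R).
Proof. exact: continuous_measurable_fun (@continuous_cos R). Qed.

Let measurable_sinR : measurable_fun [set: R] (@sin R).
Proof. exact: continuous_measurable_fun (@continuous_sin R). Qed.

Lemma integrable_fourier_cos x xi :
  m.-integrable setT (fun t => (cos (dotv xi (x - X t)))%:E).
Proof. by apply: (@bounded_integrable _ _ _ m _ 1) => [|t]; [exact: (mcos _ _ measurable_cosR)|exact: cos_max]. Qed.

Lemma integrable_fourier_sin x xi :
  m.-integrable setT (fun t => (sin (dotv xi (x - X t)))%:E).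
Proof. by apply: (@bounded_integrable _ _ _ m _ 1) => [|t]; [exact: (mcos _ _ measurable_sinR)|exact: sin_max]. Qed.

(* With [N] the sine transform, the right-hand side is [M ^+ 2 + N ^+ 2]. *)
Lemma sqr_fourier_cos_le x xi : fourier_cos x xi ^+ 2 <=
  \int[m]_t \int[m]_r cos (dotv xi (X t - X r)).
Proof.
set M := fourier_cos x xi; set N := \int[m]_t sin (dotv xi (x - X t)).
have ic := integrable_fourier_cos x xi; have isn := integrable_fourier_sin x xi.
have -> : \int[m]_t \int[m]_r cos (dotv xi (X t - X r)) =
    \int[m]_t (M * cos (dotv xi (x - X t)) + N * sin (dotv xi (x - X t))).
  apply: eq_Rintegral => t _.
  pose a := cos (dotv xi (x - X t)); pose b := sin (dotv xi (x - X t)).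
  transitivity (\int[m]_r (a * cos (dotv xi (x - X r)) + b * sin (dotv xi (x - X r)))).
    apply: eq_Rintegral => r _; rewrite -cosB -cosN; congr cos.
    rewrite /dotv -sumrB -sumrN; apply: eq_bigr => j _; rewrite !mxE; ring.
  rewrite RintegralD//; last 2 first.
  - exact: (integrableZl measurableT a ic).
  - exact: (integrableZl measurableT b isn).
  rewrite (RintegralZl _ measurableT ic) (RintegralZl _ measurableT isn).
  by rewrite -/M -/N -/a -/b mulrC [b * N]mulrC.
rewrite RintegralD//; last 2 first.
- exact: (integrableZl measurableT M ic).
- exact: (integrableZl measurableT N isn).
rewrite (RintegralZl _ measurableT ic) (RintegralZl _ measurableT isn) -/M -/N.
by rewrite -!expr2 lerDl sqr_ge0.
Qed.

Let mass : R := fine (m setT).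

Let massE : m setT = mass%:E.
Proof. by rewrite fineK// fin_num_measure. Qed.

Let int1 : (\int[m]_t 1 = mass%:E)%E.
Proof. by rewrite integral_cst// mul1e; exact: massE. Qed.

Lemma normr_fourier_cos_le x xi : `|fourier_cos x xi| <= mass.
Proof.
apply: (le_trans (le_normr_Rintegral _ (integrable_fourier_cos x xi))) => //.
apply: (@le_trans _ _ (\int[m]_t 1)); last by rewrite Rintegral_cst// mul1r.
apply: le_Rintegral => //.
- exact: (integrable_norm (integrable_fourier_cos x xi)).
- exact: finite_measure_integrable_cst.
- by move=> t _; exact: cos_max.
Qed.

Lemma integral_1Dcos x xi :
  (\int[m]_t (1 + cos (dotv xi (x - X t)))%:E = (mass + fourier_cos x xi)%:E)%E.
Proof.
under eq_integral do rewrite EFinD.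
rewrite integralD//; last 2 first.
- exact: finite_measure_integrable_cst.
- exact: integrable_fourier_cos.
rewrite EFinD int1; congr (_ + _)%E.
rewrite /fourier_cos /Rintegral fineK//; apply: integrable_fin_num => //.
exact: integrable_fourier_cos.
Qed.

Let measurable_1Dcos2 x : measurable_fun setT
  (fun p : 'rV[R]_n * T => (1 + cos (dotv p.1 (x - X p.2)))%:E).
Proof.
apply/measurable_EFinP; apply: measurable_funD => //.
apply: (measurableT_comp measurable_cosR); apply: measurable_fun_dotv => //.
by apply: measurable_fun_subv => //; exact: measurableT_comp.
Qed.

Lemma measurable_fourier_cos x : measurable_fun setT (fourier_cos x).
Proof.
have h : measurable_fun setT (fun xi => (mass + fourier_cos x xi)%:E).
  under eq_fun do rewrite -integral_1Dcos.
  apply: (measurable_fun_fubini_tonelli_F (m2 := m) _ (measurable_1Dcos2 x)) => p.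
  by rewrite lee_fin cos_ge0D1.
have {}h : measurable_fun setT (fun xi => mass + fourier_cos x xi).
  by apply/measurable_EFinP.
rewrite (_ : fourier_cos x = (fun xi => (mass + fourier_cos x xi) - mass)).
  exact: measurable_funB.
by apply/funext => xi; rewrite addrC addKr.
Qed.

Lemma measurable_heat_potential_integrand (s : R) (x : 'rV[R]_n) :
  measurable_fun setT (fun t => expR (- (s ^+ 2 * dotv (x - X t) (x - X t)) / 2)).
Proof.
apply: measurableT_comp => //; apply: measurable_funM => //.
apply: measurableT_comp => //; apply: measurable_funM => //.
by apply: measurable_fun_dotv; exact: measurable_fun_subv.
Qed.

Lemma dotv_ge0 (x : 'rV[R]_n) : 0 <= dotv x x.
Proof. by apply: sumr_ge0 => j _; rewrite -expr2 sqr_ge0. Qed.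

Lemma heat_integrand_le1 (s : R) (x : 'rV[R]_n) :
  expR (- (s ^+ 2 * dotv x x) / 2) <= 1.
Proof.
rewrite -expR0 ler_expR mulNr oppr_le0 divr_ge0// mulr_ge0 ?sqr_ge0//.
exact: dotv_ge0.
Qed.

Lemma integrable_heat_potential s x :
  m.-integrable setT (fun t => (expR (- (s ^+ 2 * dotv (x - X t) (x - X t)) / 2))%:E).
Proof.
apply: (@bounded_integrable _ _ _ m _ 1); first exact: measurable_heat_potential_integrand.
by move=> t; rewrite ger0_norm ?expR_ge0// heat_integrand_le1.
Qed.

Lemma heat_potential_ge0 s x : 0 <= heat_potential s x.
Proof. by apply: Rintegral_ge0 => t _; exact: expR_ge0. Qed.

Lemma heat_potentialE s x : (heat_potential s x)%:E =
  (\int[m]_t (expR (- (s ^+ 2 * dotv (x - X t) (x - X t)) / 2))%:E)%E.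
Proof.
by rewrite /heat_potential /Rintegral fineK//; apply: integrable_fin_num => //;
  exact: integrable_heat_potential.
Qed.

Lemma integrable_gauss_fourier_cos s x :
  (lebesgue_rV n).-integrable setT (fun xi => (gauss_rV s xi * fourier_cos x xi)%:E).
Proof.
apply: (@le_integrable _ _ _ (lebesgue_rV n) setT measurableT _
  (fun xi => mass%:E * (gauss_rV s xi)%:E)%E).
- apply/measurable_EFinP; apply: measurable_funM; first exact: measurable_gauss_rV.
  exact: measurable_fourier_cos.
- move=> xi _; rewrite -EFinM /= lee_fin !normrM mulrC ler_wpM2r//.
  by apply: (le_trans (normr_fourier_cos_le x xi)); exact: ler_norm.
- apply: integrableZl => //; apply/integrableP; split.
    by apply/measurable_EFinP; exact: measurable_gauss_rV.
  under eq_integral do rewrite gee0_abs ?lee_fin ?gauss_rV_ge0//.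
  by rewrite integral_gauss_rV ltry.
Qed.

(** The Gaussian of inverse deviation [s] is the cosine transform of the density [gauss_rV s].
    Tonelli is applied to [1 + cos], and the contribution of the added 1 is the same finite mass on
    both sides. *)
Lemma heat_potential_fourier (s : R) (x : 'rV[R]_n) : s != 0 ->
  (heat_potential s x)%:E =
  (\int[lebesgue_rV n]_xi (gauss_rV s xi * fourier_cos x xi)%:E)%E.
Proof.
move=> s0.
pose F (p : 'rV[R]_n * T) := (gauss_rV s p.1 * (1 + cos (dotv p.1 (x - X p.2))))%:E.
have mF : measurable_fun setT F.
  apply/measurable_EFinP; apply: measurable_funM.
    by apply: (measurableT_comp (measurable_gauss_rV s)).
  by apply/measurable_EFinP; exact: measurable_1Dcos2.
have F0 p : (0 <= F p)%E by rewrite lee_fin mulr_ge0 ?gauss_rV_ge0 ?cos_ge0D1.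
have ig : (lebesgue_rV n).-integrable setT (fun xi => (mass%:E * (gauss_rV s xi)%:E)%E).
  apply: integrableZl => //; apply/integrableP; split.
    by apply/measurable_EFinP; exact: measurable_gauss_rV.
  under eq_integral do rewrite gee0_abs ?lee_fin ?gauss_rV_ge0//.
  by rewrite integral_gauss_rV ltry.
have ig1 : (lebesgue_rV n).-integrable setT (fun xi => (gauss_rV s xi)%:E).
  apply/integrableP; split.
    by apply/measurable_EFinP; exact: measurable_gauss_rV.
  under eq_integral do rewrite gee0_abs ?lee_fin ?gauss_rV_ge0//.
  by rewrite integral_gauss_rV ltry.
have A1 : (\int[lebesgue_rV n]_xi \int[m]_t F (xi, t) =
   mass%:E + \int[lebesgue_rV n]_xi (gauss_rV s xi * fourier_cos x xi)%:E)%E.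
  transitivity (\int[lebesgue_rV n]_xi (mass%:E * (gauss_rV s xi)%:E +
     (gauss_rV s xi * fourier_cos x xi)%:E))%E.
    apply: eq_integral => xi _.
    transitivity (\int[m]_t ((gauss_rV s xi)%:E * (1 + cos (dotv xi (x - X t)))%:E))%E.
      by [].
    have mc : measurable_fun setT (fun t => (1 + cos (dotv xi (x - X t)))%:E).
      by apply/measurable_EFinP; apply: measurable_funD => //; exact: (mcos _ _ measurable_cosR).
    rewrite ge0_integralZl ?lee_fin ?gauss_rV_ge0//.
    by rewrite integral_1Dcos -!EFinM -EFinD; congr (_%:E); ring.
  rewrite integralD//; last exact: integrable_gauss_fourier_cos.
  by rewrite integralZl// integral_gauss_rV mule1.
have A2 : (\int[m]_t \int[lebesgue_rV n]_xi F (xi, t) = mass%:E + (heat_potential s x)%:E)%E.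
  transitivity (\int[m]_t (1%:E + (expR (- (s ^+ 2 * dotv (x - X t) (x - X t)) / 2))%:E))%E.
    apply: eq_integral => t _; rewrite -EFinD.
    have := integral_1Dcos_gauss_rV 0 (x - X t) s0; rewrite cos0 mul1r => <-.
    apply: eq_integral => xi _; rewrite /F /= add0r; congr (_ * (1 + cos _))%:E.
    by apply: eq_bigr => j _; rewrite mulrC.
  rewrite integralD//; last 2 first.
  - exact: finite_measure_integrable_cst.
  - exact: integrable_heat_potential.
  by rewrite int1 -heat_potentialE.
have := fubini_tonelli F mF F0 (m1 := lebesgue_rV n) (m2 := m).
rewrite A1 A2 => h.
have := congr1 (fun y => y - mass%:E)%E h.
by rewrite [(mass%:E + _)%E]addeC addeK// [(mass%:E + _)%E]addeC addeK// => ->.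
Qed.

Lemma heat_potential_le (D : 'rV[R]_n -> R) (s : R) (x : 'rV[R]_n) : s != 0 ->
  measurable_fun setT D -> (forall xi, `|fourier_cos x xi| <= D xi) ->
  ((heat_potential s x)%:E <= \int[lebesgue_rV n]_xi (gauss_rV s xi * D xi)%:E)%E.
Proof.
move=> s0 mD MD; rewrite heat_potential_fourier//.
apply: (le_trans (lee_abs _)).
apply: (le_trans (le_abse_integral (lebesgue_rV n) measurableT _)).
  apply/measurable_EFinP; apply: measurable_funM; first exact: measurable_gauss_rV.
  exact: measurable_fourier_cos.
apply: ge0_le_integral => //.
- apply: measurableT_comp => //; apply/measurable_EFinP.
  apply: measurable_funM; first exact: measurable_gauss_rV.
  exact: measurable_fourier_cos.
- by apply/measurable_EFinP; apply: measurable_funM => //; exact: measurable_gauss_rV.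
- move=> xi _ /=; rewrite lee_fin normrM ger0_norm ?gauss_rV_ge0//.
  by rewrite ler_wpM2l ?gauss_rV_ge0.
Qed.

End fourier_of_occupation.

Section gaussian_scaling.
Context {R : realType} {n : nat}.

Lemma normal_peak_scale (s : R) : 0 < s -> normal_peak s = s^-1 * normal_peak 1.
Proof.
move=> s0; rewrite /normal_peak expr1n -mulrnAr -[1 * pi *+ 2]mulrnAr sqrtrM ?sqr_ge0//.
by rewrite sqrtr_sqr gtr0_norm// mul1r invfM.
Qed.

Lemma gauss_rV_expR (s : R) (x : 'rV[R]_n) : s != 0 ->
  gauss_rV s x = normal_peak s ^+ n * expR (- (s ^- 2 * dotv x x) / 2).
Proof.
move=> s0; rewrite /gauss_rV.
under eq_bigr do rewrite normal_pdfE// /normal_fun subr0.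
rewrite big_split /= prodr_const card_ord -expR_sum; congr (_ * expR _).
rewrite /dotv mulr_sumr -sumrN mulr_suml; apply: eq_bigr => j _.
by rewrite -[_ *+ 2]mulr_natr; field.
Qed.

End gaussian_scaling.

Section riesz_kernel_theory.
Context {R : realType} {n : nat}.
Variable alpha : R.
Hypothesis alphan : alpha < n%:R.

Lemma riesz_kernel_ge0 (z : 'rV[R]_n) : (0 <= riesz_kernel alpha z)%E.
Proof. by rewrite /riesz_kernel; case: ifP => // _; rewrite lee_fin powR_ge0. Qed.

(** Scaling away from the origin; at the origin both sides are infinite because the constant is
    positive. *)
Lemma subordination_riesz_kernel (z : 'rV[R]_n) :
  subordination (n%:R - alpha) 1 (enorm z) =
  (subordination (n%:R - alpha) 1 1 * riesz_kernel alpha z)%E.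
Proof.
have a0 : 0 < n%:R - alpha by rewrite subr_gt0.
rewrite /riesz_kernel; case: eqVneq => [->|z0].
  by rewrite enorm0 subordination0// gt0_muley// subordination_gt0.
rewrite subordination_scale ?expr1n// ?opprB 1?muleC//.
by rewrite lt_neqAle enorm_ge0 andbT eq_sym enorm_eq0.
Qed.

Lemma measurable_riesz_kernel :
  measurable_fun setT (fun z : 'rV[R]_n => riesz_kernel alpha z).
Proof.
apply: measurable_fun_ifT.
- apply: (measurable_fun_bool true).
  rewrite setTI (_ : _ @^-1` _ = cubev 0 0); first exact: measurable_cubev.
  apply/seteqP; split => x /=.
    by move=> /eqP -> i; rewrite subrr normr0.
  move=> h; apply/eqP/rowP => i; apply/eqP.
  by have := h i; rewrite normr_le0 subr_eq0.
- exact: measurable_cst.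
- apply/measurable_EFinP; apply: (measurableT_comp (measurable_powR _)).
  exact: measurable_enorm.
Qed.

End riesz_kernel_theory.

Lemma measurable_subordination2 (R : realType) n d (T : measurableType d) (b e : R)
    (f : T -> 'rV[R]_n) : measurable_fun setT f ->
  measurable_fun setT (fun p : T * measurableTypeR R =>
    (expR (e * b * p.2 - enorm (f p.1) ^+ 2 * expR (2 * e * p.2) / 2))%:E).
Proof.
move=> mf; apply/measurable_EFinP; apply: measurableT_comp => //.
apply: measurable_funB; first exact: measurable_funM.
apply: measurable_funM => //; apply: measurable_funM.
  apply: measurable_funX; apply: (measurableT_comp (@measurable_enorm R n)).
  exact: measurableT_comp.
by apply: measurableT_comp => //; exact: measurable_funM.
Qed.

Section riesz_potential_regularity.
Context {R : realType} {n : nat} {d : measure_display} {T : measurableType d}.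
Variables (m : {finite_measure set T -> \bar R}) (X : T -> 'rV[R]_n).
Hypothesis mX : measurable_fun setT X.
Local Notation mu := (@lebesgue_measure R).

Variable alpha : R.
Hypothesis alphan : alpha < n%:R.
Let a := n%:R - alpha.

Lemma riesz_potential_pushforward x :
  riesz_potential alpha (pushforward m X) x =
  (\int[m]_t riesz_kernel alpha (x - X t))%E.
Proof.
rewrite /riesz_potential.
have := @ge0_integral_pushforward _ _ _ _ R X mX m setT
  (fun y => riesz_kernel alpha (x - y)) measurableT.
rewrite preimage_setT; apply.
  apply: (measurableT_comp (measurable_riesz_kernel alpha)).
  exact: measurable_fun_subv.
by move=> y _; exact: riesz_kernel_ge0.
Qed.

(** Integrating the subordination formula against the occupation first leaves, for each scale [u],
    one heat potential, to which the Fourier bound applies. *)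
Let F (x : 'rV[R]_n) (u : R) := expR (a * u) * heat_potential m X (expR u) x.

Let integrandE (z : 'rV[R]_n) (u : R) :
  expR (1 * a * u - enorm z ^+ 2 * expR (2 * 1 * u) / 2) =
  expR (a * u) * expR (- (expR u ^+ 2 * dotv z z) / 2).
Proof.
rewrite -expRD mul1r mulr1 sqr_enorm; congr (expR _).
by rewrite -expRM_natl mulNr; congr (_ - _); ring.
Qed.

Let G x (p : T * measurableTypeR R) :=
  (expR (1 * a * p.2 - enorm (x - X p.1) ^+ 2 * expR (2 * 1 * p.2) / 2))%:E.

Let mG x : measurable_fun setT (G x).
Proof.
exact: (measurable_subordination2 a 1 (measurable_fun_subv (measurable_cst x) mX)).
Qed.

Let G0 x p : (0 <= G x p)%E.
Proof. by rewrite lee_fin expR_ge0. Qed.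

Let FE x u : (F x u)%:E = (\int[m]_t G x (t, u))%E.
Proof.
rewrite /F EFinM heat_potentialE// -ge0_integralZl//.
- by apply: eq_integral => t _; rewrite /G /= integrandE EFinM.
- by apply/measurable_EFinP; exact: measurable_heat_potential_integrand.
Qed.

Let mF x : measurable_fun setT (F x : measurableTypeR R -> R).
Proof.
apply/measurable_EFinP; rewrite (_ : EFin \o F x = fubini_G m (G x)).
  exact: measurable_fun_fubini_tonelli_G.
by apply/funext => u; rewrite /= FE.
Qed.

Lemma subordination_riesz_potential x :
  (subordination a 1 1 * riesz_potential alpha (pushforward m X) x =
   \int[mu]_u (F x u)%:E)%E.
Proof.
rewrite riesz_potential_pushforward -ge0_integralZl//; last 3 first.
- apply: (measurableT_comp (measurable_riesz_kernel alpha)).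
  exact: measurable_fun_subv.
- by move=> t _; exact: riesz_kernel_ge0.
- by apply/ltW/subordination_gt0; rewrite subr_gt0.
under eq_integral do rewrite -(subordination_riesz_kernel alphan).
transitivity (\int[m]_t \int[mu]_u G x (t, u))%E; first by [].
by rewrite (fubini_tonelli (G x))//; apply: eq_integral => u _; rewrite FE.
Qed.

Variables (D : 'rV[R]_n -> R).
Hypothesis mD : measurable_fun setT D.
Hypothesis MD : forall x xi, `|fourier_cos m X x xi| <= D xi.
Hypothesis intD :
  (\int[lebesgue_rV n]_xi (subordination alpha (-1) (enorm xi) * (D xi)%:E) < +oo)%E.

Let D0 xi : 0 <= D xi. Proof. exact: le_trans (MD 0 xi). Qed.

Let C := normal_peak (1 : R) ^+ n.
Let C0 : 0 <= C. Proof. by rewrite exprn_ge0// normal_peak_ge0. Qed.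

Let g (u : R) : \bar R := (\int[lebesgue_rV n]_xi
  (C%:E * ((expR (-1 * alpha * u - enorm xi ^+ 2 * expR (2 * -1 * u) / 2))%:E * (D xi)%:E)))%E.

Let F0 x u : 0 <= F x u.
Proof. by rewrite mulr_ge0 ?expR_ge0// heat_potential_ge0. Qed.

(** The density [gauss_rV (expR u)] carries [exp (- n u)]; with [a = n - alpha] the prefactors
    combine to [exp (- alpha u)], the integrand of the subordination with [e = -1]. The bound is
    independent of [x]. *)
Let Fg x u : ((F x u)%:E <= g u)%E.
Proof.
have u0 : expR u != 0 by rewrite gt_eqF// expR_gt0.
have mDg : measurable_fun setT (fun xi => (gauss_rV (expR u) xi * D xi)%:E).
  by apply/measurable_EFinP; apply: measurable_funM => //; exact: measurable_gauss_rV.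
have : ((F x u)%:E <= (expR (a * u))%:E *
    \int[lebesgue_rV n]_xi (gauss_rV (expR u) xi * D xi)%:E)%E.
  by rewrite EFinM lee_wpmul2l ?lee_fin ?expR_ge0//; exact: heat_potential_le.
move=> /le_trans; apply.
rewrite -ge0_integralZl//; last first.
  by move=> xi _; rewrite lee_fin mulr_ge0 ?gauss_rV_ge0.
rewrite le_eqVlt; apply/orP; left; apply/eqP; apply: eq_integral => xi _; rewrite -!EFinM; congr (_%:E).
rewrite !mulrA; congr (_ * _); rewrite gauss_rV_expR// normal_peak_scale ?expR_gt0//.
rewrite exprMn -/C -expRN.
have -> : expR (- u) ^+ n = expR (n%:R * - u) by rewrite expRM_natl.
rewrite [LHS](_ : _ = C * (expR (a * u) * expR (n%:R * - u) *
   expR (- (expR u ^- 2 * dotv xi xi) / 2))); last by ring.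
congr (_ * _); rewrite -!expRD; congr expR; rewrite sqr_enorm.
have -> : expR (2 * -1 * u) = expR u ^- 2 by rewrite -expRM_natl -expRN; congr expR; ring.
by rewrite /a; ring.
Qed.

Let mH : measurable_fun setT (fun p : measurableTypeR R * 'rV[R]_n =>
  (C%:E * ((expR (-1 * alpha * p.1 - enorm p.2 ^+ 2 * expR (2 * -1 * p.1) / 2))%:E *
    (D p.2)%:E))%E).
Proof.
apply: emeasurable_funM => //; apply: emeasurable_funM; last first.
  by apply/measurable_EFinP; exact: measurableT_comp.
apply/measurable_EFinP; apply: measurableT_comp => //.
apply: measurable_funB; first exact: measurable_funM.
apply: measurable_funM => //; apply: measurable_funM.
  by apply: measurable_funX; apply: (measurableT_comp (@measurable_enorm R n)).
by apply: measurableT_comp => //; exact: measurable_funM.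
Qed.

Let H0 (p : measurableTypeR R * 'rV[R]_n) :
  (0 <= C%:E * ((expR (-1 * alpha * p.1 - enorm p.2 ^+ 2 * expR (2 * -1 * p.1) / 2))%:E *
    (D p.2)%:E))%E.
Proof. by rewrite !mule_ge0 ?lee_fin ?expR_ge0. Qed.

Let g0 u : (0 <= g u)%E.
Proof. by apply: integral_ge0 => xi _; exact: (H0 (u, xi)). Qed.

(** By Tonelli the integral of [g] is [C] times the weighted integral of [D] assumed finite. *)
Let ig : mu.-integrable setT g.
Proof.
apply/integrableP; split.
  exact: (measurable_fun_fubini_tonelli_F _ mH H0).
under eq_integral do rewrite gee0_abs//.
have -> : (\int[mu]_u g u = \int[lebesgue_rV n]_xi
    (C%:E * (subordination alpha (-1) (enorm xi) * (D xi)%:E)))%E.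
  rewrite /g (fubini_tonelli _ mH H0) /=; apply: eq_integral => xi _.
  rewrite ge0_integralZl//; last 2 first.
  - apply: emeasurable_funM => //; apply/measurable_EFinP.
    exact: measurable_subordination.
  - by move=> u _; rewrite mule_ge0 ?lee_fin ?expR_ge0.
  congr (_ * _)%E; rewrite ge0_integralZr//.
  - by apply/measurable_EFinP; exact: measurable_subordination.
  - by rewrite lee_fin.
have msub : measurable_fun setT (fun xi : 'rV[R]_n => (subordination alpha (-1) (enorm xi) * (D xi)%:E)%E).
  apply: emeasurable_funM; last exact/measurable_EFinP.
  apply: (measurable_fun_fubini_tonelli_F (m2 := mu)
    (fun p : 'rV[R]_n * measurableTypeR R => (expR (-1 * alpha * p.2 - enorm p.1 ^+ 2 * expR (2 * -1 * p.2) / 2))%:E)).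
    exact: (measurable_subordination2 alpha (-1) (@measurable_id _ 'rV[R]_n setT)).
  by move=> p; rewrite lee_fin expR_ge0.
rewrite ge0_integralZl//.
- by rewrite lte_mul_pinfty ?lee_fin.
- move=> xi _; rewrite mule_ge0 ?lee_fin//.
  by apply: integral_ge0 => u _; rewrite lee_fin expR_ge0.
Qed.

Variable rho : R.
Hypothesis Xrho : forall t j, `|X t ord0 j| <= rho.

Lemma dotvE_expR_continuous (s : R) (y : 'rV[R]_n) :
  continuous (fun x : 'rV[R]_n => expR (- (s ^+ 2 * dotv (x - y) (x - y)) / 2)).
Proof.
have h : continuous (fun x : 'rV[R]_n => \sum_(j < n) (x - y) ord0 j * (x - y) ord0 j).
  apply: continuous_big => [|i _ x]; first exact: add_continuous.
  have c : continuous_at x (fun x : 'rV[R]_n => (x - y) ord0 i).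
    rewrite (_ : (fun x : 'rV[R]_n => _) = (fun x : 'rV[R]_n => x ord0 i - y ord0 i)); last first.
      by apply/funext => z; rewrite !mxE.
    by apply: continuousB; [exact: coord_continuous|exact: cst_continuous].
  by apply: continuousM.
move=> x; apply: (@continuous_comp _ _ _ (fun x : 'rV[R]_n => - (s ^+ 2 * dotv (x - y) (x - y)) / 2) expR).
  apply: continuousM; last exact: cst_continuous.
  apply: continuousN; apply: continuousM; first exact: cst_continuous.
  exact: h.
exact: continuous_expR.
Qed.

Lemma continuous_heat_potential (s : R) : continuous (heat_potential m X s).
Proof.
apply: (@continuous_integral _ 'rV[R]_n _ _ m
  (fun x t => expR (- (s ^+ 2 * dotv (x - X t) (x - X t)) / 2)) (cst 1%E)).
- by move=> x; exact: measurable_heat_potential_integrand.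
- by move=> t; exact: dotvE_expR_continuous.
- by move=> x t; rewrite ger0_norm ?expR_ge0// lee_fin heat_integrand_le1.
- exact: finite_measure_integrable_cst.
Qed.

Lemma compact_cubev (r : R) : compact (cubev (0 : 'rV[R]_n) r).
Proof.
have -> : cubev (0 : 'rV[R]_n) r = [set v : 'rV[R]_n | forall i, `[- r, r]%classic (v ord0 i)].
  by apply/seteqP; split => x /= h i; have := h i; rewrite mxE subr0 in_itv /= ler_norml.
by apply: (rV_compact (A := fun=> `[- r, r]%classic)) => i; exact: segment_compact.
Qed.

Lemma not_cubevP (r : R) (x : 'rV[R]_n) : ~ cubev 0 r x -> exists j, r < `|x ord0 j|.
Proof.
move=> h; apply: contrapT => h2; apply: h => j; rewrite mxE subr0 leNgt.
by apply/negP => jr; apply: h2; exists j.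
Qed.

Lemma enorm_sub_gt (r : R) (x : 'rV[R]_n) t : ~ cubev 0 (rho + r) x -> r < enorm (x - X t).
Proof.
move=> /not_cubevP[j jr]; apply: (lt_le_trans _ (ler_coord_enorm _ j)).
rewrite !mxE; have := lerB_dist (x ord0 j) (X t ord0 j); have := Xrho t j; lra.
Qed.

(** The common majorant [g] of the functions [F x] gives finiteness, the bound and continuity. Decay
    at infinity comes from the kernel itself, since [X] stays in a bounded cube. *)
Lemma riesz_potential_regular : exists U : 'rV[R]_n -> R,
  [/\ forall x, riesz_potential alpha (pushforward m X) x = (U x)%:E,
      C_infty n U & [bounded U x | x in setT]].
Proof.
have a0 : 0 < a by rewrite subr_gt0.
have S0 := subordination_gt0 a0.
have Sfin : subordination a 1 1 \is a fin_num.
  by rewrite ge0_fin_numE ?(ltW S0)// subordination_lty// expr1n.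
pose S := fine (subordination a 1 1).
have SE : subordination a 1 1 = S%:E by rewrite fineK.
have S0' : 0 < S by rewrite -lte_fin -SE.
have iF x : mu.-integrable setT (fun u => (F x u)%:E).
  apply: le_integrable ig => //; first by apply/measurable_EFinP; exact: mF.
  by move=> u _ /=; rewrite ger0_norm//; apply: le_trans (lee_abs _).
pose U x := S^-1 * \int[mu]_u F x u.
have UE x : riesz_potential alpha (pushforward m X) x = (U x)%:E.
  have := subordination_riesz_potential x.
  have r0 : (0 <= riesz_potential alpha (pushforward m X) x)%E.
    by rewrite riesz_potential_pushforward; apply: integral_ge0 => y _; exact: riesz_kernel_ge0.
  have fin := integrable_fin_num measurableT (iF x).
  rewrite SE -(fineK fin) /U /Rintegral.
  (* An infinite potential times the positive constant would be infinite, whereas the integral of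
     [F x] is finite. *)
  case: (riesz_potential _ _ _) r0 => [y| |]// _.
    by move=> -[<-]; rewrite mulKf// gt_eqF.
  by rewrite gt0_muley.
exists U; split => //; last first.
  exists (S^-1 * fine (\int[mu]_u g u)); split; first exact: num_real.
  move=> M /ltW BM x _ /=; apply: le_trans BM.
  rewrite /U normrM gtr0_norm ?invr_gt0// ler_pM2l ?invr_gt0//.
  have gfin := integrable_fin_num measurableT ig.
  rewrite ger0_norm; last by apply: Rintegral_ge0 => u _.
  rewrite /Rintegral fine_le//; first exact: integrable_fin_num.
  apply: ge0_le_integral.
  - exact: measurableT.
  - by move=> u _; rewrite lee_fin.
  - by apply/measurable_EFinP; exact: mF.
  - by have /integrableP[] := ig.
  - by move=> u _.
split.
  move=> x; apply: (@continuousM _ _ (fun=> S^-1) (fun x => \int[mu]_u F x u)).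
    exact: cst_continuous.
  apply: (@continuous_integral _ 'rV[R]_n _ _ mu F g) => //.
  - move=> u y.
    apply: (@continuousM _ _ (fun=> expR (a * u)) (heat_potential m X (expR u))).
      exact: cst_continuous.
    exact: continuous_heat_potential.
  - by move=> y u; rewrite ger0_norm.
move=> e e0; pose mass := fine (m setT).
have mass0 : 0 <= mass by rewrite fine_ge0.
have me0 : 0 < (mass + 1) / e by rewrite divr_gt0// ltr_wpDl.
(* At distance more than [r] from the range of [X] the kernel is at most [e / (mass + 1)], so the
   potential is at most [e * mass / (mass + 1) < e]; the added 1 also covers zero mass. *)
pose r := ((mass + 1) / e) `^ a^-1.
have r0 : 0 < r by rewrite powR_gt0.
have ra : r `^ (alpha - n%:R) = e / (mass + 1).
  have -> : alpha - n%:R = - a by rewrite /a opprB.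
  by rewrite powRN -powRrM mulVf ?gt_eqF// powRr1 ?(ltW me0)// invf_div.
exists (cubev 0 (rho + r)); first exact: compact_cubev.
move=> x nx; have : (riesz_potential alpha (pushforward m X) x <= (e / (mass + 1) * mass)%:E)%E.
  rewrite riesz_potential_pushforward.
  apply: (@le_trans _ _ (\int[m]_t (cst (e / (mass + 1))%:E t))%E).
    apply: ge0_le_integral => //.
    - by move=> t _; exact: riesz_kernel_ge0.
    - apply: (measurableT_comp (measurable_riesz_kernel alpha)).
      exact: measurable_fun_subv.
    - move=> t _; have zr := enorm_sub_gt t nx; rewrite /riesz_kernel.
      case: eqVneq => [z0|_]; first by move: zr; rewrite z0 enorm0 ltNge ltW.
      rewrite lee_fin -ra; have -> : alpha - n%:R = - a by rewrite /a opprB.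
      rewrite !powRN lef_pV2 ?posrE ?powR_gt0//; last exact: lt_trans zr.
      by apply: ge0_ler_powR; rewrite ?nnegrE ?enorm_ge0// ltW.
  by rewrite integral_cst// [leRHS]EFinM [in leRHS]/mass fineK ?fin_num_measure.
have U0 : 0 <= U x.
  by rewrite mulr_ge0 ?invr_ge0 ?(ltW S0')//; apply: Rintegral_ge0 => u _.
rewrite UE lee_fin ger0_norm// => /le_lt_trans; apply.
rewrite -mulrA gtr_pMr// mulrC ltr_pdivrMr ?mul1r ?ltrDl//.
by rewrite ltr_wpDl.
Qed.

End riesz_potential_regularity.

(** * Regularity of local times from the Fourier transform *)

Section density_measure.
Context d (T : measurableType d) (R : realType).
Variables (mu : {measure set T -> \bar R}) (f : T -> R).
Hypotheses (mf : measurable_fun setT f) (f0 : forall x, 0 <= f x).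

(** The two proofs are arguments, so that the measure structure attached below can be recovered from
    the term itself. *)
Definition density_measure of measurable_fun setT f & (forall x, 0 <= f x) :=
  fun A : set T => (\int[mu]_(x in A) (f x)%:E)%E.

Local Notation nu := (density_measure mf f0).

Let nu0 : nu set0 = 0%E.
Proof. by rewrite /density_measure integral_set0. Qed.

Let nu_ge0 A : (0 <= nu A)%E.
Proof. by apply: integral_ge0 => x _; rewrite lee_fin. Qed.

Let nu_sigma_additive : semi_sigma_additive nu.
Proof.
move=> A mA tA mUA; rewrite /density_measure ge0_integral_bigcup//=.
- apply: is_cvg_ereal_nneg_natsum_cond => n _ _.
  by apply: integral_ge0 => x _; rewrite lee_fin.
- by apply/measurable_funTS/measurable_EFinP.
- by move=> x _; rewrite lee_fin.
Qed.

HB.instance Definition _ := isMeasure.Build _ _ _ nu nu0 nu_ge0 nu_sigma_additive.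

End density_measure.

Section obox_exhaustion.
Context {R : realType} {n : nat}.
Implicit Types a b : 'I_n -> R.

Lemma obox_exhaustion a b (m : {measure set 'rV[R]_n -> \bar R}) :
  (fun i => m (obox (fun j => a j + i.+1%:R^-1) (fun j => b j - i.+1%:R^-1))) @ \oo --> m (obox a b).
Proof.
pose A i := obox (fun j => a j + i.+1%:R^-1) (fun j => b j - i.+1%:R^-1).
have <- : \bigcup_i A i = obox a b.
  apply/seteqP; split => x.
    move=> [i _ Ax] j; have /andP[h1 h2] := Ax j.
    have e0 : 0 < i.+1%:R^-1 :> R by rewrite invr_gt0 ltr0n.
    move: h1 h2 e0; move: (i.+1%:R^-1 : R) => e h1 h2 e0.
    by apply/andP; split; lra.
  move=> xab.
  have gap j : 0 < Num.min (x ord0 j - a j) (b j - x ord0 j).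
    by have /andP[h1 h2] := xab j; rewrite lt_min !subr_gt0 h1.
  (* The sum of the inverse gaps exceeds each of them, so one index serves all coordinates. *)
  pose N := (Num.truncn (\sum_j (Num.min (x ord0 j - a j) (b j - x ord0 j))^-1)).
  exists N => // j; have := gap j; set e := Num.min _ _ => e0.
  have : N.+1%:R^-1 < e.
    rewrite -[ltRHS]invrK ltf_pV2 ?posrE ?invr_gt0 ?ltr0n//.
    apply: le_lt_trans (truncnS_gt _); rewrite (bigD1 j)//= lerDl.
    by apply: sumr_ge0 => l _; rewrite invr_ge0 ltW.
  have : e <= x ord0 j - a j by rewrite ge_min lexx.
  have : e <= b j - x ord0 j by rewrite ge_min lexx orbT.
  move: (N.+1%:R^-1 : R) => e' ? ? ?.
  by apply/andP; split; lra.
apply: nondecreasing_cvg_mu.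
- by move=> i; exact: measurable_obox.
- by apply: bigcupT_measurable => i; exact: measurable_obox.
- move=> i l il; apply/subsetPset => x Ax j; have /andP[h1 h2] := Ax j.
  have : l.+1%:R^-1 <= i.+1%:R^-1 :> R by rewrite lef_pV2 ?posrE ?ltr0n// ler_nat.
  move: h1 h2; move: (l.+1%:R^-1 : R) (i.+1%:R^-1 : R) => e e' h1 h2 ?.
  by apply/andP; split; lra.
Qed.

Lemma indic_obox a b (x : 'rV[R]_n) :
  \1_(obox a b) x = \prod_(j < n) \1_(`]a j, b j[%classic) (x ord0 j) :> R.
Proof.
rewrite indicE; case: (boolP (x \in obox a b)) => [|h].
  rewrite inE => h; rewrite big1// => j _.
  by rewrite indicE mem_set//= in_itv /=; exact: h.
have [j hj] : exists j, ~~ (a j < x ord0 j < b j).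
  apply/existsP; rewrite -negb_forall; apply: contra h => /forallP h.
  by rewrite inE => j; exact: h.
rewrite (bigD1 j)//= indicE memNset ?mul0r//= in_itv /=; exact/negP.
Qed.

End obox_exhaustion.

(** Weierstrass' product inequality. The induction also carries that the partial products lie
    between 0 and 1. *)
Lemma prod_ge1B (R : realFieldType) (I : Type) (r : seq I) (p : I -> R) :
  (forall i, 0 <= p i <= 1) ->
  1 - \sum_(i <- r) (1 - p i) <= \prod_(i <- r) p i.
Proof.
move=> p01; suff : 0 <= \prod_(i <- r) p i <= 1 /\
    1 - \sum_(i <- r) (1 - p i) <= \prod_(i <- r) p i by case.
elim: r => [|i r [/andP[h0 h1] h]]; first by rewrite !big_nil subr0 lexx ler01.
rewrite !big_cons; have /andP[i0 i1] := p01 i; split; last by nra.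
by rewrite mulr_ge0//= mulr_ile1.
Qed.

Section local_time_regularity.
Context {R : realType} {n : nat} {d : measure_display} {T : measurableType d}.
Variables (m : {finite_measure set T -> \bar R}) (X : T -> 'rV[R]_n).
Hypothesis mX : measurable_fun setT X.
Local Notation leb := (lebesgue_rV n).

Variables (D : 'rV[R]_n -> R).
Hypothesis mD : measurable_fun setT D.
Hypothesis MD : forall x xi, `|fourier_cos m X x xi| <= D xi.
Hypothesis intD : (\int[leb]_xi (D xi)%:E < +oo)%E.

Let D0 xi : 0 <= D xi. Proof. exact: le_trans (MD 0 xi). Qed.

Let iD : leb.-integrable setT (EFin \o D).
Proof.
apply/integrableP; split; first exact/measurable_EFinP.
by under eq_integral do rewrite /= ger0_norm//.
Qed.

(** This is [(2 pi) ^ (- n)], the constant of Fourier inversion. *)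
Let C := (normal_peak (1 : R) ^+ n) ^+ 2.
Let C0 : 0 <= C. Proof. exact: sqr_ge0. Qed.

Let s k : R := k.+1%:R^-1.
Let s0 k : 0 < s k. Proof. by rewrite invr_gt0 ltr0n. Qed.

(** Density of the occupation measure convolved with the centered Gaussian of deviation [s k]. *)
Let p k (x : 'rV[R]_n) := normal_peak (s k) ^+ n * heat_potential m X (s k)^-1 x.

Let p_ge0 k x : 0 <= p k x.
Proof. by rewrite mulr_ge0 ?heat_potential_ge0// exprn_ge0// normal_peak_ge0. Qed.

Let w k (xi : 'rV[R]_n) := expR (- (s k ^+ 2 * dotv xi xi) / 2).

Let mw k : measurable_fun setT (w k).
Proof.
apply: measurableT_comp => //; apply: measurable_funM => //.
apply: measurableT_comp => //; apply: measurable_funM => //.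
by apply: measurable_fun_dotv.
Qed.

Let iwM k x : leb.-integrable setT (fun xi => (w k xi * fourier_cos m X x xi)%:E).
Proof.
apply: le_integrable iD => //.
  apply/measurable_EFinP; apply: measurable_funM; first exact: mw.
  exact: measurable_fourier_cos.
move=> xi _ /=; rewrite lee_fin normrM ger0_norm ?expR_ge0// (ger0_norm (D0 xi)).
by apply: le_trans (MD x xi); rewrite ler_piMl// heat_integrand_le1.
Qed.

(** Fourier inversion for the smoothed measure, with damping [w k]. The peaks of deviations [s k]
    and [1 / s k] multiply to a quantity free of [k], whence [C]. *)
Let pE k x : (p k x)%:E = (C%:E * \int[leb]_xi (w k xi * fourier_cos m X x xi)%:E)%E.
Proof.
have k0 : (s k)^-1 != 0 by rewrite invr_eq0 gt_eqF.
rewrite /p EFinM heat_potential_fourier//.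
rewrite -!integralZl//; last exact: integrable_gauss_fourier_cos.
apply: eq_integral => xi _; rewrite -!EFinM; congr (_%:E).
rewrite gauss_rV_expR// /w.
have -> : (s k)^-1 ^- 2 = s k ^+ 2 by rewrite exprVn invrK.
rewrite (normal_peak_scale (s0 k)) (@normal_peak_scale _ (s k)^-1) ?invr_gt0//.
rewrite [(s k)^-1^-1]invrK !exprMn /C exprVn.
have : s k ^+ n != 0 by rewrite expf_neq0 ?gt_eqF.
move: (s k ^+ n) (normal_peak 1 ^+ n) (expR _) (fourier_cos _ _ _ _) => b P E M b0.
by field.
Qed.

Let L x : R := C * \int[leb]_xi fourier_cos m X x xi.

Let B : R := C * \int[leb]_xi D xi.

Let p_le k x : p k x <= B.
Proof.
have : ((p k x)%:E <= B%:E)%E.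
  rewrite pE [B%:E]EFinM lee_wpmul2l ?lee_fin// /Rintegral fineK; last exact: integrable_fin_num.
  apply: (le_trans (lee_abs _)); apply: (le_trans (le_abse_integral leb measurableT _)).
    by apply: measurable_int (iwM k x).
  apply: ge0_le_integral => //.
  - by apply: measurableT_comp => //; apply: measurable_int (iwM k x).
  - exact/measurable_EFinP.
  - move=> xi _ /=; rewrite lee_fin normrM ger0_norm ?expR_ge0//.
    by apply: le_trans (MD x xi); rewrite ler_piMl// heat_integrand_le1.
by rewrite lee_fin.
Qed.

Let s_cvg0 : s @ \oo --> (0 : R).
Proof. exact: cvg_harmonic. Qed.

Let p_cvg x : (fun k => p k x) @ \oo --> L x.
Proof.
have iM : leb.-integrable setT (fun xi => (fourier_cos m X x xi)%:E).
  apply: le_integrable iD => //; first by apply/measurable_EFinP; exact: measurable_fourier_cos.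
  by move=> xi _ /=; rewrite lee_fin (ger0_norm (D0 xi)).
have [_ _ cv] : [/\ leb.-integrable setT (fun xi => (fourier_cos m X x xi)%:E),
    [sequence (\int[leb]_xi `|(w k xi * fourier_cos m X x xi)%:E - (fourier_cos m X x xi)%:E|)%E]_k @ \oo --> 0%E &
    [sequence (\int[leb]_xi (w k xi * fourier_cos m X x xi)%:E)%E]_k @ \oo --> (\int[leb]_xi (fourier_cos m X x xi)%:E)%E].
  apply: (@dominated_convergence _ _ _ leb setT measurableT
    (fun k xi => (w k xi * fourier_cos m X x xi)%:E) _ (EFin \o D)) => //.
  - by move=> k; apply: measurable_int (iwM k x).
  - exact: measurable_int iM.
  - apply: aeW => xi _; apply: cvg_EFin; first exact: nearW.
    rewrite -[X in _ --> X]mul1r; apply: cvgM; last exact: cvg_cst.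
    rewrite -expR0; apply: (@cvg_comp _ _ _ (fun k => - (s k ^+ 2 * dotv xi xi) / 2) expR); last exact: continuous_expR.
    rewrite (_ : nbhs (0 : R) = nbhs (- (0 ^+ 2 * dotv xi xi) / 2)); last by rewrite expr0n /= mul0r oppr0 mul0r.
    apply: cvgM; last exact: cvg_cst.
    apply: cvgN; apply: cvgM; last exact: cvg_cst.
    by apply: (@cvg_comp _ _ _ s (fun y => y ^+ 2)); [exact: s_cvg0|exact: sqr_continuous].
  - apply: aeW => xi k _ /=; rewrite lee_fin normrM ger0_norm ?expR_ge0//.
    by apply: le_trans (MD x xi); rewrite ler_piMl// heat_integrand_le1.
have fin := integrable_fin_num measurableT iM.
have -> : (fun k => p k x) = (fun k => C * \int[leb]_xi (w k xi * fourier_cos m X x xi)).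
  apply/funext => k; apply: EFin_inj.
  by rewrite pE [RHS]EFinM /Rintegral fineK//; apply: integrable_fin_num => //; exact: iwM.
apply: cvgM; first exact: cvg_cst.
by apply: fine_cvg; rewrite fineK.
Qed.

(** Invisible on the inversion formula; it is inherited from the densities [p k], and so is the
    upper bound that follows. *)
Let L_ge0 x : 0 <= L x.
Proof. by apply: (cvgr_to_ge (@p_cvg x)); exact: nearW. Qed.

Let L_le x : L x <= B.
Proof. by apply: (cvgr_to_le (@p_cvg x)); exact: nearW. Qed.

Let q k (x : 'rV[R]_n) (t : T) := \prod_(j < n) normal_pdf (X t ord0 j) (s k) (x ord0 j).

Let q_ge0 k x t : 0 <= q k x t.
Proof. by apply: prodr_ge0 => j _; exact: normal_pdf_ge0. Qed.

Let qE k x t : q k x t = normal_peak (s k) ^+ n *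
  expR (- ((s k)^-1 ^+ 2 * dotv (x - X t) (x - X t)) / 2).
Proof.
rewrite /q; under eq_bigr do rewrite normal_pdfE ?gt_eqF// /normal_fun.
rewrite big_split /= prodr_const card_ord -expR_sum; congr (_ * expR _).
rewrite /dotv mulr_sumr -sumrN mulr_suml; apply: eq_bigr => j _.
have : s k != 0 by rewrite gt_eqF.
by rewrite !mxE -[_ *+ 2]mulr_natr => ?; field.
Qed.

Let pqE k x : (p k x)%:E = (\int[m]_t (q k x t)%:E)%E.
Proof.
rewrite /p EFinM heat_potentialE// -integralZl//; last exact: integrable_heat_potential.
by apply: eq_integral => t _; rewrite qE EFinM.
Qed.

Let mq k : measurable_fun setT (fun z : 'rV[R]_n * T => (q k z.1 z.2)%:E).
Proof.
apply/measurable_EFinP; apply: measurable_prod => j _.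
rewrite (_ : (fun z : 'rV[R]_n * T => _) =
  normal_pdf 0 (s k) \o (fun z : 'rV[R]_n * T => z.1 ord0 j - X z.2 ord0 j)).
  apply: measurableT_comp; first exact: measurable_normal_pdf.
  by apply: measurable_funB; apply: measurable_fun_coord => //; exact: measurableT_comp.
by apply/funext => z /=; rewrite !normal_pdfE ?gt_eqF// normal_fun_center.
Qed.

Let mp k : measurable_fun setT (p k).
Proof.
apply/measurable_EFinP.
rewrite (_ : EFin \o p k = fubini_F m (fun z : 'rV[R]_n * T => (q k z.1 z.2)%:E)).
  by apply: measurable_fun_fubini_tonelli_F => // z; rewrite lee_fin.
by apply/funext => x; rewrite /= pqE.
Qed.

Let mL : measurable_fun setT L.
Proof. by apply: (measurable_fun_cvg mp) => x _; exact: p_cvg. Qed.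

Section obox_estimates.
Variables (a b : 'I_n -> R).
Let I j : set R := [set` `]a j, b j[].
(** Probability that a Gaussian vector of mean [X t] and independent coordinates of deviation [s k]
    falls in the box: a smoothed indicator of the box at [X t]. *)
Let Q k t : R := \prod_(j < n) fine (normal_prob (X t ord0 j) (s k) (I j)).

Let mI j : measurable (I j). Proof. exact: measurable_itv. Qed.

Let Qfin k t j : normal_prob (X t ord0 j) (s k) (I j) \is a fin_num.
Proof. by apply: fin_num_measure; exact: mI. Qed.

Let Qj01 k t j : 0 <= fine (normal_prob (X t ord0 j) (s k) (I j)) <= 1.
Proof.
rewrite fine_ge0//= -lee_fin fineK//.
apply: probability_le1; exact: mI.
Qed.

Let Q_ge0 k t : 0 <= Q k t.
Proof. by apply: prodr_ge0 => j _; have /andP[] := Qj01 k t j. Qed.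

Let Z k (z : T * 'rV[R]_n) : \bar R := (q k z.2 z.1 * \1_(obox a b) z.2)%:E.

Let mZ k : measurable_fun setT (Z k).
Proof.
apply/measurable_EFinP; apply: measurable_funM; last first.
  apply: (@measurableT_comp _ _ _ _ _ _ (\1_(obox a b) : 'rV[R]_n -> R)) => //.
  by apply: measurable_indic; exact: measurable_obox.
apply/measurable_EFinP.
apply: (@measurableT_comp _ _ _ _ _ _ (fun z : 'rV[R]_n * T => (q k z.1 z.2)%:E) _ (fun z => (z.2, z.1))).
  exact: mq.
by apply/measurable_fun_pair.
Qed.

Let Z_ge0 k z : (0 <= Z k z)%E.
Proof. by rewrite lee_fin mulr_ge0. Qed.

Let ZE k t : (\int[leb]_x Z k (t, x) = (Q k t)%:E)%E.
Proof.
transitivity (\int[leb]_x (\prod_(j < n)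
    (normal_pdf (X t ord0 j) (s k) (x ord0 j) * \1_(I j) (x ord0 j)))%:E)%E.
  by apply: eq_integral => x _; rewrite /Z /= indic_obox -big_split.
rewrite (ge0_integral_prod_rV
  (g := fun j r => normal_pdf (X t ord0 j) (s k) r * \1_(I j) r)); last 2 first.
- move=> j; apply: measurable_funM; first exact: measurable_normal_pdf.
  exact: measurable_indic.
- by move=> j r; rewrite mulr_ge0// normal_pdf_ge0.
rewrite -prodEFin; apply: eq_bigr => j _.
rewrite fineK// /normal_prob [RHS]integral_mkcond.
apply: eq_integral => r _; rewrite patchE indicE.
by case: ifPn => _; rewrite ?mulr1 ?mulr0.
Qed.

Let mQ k : measurable_fun setT (fun t => (Q k t)%:E).
Proof.
rewrite (_ : (fun t => _) = fubini_F leb (Z k)).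
  exact: measurable_fun_fubini_tonelli_F.
by apply/funext => t; rewrite /fubini_F ZE.
Qed.

Let integral_p_obox k :
  (\int[leb]_(x in obox a b) (p k x)%:E = \int[m]_t (Q k t)%:E)%E.
Proof.
rewrite integral_mkcond.
transitivity (\int[leb]_x \int[m]_t Z k (t, x))%E.
  apply: eq_integral => x _; rewrite patchE /Z /= indicE.
  case: ifPn => _; last by under eq_integral do rewrite mulr0; rewrite integral0.
  by rewrite pqE; apply: eq_integral => t _; rewrite mulr1.
rewrite -(fubini_tonelli (Z k))//.
by apply: eq_integral => t _; rewrite ZE.
Qed.

Variable del : R.
Hypothesis del0 : 0 < del.
Let eps k : R := (s k / del) ^+ 2.

(** If [X t] lies in the box with margin [del], Chebyshev bounds by [eps k] the probability that a
    given coordinate leaves its interval; the product inequality adds these up over [n]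
    coordinates. *)
Let Q_lower k t : obox (fun j => a j + del) (fun j => b j - del) (X t) ->
  1 <= Q k t + n%:R * eps k.
Proof.
move=> Xt; have h := @prod_ge1B R _ (index_enum 'I_n) _ (Qj01 k t).
have : \sum_(j < n) (1 - fine (normal_prob (X t ord0 j) (s k) (I j))) <= n%:R * eps k.
  rewrite mulr_natl -[X in _ *+ X]card_ord -sumr_const ler_sum// => j _.
  rewrite -lee_fin EFinB fineK// -probability_setC; last exact: mI.
  apply: normal_prob_chebyshev; [by rewrite gt_eqF|exact: del0|by apply: measurableC; exact: mI|].
  move=> x /= /negP; rewrite in_itv /= negb_and -!leNgt => hx.
  have /andP[h1 h2] := Xt j; rewrite ler_normr.
  by case/orP: hx => hx; apply/orP; [right|left]; lra.
by move: h; rewrite -/(Q k t); lra.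
Qed.

(** A single coordinate at distance at least [del] from its interval is enough, the other factors
    being at most 1. *)
Let Q_upper k t : ~ obox (fun j => a j - del) (fun j => b j + del) (X t) ->
  Q k t <= eps k.
Proof.
move=> Xt; have [j hj] : exists j, ~~ (a j - del < X t ord0 j < b j + del).
  apply/existsP; rewrite -negb_forall; apply/negP => /forallP h.
  by apply: Xt => j; exact: h.
apply: (@le_trans _ _ (fine (normal_prob (X t ord0 j) (s k) (I j)))).
  rewrite /Q (bigD1 j)//= ler_piMr//; first by have /andP[] := Qj01 k t j.
  by apply: prodr_ile1 => i _; exact: Qj01.
rewrite -lee_fin fineK//.
apply: normal_prob_chebyshev; [by rewrite gt_eqF|exact: del0|exact: mI|].
move=> x; rewrite /I /= in_itv /= => /andP[ax xb].
rewrite ler_normr; move: hj; rewrite negb_and -!leNgt => /orP[] hj; apply/orP.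
  by left; lra.
by right; lra.
Qed.

Let mass : R := fine (m setT).
Let massE : m setT = mass%:E.
Proof. by rewrite fineK// fin_num_measure. Qed.

Let eps_ge0 k : 0 <= eps k. Proof. exact: sqr_ge0. Qed.

Let mXobox (c e : 'I_n -> R) : measurable (X @^-1` obox c e).
Proof. by rewrite -[X in measurable X]setTI; apply: mX => //; exact: measurable_obox. Qed.

Let intcst (c : R) : (\int[m]_t c%:E = (c * mass)%:E)%E.
Proof. by rewrite integral_cst// EFinM; congr (_ * _)%E; exact: massE. Qed.

Let mindic O : measurable O -> m O = (\int[m]_t (\1_O t)%:E)%E.
Proof. by move=> mO; rewrite integral_indic// setIT. Qed.

Lemma integral_p_lower k :
  (m (X @^-1` obox (fun j => a j + del)%R (fun j => b j - del)%R) <=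
   \int[leb]_(x in obox a b) (p k x)%:E + (n%:R * eps k * mass)%:E)%E.
Proof.
have mO := mXobox (fun j => a j + del) (fun j => b j - del).
rewrite integral_p_obox (mindic mO) -intcst.
rewrite -ge0_integralD//; last 2 first.
- by move=> t _; rewrite lee_fin.
- by move=> t _; rewrite lee_fin mulr_ge0.
apply: ge0_le_integral => //.
- by apply/measurable_EFinP; exact: measurable_indic.
- by apply: emeasurable_funD => //; exact: mQ.
move=> t _; rewrite -EFinD lee_fin indicE; case: (boolP (t \in _)) => [|_].
  by rewrite inE => /Q_lower.
by rewrite addr_ge0// mulr_ge0.
Qed.

Lemma integral_p_upper k :
  (\int[leb]_(x in obox a b) (p k x)%:E <=
   m (X @^-1` obox (fun j => a j - del)%R (fun j => b j + del)%R) + (eps k * mass)%:E)%E.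
Proof.
have mO := mXobox (fun j => a j - del) (fun j => b j + del).
rewrite integral_p_obox (mindic mO) -intcst.
rewrite -ge0_integralD//; last 2 first.
- by apply/measurable_EFinP; exact: measurable_indic.
- by move=> t _; rewrite lee_fin.
apply: ge0_le_integral => //.
- by move=> t _; rewrite lee_fin.
- by apply: emeasurable_funD => //; apply/measurable_EFinP; exact: measurable_indic.
move=> t _; rewrite -EFinD lee_fin indicE; case: (boolP (t \in _)) => [_|].
  apply: (@le_trans _ _ 1); last by rewrite lerDl.
  by apply: prodr_ile1 => i _; exact: Qj01.
by rewrite notin_setE add0r => /Q_upper.
Qed.

Let eps_cvg0 (c : R) : (fun k => (c * eps k * mass)%:E) @ \oo --> 0%E.
Proof.
apply: cvg_EFin; first exact: nearW.
rewrite (_ : nbhs (0 : R) = nbhs (c * (0 / del) ^+ 2 * mass)); last by rewrite mul0r expr0n /= mulr0 mul0r.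
apply: cvgM; last exact: cvg_cst.
apply: cvgM; first exact: cvg_cst.
apply: (@cvg_comp _ _ _ (fun k => s k / del) (fun y => y ^+ 2)); last exact: sqr_continuous.
by apply: cvgM; [exact: s_cvg0|exact: cvg_cst].
Qed.

Let integral_p_cvg :
  (fun k => (\int[leb]_(x in obox a b) (p k x)%:E)%E) @ \oo --> (\int[leb]_(x in obox a b) (L x)%:E)%E.
Proof.
have mO : measurable (obox a b) by exact: measurable_obox.
have lebO : (leb (obox a b) < +oo)%E.
  pose r := \sum_j (`|a j| + `|b j|).
  have r0 : 0 <= r by apply: sumr_ge0 => j _; rewrite addr_ge0.
  apply: (@le_lt_trans _ _ (leb (cubev 0 r))); last by rewrite lebesgue_rV_cubev// ltry.
  apply: le_measure; rewrite ?inE//; first exact: measurable_cubev.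
  move=> x xab j; rewrite mxE subr0; have /andP[h1 h2] := xab j.
  have : `|a j| + `|b j| <= r by rewrite /r (bigD1 j)//= lerDl sumr_ge0// => i _; rewrite addr_ge0.
  have := ler_norm (b j); have := ler_norm (- a j); rewrite normrN => ? ? ?.
  by rewrite ler_norml; apply/andP; split; have := normr_ge0 (a j); have := normr_ge0 (b j); lra.
have [_ _ cv] : [/\ leb.-integrable (obox a b) (EFin \o L),
    [sequence (\int[leb]_(x in obox a b) `|(p k x)%:E - (L x)%:E|)%E]_k @ \oo --> 0%E &
    [sequence (\int[leb]_(x in obox a b) (p k x)%:E)%E]_k @ \oo --> (\int[leb]_(x in obox a b) (L x)%:E)%E].
  apply: (@dominated_convergence _ _ _ leb (obox a b) mO
    (fun k x => (p k x)%:E) (EFin \o L) (cst B%:E)) => //.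
  - by move=> k; apply/measurable_funTS/measurable_EFinP; exact: mp.
  - by apply/measurable_funTS/measurable_EFinP; exact: mL.
  - by apply: aeW => x _; apply: cvg_EFin; [exact: nearW|exact: p_cvg].
  - apply/integrableP; split => //.
    by rewrite integral_cst//= lte_mul_pinfty.
  - by apply: aeW => x k _ /=; rewrite lee_fin ger0_norm.
exact: cv.
Qed.

(** Let [k] tend to infinity with [del] fixed: the Chebyshev errors vanish and the masses of [p k]
    converge by bounded convergence on the box. The margins are needed since the image measure might
    a priori charge the boundary of a box. *)
Lemma local_time_obox_bounds :
  (m (X @^-1` obox (fun j => a j + del)%R (fun j => b j - del)%R) <=
     \int[leb]_(x in obox a b) (L x)%:E <=
   m (X @^-1` obox (fun j => a j - del)%R (fun j => b j + del)%R))%E.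
Proof.
apply/andP; split.
  have h : (fun k => \int[leb]_(x in obox a b) (p k x)%:E + (n%:R * eps k * mass)%:E)%E @ \oo -->
      (\int[leb]_(x in obox a b) (L x)%:E + 0)%E.
    by apply: cvgeD; [rewrite fin_num_adde_defl|exact: integral_p_cvg|exact: eps_cvg0].
  rewrite adde0 in h; apply: (cvge_to_ge h); apply: nearW => k.
  exact: integral_p_lower.
apply: (lee_cvg_to integral_p_cvg).
  rewrite -[X in _ --> X]adde0; apply: cvgeD; [by rewrite fin_num_adde_defl|exact: cvg_cst|exact: (eps_cvg0 1)].
by apply: nearW => k; rewrite mul1r; exact: integral_p_upper.
Qed.

End obox_estimates.

Variable rho : R.
Hypothesis Xrho : forall t j, `|X t ord0 j| <= rho.

Let continuous_fourier_cos (xi : 'rV[R]_n) : continuous (fun x => fourier_cos m X x xi).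
Proof.
apply: (@continuous_integral _ 'rV[R]_n _ _ m
  (fun x t => cos (dotv xi (x - X t))) (cst 1%E)).
- move=> x; apply: measurableT_comp.
    exact: continuous_measurable_fun (@continuous_cos R).
  by apply: measurable_fun_dotv => //; exact: measurable_fun_subv.
- move=> t.
  have h : continuous (fun x : 'rV[R]_n => \sum_(j < n) xi ord0 j * (x - X t) ord0 j).
    apply: continuous_big => [|i _ x]; first exact: add_continuous.
    have c : continuous_at x (fun x : 'rV[R]_n => (x - X t) ord0 i).
      rewrite (_ : (fun x : 'rV[R]_n => _) = (fun x : 'rV[R]_n => x ord0 i - X t ord0 i)); last first.
        by apply/funext => z; rewrite !mxE.
      by apply: continuousB; [exact: coord_continuous|exact: cst_continuous].
    by apply: continuousM => //; exact: cst_continuous.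
  move=> x; apply: (@continuous_comp _ _ _ (fun x : 'rV[R]_n => dotv xi (x - X t)) (@cos R)).
    exact: h.
  exact: continuous_cos.
- by move=> x t; rewrite lee_fin cos_max.
- exact: finite_measure_integrable_cst.
Qed.

Let continuous_L : continuous L.
Proof.
move=> x; apply: (@continuousM _ _ (fun=> C) (fun x => \int[leb]_xi fourier_cos m X x xi)).
  exact: cst_continuous.
apply: (@continuous_integral _ 'rV[R]_n _ _ leb (fourier_cos m X) (EFin \o D)) => //.
by move=> y; exact: measurable_fourier_cos.
Qed.

(** At distance more than 1 from the range of [X] the smoothed densities tend to 0, the Gaussian
    factor beating the normalisation [(k + 1) ^ n]. *)
Let L_eq0 x : ~ cubev 0 (rho + 1) x -> L x = 0.
Proof.
move=> nx; apply/eqP; rewrite eq_le L_ge0 andbT.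
(* The exponent [n + 1] beats the normalisation with one factor [s k] to spare, which provides the
   decay. *)
have [K K0 hK] := @powR_le_expR R n.+1%:R (ltr0Sn _ _).
pose mass := fine (m setT).
have mass0 : 0 <= mass by rewrite fine_ge0.
pose P := normal_peak (1 : R) ^+ n.
have P0 : 0 <= P by rewrite exprn_ge0// normal_peak_ge0.
have bound k : p k x <= P * mass * K * s k.
  have k1 : 1 <= k.+1%:R :> R by rewrite ler1n.
  have kpos : 0 < k.+1%:R :> R by rewrite ltr0n.
  have hp : heat_potential m X (s k)^-1 x <= expR (- (k.+1%:R / 2)) * mass.
    rewrite -lee_fin heat_potentialE//.
    apply: (@le_trans _ _ (\int[m]_t (cst (expR (- (k.+1%:R / 2)))%:E t))%E).
      apply: ge0_le_integral => //.
      - by apply/measurable_EFinP; exact: measurable_heat_potential_integrand.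
      - move=> t _; rewrite lee_fin ler_expR mulNr lerN2 invrK ler_pM2r ?invr_gt0//.
        have z1 := enorm_sub_gt Xrho t nx; rewrite -sqr_enorm.
        have : 1 <= enorm (x - X t) ^+ 2 by rewrite expr_ge1 ?enorm_ge0// ltW.
        move: (enorm (x - X t) ^+ 2) (k.+1%:R : R) k1 => u v v1 u1.
        have v0 : 0 <= v by apply: le_trans v1.
        rewrite expr2 -mulrA -[leLHS]mulr1 ler_wpM2l//.
        by rewrite (le_trans v1)// ler_peMr.
    by rewrite integral_cst// [leRHS]EFinM [in leRHS]/mass fineK ?fin_num_measure.
  rewrite /p (normal_peak_scale (s0 k)) exprMn -/P.
  apply: (@le_trans _ _ ((s k)^-1 ^+ n * P * (expR (- (k.+1%:R / 2)) * mass))).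
    by rewrite ler_wpM2l// mulr_ge0// exprn_ge0// invr_ge0 ltW.
  rewrite [(s k)^-1]invrK.
  have hk : k.+1%:R ^+ n * k.+1%:R <= K * expR (k.+1%:R / 2).
    by rewrite -exprSr -powR_mulrn ?(ltW kpos)//; exact: hK.
  have e0 := expR_gt0 (k.+1%:R / 2 : R).
  have : k.+1%:R ^+ n * expR (- (k.+1%:R / 2)) <= K * s k.
    by rewrite expRN /s ler_pdivrMr// mulrAC ler_pdivlMr.
  move=> /(ler_wpM2l (mulr_ge0 P0 mass0)); rewrite [P * mass * (K * _)]mulrA.
  by apply: le_trans; rewrite le_eqVlt; apply/orP; left; apply/eqP; ring.
apply: (ler_cvg_to (@p_cvg x) (g := fun k => P * mass * K * s k)).
  by rewrite -(mulr0 (P * mass * K)); apply: cvgM; [exact: cvg_cst|exact: s_cvg0].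
exact: nearW.
Qed.

Lemma local_time_regular : exists L : 'rV[R]_n -> R,
  [/\ density (pushforward m X) leb L, C_infty n L & [bounded L x | x in setT]].
Proof.
exists L; split.
- split => // A mA.
  pose nu : {measure set 'rV[R]_n -> \bar R} := density_measure leb mL L_ge0.
  pose muX : {measure set 'rV[R]_n -> \bar R} :=
    measure_function_pushforward__canonical__measure_function_Measure m mX.
  apply: (@measure_unique_obox _ _ muX nu) => //; last first.
    by rewrite /= /pushforward preimage_setT ltey_eq fin_num_measure.
  move=> a b; apply/eqP; rewrite eq_le; apply/andP; split.
    have h := @obox_exhaustion _ _ a b muX.
    apply: (cvge_to_le h); apply: nearW => i.
    by have /andP[] := @local_time_obox_bounds a b i.+1%:R^-1 (s0 i).
  (* The upper estimate is applied to the shrunken boxes, with a margin equal to the shrinking, so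
     that the enlarged box is the original one. *)
  have h := @obox_exhaustion _ _ a b nu.
  apply: (cvge_to_le h); apply: nearW => i.
  have /andP[_] := @local_time_obox_bounds (fun j => a j + i.+1%:R^-1)
    (fun j => b j - i.+1%:R^-1) i.+1%:R^-1 (s0 i).
  have -> : (fun j => a j + i.+1%:R^-1 - i.+1%:R^-1) = a by apply/funext => j; rewrite addrK.
  by have -> : (fun j => b j - i.+1%:R^-1 + i.+1%:R^-1) = b by apply/funext => j; rewrite subrK.
- split; first exact: continuous_L.
  move=> e e0; exists (cubev 0 (rho + 1)); first exact: compact_cubev.
  by move=> x /L_eq0 ->; rewrite normr0.
- exists B; split; first exact: num_real.
  move=> M /ltW BM x _ /=; apply: le_trans BM.
  by rewrite ger0_norm.
Qed.

End local_time_regularity.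

(** * Gaussian laws *)

Section density_change_of_variables.
Import HBNNSimple.
Local Open Scope ereal_scope.

(** True on indicators by the hypothesis on [nu], hence on simple functions, and in general by
    monotone convergence. *)
Lemma ge0_integral_density d (T : measurableType d) (R : realType)
    (mu nu : {measure set T -> \bar R}) (f : T -> R) (h : T -> \bar R) :
  measurable_fun setT f -> (forall x, 0 <= f x)%R ->
  (forall A, measurable A -> nu A = \int[mu]_(x in A) (f x)%:E) ->
  measurable_fun setT h -> (forall x, 0 <= h x) ->
  \int[nu]_x h x = \int[mu]_x (h x * (f x)%:E).
Proof.
move=> mf f0 nuE mh h0; pose g := nnsfun_approx measurableT mh.
have mfE : measurable_fun setT (EFin \o f) by exact/measurable_EFinP.
have hE x : h x = lim ((EFin \o g n) x @[n --> \oo]).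
  by apply/esym/cvg_lim => //; exact: cvg_nnsfun_approx.
transitivity (lim (\int[nu]_x (EFin \o g n) x @[n --> \oo])).
  under eq_integral do rewrite hE.
  apply: monotone_convergence => //.
  - by move=> n; apply/measurable_EFinP; exact: measurable_funP.
  - by move=> n x _; rewrite lee_fin.
  - by move=> x _ a b ab; rewrite lee_fin; exact/lefP/nd_nnsfun_approx.
transitivity (lim (\int[mu]_x ((g n x)%:E * (f x)%:E) @[n --> \oo])); last first.
  rewrite -monotone_convergence//.
  - apply: eq_integral => x _; apply/cvg_lim => //; apply: cvgeZr => //.
    exact: cvg_nnsfun_approx.
  - by move=> n; apply: emeasurable_funM => //; apply/measurable_EFinP; exact: measurable_funP.
  - by move=> n x _; rewrite mule_ge0 ?lee_fin.
  - by move=> x _ a b ab; rewrite lee_wpmul2r ?lee_fin//; exact/lefP/nd_nnsfun_approx.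
congr (lim (_ @ \oo)); apply/funext => n.
have mgr r : measurable (g n @^-1` [set r]) by exact: measurable_sfunP.
have mind r : measurable_fun setT (fun x => (r * \1_(g n @^-1` [set r]) x)%:E).
  by apply/measurable_EFinP; exact: measurable_funM.
transitivity (\int[nu]_x (\sum_(r \in range (g n)) (r * \1_(g n @^-1` [set r]) x)%:E)).
  by apply: eq_integral => t _; rewrite /= fimfunE -fsumEFin.
rewrite ge0_integral_fsum//; last by move=> r x _; exact: nnfun_muleindic_ge0.
transitivity (\int[mu]_x (\sum_(r \in range (g n))
    (r * \1_(g n @^-1` [set r]) x)%:E * (f x)%:E)); last first.
  apply: eq_integral => x _; rewrite -ge0_mule_fsuml => [|r]; last exact: nnfun_muleindic_ge0.
  by rewrite fsumEFin // -(fimfunE _ x).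
rewrite ge0_integral_fsum//; last 2 first.
- by move=> r; exact: emeasurable_funM.
- by move=> r x _; apply: mule_ge0; [exact: nnfun_muleindic_ge0|rewrite lee_fin].
apply: eq_fsbigr => r; rewrite inE => -[y _ yr].
have r0 : (0 <= r)%R by rewrite -yr.
under eq_integral do rewrite EFinM.
rewrite ge0_integralZl ?lee_fin//; last by apply/measurable_EFinP; exact: measurable_indic.
rewrite integral_indic// setIT nuE// integral_mkcond.
rewrite -ge0_integralZl ?lee_fin//; last 2 first.
- by apply/(measurable_restrictT _ _).1 => //; exact: measurable_funTS.
- by move=> x _; rewrite patchE; case: ifP => // _; rewrite lee_fin.
apply: eq_integral => x _; rewrite EFinM -muleA patchE indicE.
by case: ifPn => _; rewrite ?mul1e ?mul0e.
Qed.

End density_change_of_variables.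

Section gaussian_laws.
Context {R : realType} {d : measure_display} {Omega : measurableType d}.
Variable P : probability Omega R.
Local Notation mu := (@lebesgue_measure R).

Lemma integral_sqrD_normal_pdf (m s c : R) : s != 0 ->
  (\int[mu]_x (((x + c) ^+ 2)%:E * (normal_pdf m s x)%:E) = (s ^+ 2 + (m + c) ^+ 2)%:E)%E.
Proof.
move=> s0; pose phi := normal_pdf m s.
have iphi : mu.-integrable setT (fun x => (phi x)%:E) by exact: integrable_normal_pdf.
have i1 : mu.-integrable setT (fun x => ((x - m) * phi x)%:E).
  apply: (@integrable_quadratic_normal_pdf _ m s s0 (fun x => x - m) 1).
    exact: measurable_funB.
  move=> x; rewrite mul1r -(real_normK (num_real (x - m))).
  by have := sqr_ge0 (`|x - m| - 1); nra.
have i2 : mu.-integrable setT (fun x => ((x - m) ^+ 2 * phi x)%:E).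
  apply: (@integrable_quadratic_normal_pdf _ m s s0 (fun x => (x - m) ^+ 2) 1).
    by apply: measurable_funX; exact: measurable_funB.
  by move=> x; rewrite ger0_norm ?sqr_ge0// mul1r lerDr.
have E x : (((x + c) ^+ 2)%:E * (phi x)%:E = ((x - m) ^+ 2 * phi x)%:E +
    ((2 * (m + c))%:E * ((x - m) * phi x)%:E + ((m + c) ^+ 2)%:E * (phi x)%:E))%E.
  by rewrite -!EFinM -!EFinD; congr (_%:E); ring.
under eq_integral do rewrite E.
rewrite integralD//; last first.
  by apply: integrableD => //; exact: integrableZl.
rewrite integralD//; [|exact: integrableZl|exact: integrableZl].
rewrite !integralZl// integral_sqr_center_normal_pdf// integral_center_normal_pdf//.
by rewrite integral_normal_pdf mule0 mule1 add0e EFinD.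
Qed.

(** The shift [c] is kept so that two of its values can determine both [m] and [s]. The formula also
    covers the degenerate law. *)
Lemma gaussian_rv_second_moment (Y : Omega -> R) (m s : R) :
  measurable_fun setT Y -> 0 <= s ->
  (forall A : set R, measurable A ->
    P (Y @^-1` A) = if s == 0 then \d_m A else normal_prob m s A) ->
  forall c, (\int[P]_w ((Y w + c) ^+ 2)%:E = (s ^+ 2 + (m + c) ^+ 2)%:E)%E.
Proof.
move=> mY s0 law c.
have mh : measurable_fun setT (fun x : R => ((x + c) ^+ 2)%:E).
  by apply/measurable_EFinP; apply: measurable_funX; exact: measurable_funD.
have h0 x : (0 <= ((x + c) ^+ 2)%:E)%E by rewrite lee_fin sqr_ge0.
have [s00|sn0] := eqVneq s 0.
  have -> : (\int[P]_w ((Y w + c) ^+ 2)%:E = \int[pushforward P Y]_x ((x + c) ^+ 2)%:E)%E.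
    by rewrite (@ge0_integral_pushforward _ _ _ _ R Y mY P setT)// preimage_setT.
  rewrite (eq_measure_integral (\d_m : {measure set R -> \bar R})).
    by rewrite integral_dirac// diracT mul1e s00 expr0n add0r.
  by move=> A mA _; rewrite /= /pushforward law// s00 eqxx.
have mY1 : measurable_fun setT (Y : Omega -> measurableTypeR R) := mY.
pose nu := measure_function_pushforward__canonical__measure_function_Measure P mY1.
have nuE A : measurable A -> nu A = (\int[mu]_(x in A) (normal_pdf m s x)%:E)%E.
  by move=> mA; rewrite /nu /= /pushforward law// (negbTE sn0).
have K := @ge0_integral_density _ (measurableTypeR R) R mu nu (normal_pdf m s)
  (fun x : R => ((x + c) ^+ 2)%:E) (@measurable_normal_pdf R m s) (@normal_pdf_ge0 R m s) nuE
  (mh : measurable_fun [set: measurableTypeR R] _) h0.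
rewrite -integral_sqrD_normal_pdf// -K; apply/esym.
have := @ge0_integral_pushforward _ _ _ (measurableTypeR R) R Y mY1 P setT
  (fun x : R => ((x + c) ^+ 2)%:E) measurableT mh (fun x _ => h0 x).
by rewrite preimage_setT.
Qed.

(** The expectation is the difference of the integrals of the positive and negative parts, and an
    extended real difference involving an infinite term, including [+oo - +oo = -oo], is never 0. *)
Lemma integrable_of_expectation0 (Y : Omega -> R) :
  measurable_fun setT Y -> ('E_P[Y] = 0)%E -> P.-integrable setT (EFin \o Y).
Proof.
move=> mY; rewrite unlock integralE => h.
have mE : measurable_fun setT (EFin \o Y) by exact/measurable_EFinP.
apply/integrableP; split => //.
have p0 : (0 <= \int[P]_w (EFin \o Y)^\+ w)%E by exact: integral_ge0.
have n0 : (0 <= \int[P]_w (EFin \o Y)^\- w)%E by exact: integral_ge0.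
have -> : (\int[P]_w `|(EFin \o Y) w| =
    \int[P]_w (EFin \o Y)^\+ w + \int[P]_w (EFin \o Y)^\- w)%E.
  rewrite -ge0_integralD//; [|exact: measurable_funepos|exact: measurable_funeneg].
  by apply: eq_integral => w _; rewrite -/((abse \o (EFin \o Y)) w) fune_abse.
move: h p0 n0; rewrite (_ : (\int[P]_w (EFin \o Y)^\+ w)%E = (\int[P]_x (fun w => (Y w)%:E)^\+ x)%E)//.
case: (\int[P]_x (fun w => (Y w)%:E)^\+ x)%E => [x| |]//;
  rewrite (_ : (\int[P]_w (EFin \o Y)^\- w)%E = (\int[P]_x (fun w => (Y w)%:E)^\- x)%E)//;
  case: (\int[P]_x (fun w => (Y w)%:E)^\- x)%E => [y| |]// _ _ _.
by rewrite -EFinD ltry.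
Qed.

(** The shifts 0 and 1 give [s ^ 2 + m ^ 2 = v] and [s ^ 2 + (m + 1) ^ 2 = v + 1], whence [m = 0]
    and [s ^ 2 = v]; positivity of [v] rules out the Dirac law. *)
Lemma centered_gaussian_law (Y : Omega -> R) (v : R) :
  gaussian_rv P Y -> P.-integrable setT (EFin \o Y) -> (\int[P]_w (Y w)%:E = 0)%E ->
  (\int[P]_w (Y w ^+ 2)%:E = v%:E)%E -> 0 < v ->
  forall A : set R, measurable A -> P (Y @^-1` A) = normal_prob 0 (Num.sqrt v) A.
Proof.
move=> [mY [m [s [s0 law]]]] iY EY EY2 v0.
have M := gaussian_rv_second_moment mY s0 law.
have M0 : s ^+ 2 + m ^+ 2 = v.
  have := M 0; under eq_integral do rewrite addr0.
  by rewrite EY2 addr0 => -[].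
have M1 : s ^+ 2 + (m + 1) ^+ 2 = v + 1.
  have mY2 : measurable_fun setT (fun w => (Y w ^+ 2)%:E).
    by apply/measurable_EFinP; exact: measurable_funX.
  have iY2 : P.-integrable setT (fun w => (Y w ^+ 2)%:E).
    apply/integrableP; split => //.
    by under eq_integral do rewrite gee0_abs ?lee_fin ?sqr_ge0//; rewrite EY2 ltry.
  have i1 : P.-integrable setT (fun=> 1%E) by exact: finite_measure_integrable_cst.
  have := M 1.
  have E w : (((Y w + 1) ^+ 2)%:E = (Y w ^+ 2)%:E + (2%:E * (Y w)%:E + 1))%E.
    by rewrite -EFinM -!EFinD; congr (_%:E); ring.
  under eq_integral do rewrite E.
  rewrite integralD//; last by apply: integrableD => //; exact: integrableZl.
  rewrite integralD//; last exact: integrableZl.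
  rewrite integralZl// EY mule0 add0e EY2 integral_cst//= mul1e probability_setT -EFinD.
  by move=> -[->].
have m0 : m = 0 by nra.
have sv : s = Num.sqrt v by rewrite -M0 m0 expr0n addr0 sqrtr_sqr ger0_norm.
move=> A mA; rewrite law// -sv m0; case: eqP => // s00.
by move: v0; rewrite -M0 m0 s00 !expr0n addr0 ltxx.
Qed.

End gaussian_laws.

Lemma within_continuous_coord {R : realType} (k n : nat) (D : set 'rV[R]_k)
    (X : 'rV[R]_k -> 'rV[R]_n) j :
  {within D, continuous X} -> {within D, continuous (fun t => X t ord0 j)}.
Proof.
move=> cX; apply/subspace_continuousP => t Dt.
have /subspace_continuousP/(_ t Dt) h := cX.
exact: (cvg_comp _ _ h (@coord_continuous R 1 n ord0 j (X t))).
Qed.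

(** * Occupation of the unit cube *)

Section clipping.
Context {R : realType} {k : nat}.
Implicit Types t : 'rV[R]_k.

(* [X \o clip] is total and only evaluates [X] on the unit cube. *)
Definition clip t : 'rV[R]_k := \row_i Num.min 1 (Num.max 0 (t ord0 i)).

Lemma clip_unit_cube t : unit_cube k (clip t).
Proof.
move=> i; rewrite mxE le_min ler01 le_max lexx /=.
by rewrite ge_min lexx.
Qed.

Lemma unit_cube_orthant t : unit_cube k t -> orthant k t.
Proof. by move=> h i; have /andP[] := h i. Qed.

Lemma clip_id t : unit_cube k t -> clip t = t.
Proof.
move=> h; apply/rowP => i; rewrite mxE; have /andP[t0 t1] := h i.
by rewrite max_r// min_r.
Qed.

Lemma measurable_clip_coord i : measurable_fun setT (fun t => clip t ord0 i).
Proof.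
under eq_fun do rewrite mxE.
apply: measurable_minr => //; apply: measurable_maxr => //; exact: measurable_coord.
Qed.

(** Rounding down stays in the orthant, the only place where the field is known to be measurable,
    and takes finitely many values. *)
Definition grid N t : 'rV[R]_k :=
  \row_i ((Num.truncn (N.+1%:R * clip t ord0 i))%:R / N.+1%:R).

Lemma grid_orthant N t : orthant k (grid N t).
Proof. by move=> i; rewrite mxE divr_ge0. Qed.

Lemma grid_cvg t : grid ^~ t @ \oo --> clip t.
Proof.
apply/cvg_ballP => e e0; near=> N; split => // i j; rewrite (ord1 i) /ball /= !mxE.
have N0 : 0 < N.+1%:R :> R by rewrite ltr0n.
set c := Num.min _ _.
have c0 : 0 <= c by have := clip_unit_cube t j; rewrite mxE => /andP[].
have Nc : 0 <= N.+1%:R * c by rewrite mulr_ge0// ltW.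
have /andP[h1 h2] := truncn_itv Nc.
rewrite ger0_norm; last by rewrite subr_ge0 ler_pdivrMr// [c * _]mulrC.
apply: (@le_lt_trans _ _ N.+1%:R^-1).
  rewrite lerBlDr -[X in _ <= X + _]mul1r -mulrDl ler_pdivlMr// [c * _]mulrC.
  by rewrite addrC natr1 ltW.
rewrite -[ltRHS]invrK ltf_pV2 ?posrE ?invr_gt0//.
apply: (lt_le_trans (truncnS_gt e^-1)).
by rewrite ler_nat ltnS; near: N; exact: nbhs_infty_ge.
Unshelve. all: by end_near. Qed.

(* A function that is measurable in [w] and continuous in [t] is jointly
   measurable, as the limit of its versions discretised on the grids. *)
Lemma measurable_clipped_path d (Omega : measurableType d) (Y : 'rV[R]_k -> Omega -> R) :
  (forall t, orthant k t -> measurable_fun setT (Y t)) ->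
  (forall w, {within orthant k, continuous (Y ^~ w)}) ->
  measurable_fun setT (fun p : 'rV[R]_k * Omega => Y (clip p.1) p.2).
Proof.
move=> mY cY; apply: (@measurable_fun_cvg _ _ _ _ (fun N p => Y (grid N p.1) p.2)); last first.
  move=> [t w] _ /=.
  have : Y ^~ w @ within (orthant k) (nbhs (clip t)) --> Y (clip t) w.
    have /subspace_continuousP := cY w; apply.
    exact/unit_cube_orthant/clip_unit_cube.
  move=> h; apply: (@cvg_comp _ _ _ (grid ^~ t) (Y ^~ w) _ _ _ _ h).
  move=> A /= wA; have h2 : nbhs \oo (fun N => orthant k (grid N t) -> A (grid N t)).
    exact: (@grid_cvg t _ wA).
  by apply: filterS h2 => N; apply; exact: grid_orthant.
move=> N _ A mA; rewrite setTI.
(* Cells on which the discretised point is constant; they are indexed by integer vectors, hence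
   countably many. *)
pose S (z : 'rV[nat]_k) : set 'rV[R]_k :=
  [set t | forall i, Num.truncn (N.+1%:R * clip t ord0 i) = z ord0 i].
have mS z : measurable (S z).
  have -> : S z = \bigcap_(i in [set: 'I_k]) (fun t => N.+1%:R * clip t ord0 i) @^-1`
      [set` `[(z ord0 i)%:R, (z ord0 i).+1%:R[].
    have c0 t i : 0 <= N.+1%:R * clip t ord0 i.
      by rewrite mulr_ge0//; have /andP[] := clip_unit_cube t i.
    apply/seteqP; split => t /= h i.
      by move=> _; rewrite /= in_itv /= -(h i); exact: truncn_itv.
    by have := h i Logic.I; rewrite /= in_itv /= -truncn_eq// => /eqP.
  apply: fin_bigcap_measurable => // i _; rewrite -[X in measurable X]setTI.
  by apply: measurable_funM => //; exact: measurable_clip_coord.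
pose pt (z : 'rV[nat]_k) : 'rV[R]_k := \row_i ((z ord0 i)%:R / N.+1%:R).
have -> : (fun p : 'rV[R]_k * Omega => Y (grid N p.1) p.2) @^-1` A =
    \bigcup_j (if unpickle j is Some z then S z `*` (Y (pt z) @^-1` A) else set0).
  apply/seteqP; split => [[t w]|[t w] [j _]] /=.
    pose z : 'rV[nat]_k := \row_i Num.truncn (N.+1%:R * clip t ord0 i).
    have -> : grid N t = pt z by apply/rowP => i; rewrite !mxE.
    move=> YA; exists (pickle z) => //; rewrite pickleK; split => //= i.
    by rewrite !mxE.
  case: unpickle => // z [/= Sz]; have -> // : pt z = grid N t.
  by apply/rowP => i; rewrite !mxE -Sz mxE.
apply: bigcupT_measurable => j; case: unpickle => // z; apply: measurableX => //.
rewrite -[X in measurable X]setTI; apply: mY => // i.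
by rewrite mxE divr_ge0.
Qed.

Lemma compact_unit_cube : compact (unit_cube k : set 'rV[R]_k).
Proof.
have E : unit_cube k = [set v : 'rV[R]_k | forall i, `[0, 1]%classic (v ord0 i)].
  by apply/seteqP; split => x /= h i; have := h i; rewrite in_itv.
rewrite E; exact: (@rV_compact R k (fun=> `[0, 1]%classic) (fun=> @segment_compact R 0 1)).
Qed.

Lemma bounded_clipped_path n (X : 'rV[R]_k -> 'rV[R]_n) :
  {within orthant k, continuous X} ->
  exists rho : R, forall t j, `|X (clip t) ord0 j| <= rho.
Proof.
move=> cX.
have /choice[r hr] : forall j, exists r : R, 0 <= r /\ forall t, `|X (clip t) ord0 j| <= r.
  move=> j; have cXj : {within unit_cube k, continuous (fun t => X t ord0 j)}.
    exact: (continuous_subspaceW unit_cube_orthant (within_continuous_coord cX)).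
  have /compact_bounded := continuous_compact cXj compact_unit_cube.
  move=> [M [_ hM]]; exists (`|M| + 1); split => // t.
  apply: (hM (`|M| + 1)); first by rewrite (le_lt_trans (ler_norm M))// ltrDl.
  by exists (clip t) => //; exact: clip_unit_cube.
exists (\sum_j r j) => t j; apply: le_trans ((hr j).2 t) _.
by rewrite (bigD1 j)//= lerDl sumr_ge0// => i _; have [] := hr i.
Qed.

Lemma measurable_unit_cube : measurable (unit_cube k : set 'rV[R]_k).
Proof.
have -> : (unit_cube k : set 'rV[R]_k) = \bigcap_(i in [set: 'I_k])
    (fun x : 'rV[R]_k => x ord0 i) @^-1` [set` `[0, 1]].
  apply/seteqP; split => x /= h i; [move=> _|]; have := h i.
    by rewrite /= in_itv.
  by move=> /(_ Logic.I); rewrite /= in_itv.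
apply: fin_bigcap_measurable => // i _.
by rewrite -[X in measurable X]setTI; apply: measurable_coord.
Qed.

Lemma lebesgue_unit_cube : lebesgue_rV k (unit_cube k : set 'rV[R]_k) = 1%E.
Proof.
have -> : (unit_cube k : set 'rV[R]_k) = [set v | forall i, `[0, 1]%classic (v ord0 i)].
  by apply/seteqP; split => x /= h i; have := h i; rewrite in_itv.
rewrite (lebesgue_rV_box (A := fun=> `[0, 1]%classic))//.
by rewrite big1// => i _; rewrite lebesgue_measure_itv /= lte_fin ltr01 oppr0 adde0.
Qed.

Lemma lebesgue_unit_cube_lty : (lebesgue_rV k (unit_cube k : set 'rV[R]_k) < +oo)%E.
Proof. by rewrite lebesgue_unit_cube ltry. Qed.

Definition cube_measure : {finite_measure set 'rV[R]_k -> \bar R} :=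
  mfrestr measurable_unit_cube lebesgue_unit_cube_lty.

Lemma cube_measureT : cube_measure setT = 1%E.
Proof. by rewrite /= /mfrestr /mrestr setTI lebesgue_unit_cube. Qed.

(** This presents the occupation measure as the image of a probability under a map on the whole
    space, the setting of the two regularity results. *)
Lemma occupation_measureE n (X : 'rV[R]_k -> 'rV[R]_n) :
  occupation_measure X = pushforward cube_measure (X \o clip).
Proof.
apply/funext => A; rewrite /occupation_measure /pushforward /= /mfrestr /mrestr setIC.
congr (lebesgue_rV k _); apply/seteqP; split => t /= [h1 h2]; split => //.
  by rewrite clip_id.
by move: h1; rewrite clip_id.
Qed.

Lemma ge0_integral_cube_measure (f : 'rV[R]_k -> \bar R) :
  measurable_fun setT f -> (forall t, 0 <= f t)%E ->
  (\int[cube_measure]_t f t = \int[lebesgue_rV k]_(t in unit_cube k) f t)%E.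
Proof.
move=> mf f0.
rewrite [RHS]integral_mkcond.
rewrite (@ge0_integral_density _ _ _ (lebesgue_rV k) cube_measure (\1_(unit_cube k))) //.
- apply: eq_integral => t _; rewrite patchE indicE.
  by case: ifPn => _; rewrite ?mule1 ?mule0.
- by apply: measurable_indic; exact: measurable_unit_cube.
- move=> A mA; rewrite /= /mfrestr /mrestr integral_indic//; last exact: measurable_unit_cube.
  by rewrite setIC.
Qed.

End clipping.

(** * Increments of fractional Brownian fields *)

Section increments.
Context {R : realType} {d : measure_display} {Omega : measurableType d}.
Variable P : probability Omega R.
Variables (k : nat) (H : R).
Hypothesis H0 : 0 < H.

Section component.
Variable b : 'rV[R]_k -> Omega -> R.
Hypothesis hb : fractional_brownian_field1 P H b.

Lemma fbf1_gaussian_rv t : orthant k t -> gaussian_rv P (b t).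
Proof.
move=> ot; have := @fbf1_gaussian _ _ _ _ _ _ _ hb 1 (fun=> t) (fun=> 1) (fun=> ot).
rewrite (_ : (fun w => _) = b t)//.
by apply/funext => w; rewrite big_ord1 mul1r.
Qed.

Lemma fbf1_measurable t : orthant k t -> measurable_fun setT (b t).
Proof. by move=> /fbf1_gaussian_rv[]. Qed.

Lemma fbf1_increment_gaussian s t : orthant k s -> orthant k t ->
  gaussian_rv P (fun w => b t w - b s w).
Proof.
move=> os ot.
have := @fbf1_gaussian _ _ _ _ _ _ _ hb 2 (fun j => if j == ord0 then t else s)
  (fun j => if j == ord0 then 1 else -1).
rewrite (_ : (fun w => _) = (fun w => b t w - b s w)); last first.
  by apply/funext => w; rewrite big_ord_recl big_ord1 /= mul1r mulN1r.
by apply=> j; case: ifP.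
Qed.

Lemma fbf1_integrable t : orthant k t -> P.-integrable setT (EFin \o b t).
Proof.
move=> ot; apply: integrable_of_expectation0; first exact: fbf1_measurable.
exact: (fbf1_centered hb).
Qed.

Lemma fbf1_increment_law s t : orthant k s -> orthant k t -> t != s ->
  forall A : set R, measurable A ->
  P ((fun w => b t w - b s w) @^-1` A) = normal_prob 0 (enorm (t - s) `^ H) A.
Proof.
move=> os ot ts.
have e0 : 0 < enorm (t - s) by rewrite lt_neqAle enorm_ge0 eq_sym enorm_eq0 subr_eq0 ts.
have vE : Num.sqrt (enorm (t - s) `^ (2 * H)) = enorm (t - s) `^ H.
  rewrite mulrC powRrM powR_mulrn ?powR_ge0// sqrtr_sqr.
  by rewrite ger0_norm ?powR_ge0.
have it := fbf1_integrable ot; have iz := fbf1_integrable os.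
rewrite -vE; apply: centered_gaussian_law.
- exact: fbf1_increment_gaussian.
- rewrite (_ : _ \o _ = (EFin \o b t) \- (EFin \o b s))%E; first exact: integrableB.
  by apply/funext => w; rewrite /= EFinB.
- under eq_integral do rewrite EFinB.
  rewrite integralB//.
  have := fbf1_centered hb ot; have := fbf1_centered hb os.
  by rewrite unlock => -> ->; rewrite subee.
- have := fbf1_increment hb os ot; rewrite unlock => <-.
  by apply: eq_integral => w _; rewrite real_normK ?num_real.
- exact: powR_gt0.
Qed.

End component.

Variables (n : nat) (B : 'rV[R]_k -> Omega -> 'rV[R]_n).
Hypothesis hB : fractional_brownian_field P H B.

Lemma fbf_measurable t : orthant k t -> measurable_fun setT (B t).
Proof.
move=> ot; apply: measurable_fun_mx => i j; rewrite (ord1 i).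
exact: (fbf1_measurable (fbf_component hB j) ot).
Qed.

(** Independence concerns the sigma-algebras generated by whole components; this lets it be used for
    increments. *)
Lemma increment_field_sigma_algebra (X : 'rV[R]_k -> Omega -> R) s t (A : set R) :
  orthant k s -> orthant k t -> measurable A ->
  field_sigma_algebra (orthant k) X ((fun w => X t w - X s w) @^-1` A).
Proof.
move=> os ot mA; set G := \bigcup_(t in orthant k) preimage_set_system setT (X t) measurable.
have mX r : orthant k r -> measurable_fun setT (X r : g_sigma_algebraType G -> R).
  move=> kr _ C mC; apply: sub_sigma_algebra; exists r => //.
  by exists C.
have mXB : measurable_fun setT ((fun w => X t w - X s w) : g_sigma_algebraType G -> R).
  by apply: measurable_funB; exact: mX.
by have := mXB measurableT _ mA; rewrite setTI.
Qed.

(** On open boxes, independence of the components factorises the probability into one-dimensional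
    Gaussian laws; finite measures that agree on boxes are equal. *)
Lemma fbf_increment_law s t : orthant k s -> orthant k t -> t != s ->
  forall A, measurable A -> P ((fun w => B t w - B s w) @^-1` A) =
    (\int[lebesgue_rV n]_(x in A) (gauss_rV (enorm (t - s) `^ H) x)%:E)%E.
Proof.
move=> os ot ts; set sg := _ `^ H.
have mZ : measurable_fun setT (fun w => B t w - B s w).
  by apply: measurable_fun_subv; exact: fbf_measurable.
pose m1 := measure_function_pushforward__canonical__measure_function_Measure P mZ.
pose m2 : {measure set 'rV[R]_n -> \bar R} :=
  density_measure (lebesgue_rV n) (@measurable_gauss_rV R n sg) (gauss_rV_ge0 sg).
apply: (@measure_unique_obox _ _ m1 m2) => [a b|]; last first.
  by rewrite /= /pushforward preimage_setT probability_setT ltry.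
pose E (j : 'I_n) : set Omega := (fun w => B t w ord0 j - B s w ord0 j) @^-1` `]a j, b j[%classic.
transitivity (\prod_(j < n) normal_prob 0 sg `]a j, b j[%classic)%E.
  have := @fbf_independent _ _ _ _ _ _ _ _ hB [set: 'I_n]%SET E.
  rewrite (_ : \bigcap_(_ in _) _ = (fun w => B t w - B s w) @^-1` obox a b); last first.
    apply/seteqP; split => w /= h j.
      by have := h j (finset.in_setT j); rewrite /E /= in_itv /= !mxE.
    by move=> _; have := h j; rewrite /E /= in_itv /= !mxE.
  rewrite /m1 /= /pushforward => ->; last first.
    move=> j _.
    exact: (@increment_field_sigma_algebra (fun t w => B t w ord0 j)).
  rewrite (eq_bigl xpredT) => [|j]; last by rewrite finset.in_setT.
  apply: eq_bigr => j _.
  exact: (fbf1_increment_law (fbf_component hB j)).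
rewrite /m2 /= /density_measure integral_mkcond.
transitivity (\int[lebesgue_rV n]_x
    (\prod_(j < n) (\1_(`]a j, b j[%classic) (x ord0 j) * normal_pdf 0 sg (x ord0 j)))%:E)%E.
  rewrite (ge0_integral_prod_rV
    (g := fun j r => \1_(`]a j, b j[%classic) r * normal_pdf 0 sg r)); last 2 first.
  - move=> j; apply: measurable_funM; first exact: measurable_indic.
    exact: measurable_normal_pdf.
  - by move=> j r; rewrite mulr_ge0 ?normal_pdf_ge0// indicE.
  apply: eq_bigr => j _; rewrite /normal_prob integral_mkcond.
  apply: eq_integral => r _; rewrite patchE indicE.
  by case: ifPn => _; rewrite ?mul1r ?mul0r.
apply: eq_integral => x _; rewrite big_split/= -indic_obox patchE indicE.
by case: ifPn => _; rewrite ?mul1r ?mul0r.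
Qed.

Lemma fbf_integral_1Dcos s t xi : orthant k s -> orthant k t ->
  (\int[P]_w (1 + cos (dotv xi (B t w - B s w)))%:E =
   (1 + expR (- (dotv xi xi / 2 * enorm (t - s) `^ (2 * H))))%:E)%E.
Proof.
move=> os ot; have [ts|ts] := eqVneq t s.
  (* The increment is degenerate here and has no density, but the formula persists because
     [0 ^ (2 H) = 0], the exponent being nonzero. *)
  rewrite ts subrr enorm0 powR0; last by rewrite mulf_neq0// gt_eqF.
  rewrite mulr0 oppr0 expR0.
  have E w : (1 + cos (dotv xi (B s w - B s w)))%:E = 2%:E :> \bar R.
    by rewrite subrr (_ : dotv xi 0 = 0) ?cos0// /dotv big1// => j _; rewrite mxE mulr0.
  under eq_integral do rewrite E.
  by rewrite integral_cst//= probability_setT mule1.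
have mZ : measurable_fun setT (fun w => B t w - B s w).
  by apply: measurable_fun_subv; exact: fbf_measurable.
have e0 : 0 < enorm (t - s) by rewrite lt_neqAle enorm_ge0 eq_sym enorm_eq0 subr_eq0 ts.
pose sg := enorm (t - s) `^ H.
have s0 : sg != 0 by rewrite gt_eqF// powR_gt0.
pose m1 := measure_function_pushforward__canonical__measure_function_Measure P mZ.
pose h (x : 'rV[R]_n) : \bar R := (1 + cos (0 + dotv xi x))%:E.
have mh : measurable_fun setT h by apply/measurable_EFinP; exact: measurable_1Dcos_dotv.
have h0 x : (0 <= h x)%E by rewrite lee_fin cos_ge0D1.
transitivity (\int[m1]_x h x)%E.
  rewrite (@ge0_integral_pushforward _ _ _ _ R _ mZ P setT h)// preimage_setT.
  by apply: eq_integral => w _; rewrite /h /= add0r.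
rewrite (@ge0_integral_density _ _ _ (lebesgue_rV n) m1 (gauss_rV sg))//; last 3 first.
- exact: measurable_gauss_rV.
- by move=> x; exact: gauss_rV_ge0.
- by move=> A mA; exact: fbf_increment_law.
under eq_integral => x _ do rewrite -EFinM mulrC.
rewrite integral_1Dcos_gauss_rV// cos0 mul1r; congr (1 + expR _)%:E.
rewrite [2 * H]mulrC powRrM powR_mulrn ?powR_ge0//.
by rewrite -/sg; field.
Qed.

End increments.

(** * Expected energy *)

Section energy.
Context {R : realType} {n : nat} {d : measure_display} {T : measurableType d}.
Variables (m : {finite_measure set T -> \bar R}) (X : T -> 'rV[R]_n).

(* As [m] will be a probability, this is [1] plus the squared modulus of the
   Fourier transform of the pushforward at [xi]. *)
Definition energy (xi : 'rV[R]_n) : \bar R :=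
  (\int[m]_t \int[m]_r (1 + cos (dotv xi (X t - X r)))%:E)%E.

Hypotheses (mX : measurable_fun setT X) (m1 : m setT = 1%E).

Lemma energyE xi :
  energy xi = (1 + \int[m]_t \int[m]_r cos (dotv xi (X t - X r)))%:E.
Proof.
pose F t := fourier_cos m X (X t) xi.
have E t : (\int[m]_r (1 + cos (dotv xi (X t - X r)))%:E = (1 + F t)%:E)%E.
  by rewrite integral_1Dcos// m1.
have mF : measurable_fun setT F.
  pose g (p : T * T) := (1 + cos (dotv xi (X p.1 - X p.2)))%:E.
  have mg : measurable_fun setT g.
    apply/measurable_EFinP; apply: measurable_funD => //.
    apply: (measurableT_comp (continuous_measurable_fun (@continuous_cos R))).
    apply: measurable_fun_dotv => //; apply: measurable_fun_subv.
      exact: (measurableT_comp mX measurable_fst).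
    exact: (measurableT_comp mX measurable_snd).
  have mG := @measurable_fun_fubini_tonelli_F _ _ _ _ _ m _ mg (fun p => cos_ge0D1 _).
  rewrite (_ : F = (fun t => fine (fubini_F m g t) - 1)); last first.
    by apply/funext => t; rewrite /fubini_F E /= addrC addKr.
  by apply: measurable_funB => //; apply: (measurableT_comp (fine_measurable measurableT)).
have iF : m.-integrable setT (EFin \o F).
  apply: (@bounded_integrable _ _ _ m _ 1) => // t.
  by have := normr_fourier_cos_le m mX (X t) xi; rewrite m1.
rewrite /energy; under eq_integral do rewrite E EFinD.
rewrite integralD//; last exact: finite_measure_integrable_cst.
have -> : (\int[m]__ 1 = 1)%E by rewrite integral_cst// mul1e; exact: m1.
rewrite EFinD; congr (_ + _)%E.
by rewrite [RHS]fineK//; apply: (integrable_fin_num measurableT iF).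
Qed.

(** The right-hand side no longer depends on [x]: this is the source of the uniform domination. *)
Lemma sqr_fourier_cos_le_energy x xi :
  fourier_cos m X x xi ^+ 2 <= fine (energy xi) - 1.
Proof. by rewrite energyE /= [1 + _]addrC addrK; exact: sqr_fourier_cos_le. Qed.

Lemma fine_energyK xi : (fine (energy xi))%:E = energy xi.
Proof. by rewrite energyE. Qed.

End energy.

(** * From expected energy to almost sure domination *)

Section almost_sure_domination.
Context {R : realType} {n : nat} {d1 d2 : measure_display}.
Context {T : measurableType d1} {Omega : measurableType d2}.
Variables (P : probability Omega R) (m : {finite_measure set T -> \bar R}).
Variable X : Omega -> T -> 'rV[R]_n.
Hypothesis mX : measurable_fun setT (fun p : T * Omega => X p.2 p.1).
Hypothesis m1 : m setT = 1%E.

Let mXw w : measurable_fun setT (X w).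
Proof. exact: (measurableT_comp mX (pair2_measurable w)). Qed.

Lemma measurable_energy :
  measurable_fun setT (fun p : 'rV[R]_n * Omega => energy m (X p.2) p.1).
Proof.
pose g (q : ('rV[R]_n * Omega * T) * T) :=
  (1 + cos (dotv q.1.1.1 (X q.1.1.2 q.1.2 - X q.1.1.2 q.2)))%:E.
have mg : measurable_fun setT g.
  apply/measurable_EFinP; apply: measurable_funD => //.
  apply: (measurableT_comp (continuous_measurable_fun (@continuous_cos R))).
  have m1q : measurable_fun setT (fun q : ('rV[R]_n * Omega * T) * T => q.1.1).
    by apply: measurableT_comp => //; exact: measurable_fst.
  apply: measurable_fun_dotv; first exact: (measurableT_comp measurable_fst m1q).
  have mO := measurableT_comp measurable_snd m1q.
  apply: measurable_fun_subv.
    apply: (measurableT_comp mX (g := fun q : ('rV[R]_n * Omega * T) * T => (q.1.2, q.1.1.2))).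
    apply/measurable_fun_pair => //; exact: (measurableT_comp measurable_snd measurable_fst).
  apply: (measurableT_comp mX (g := fun q : ('rV[R]_n * Omega * T) * T => (q.2, q.1.1.2))).
  by apply/measurable_fun_pair => //; exact: measurable_snd.
have g0 q : (0 <= g q)%E by exact: cos_ge0D1.
have mG := @measurable_fun_fubini_tonelli_F _ _ _ _ _ m _ mg g0.
apply: (@measurable_fun_fubini_tonelli_F _ _ _ _ _ m _ mG).
by move=> q; apply: integral_ge0.
Qed.

Lemma integral_energy xi :
  (\int[P]_w energy m (X w) xi =
   \int[m]_t \int[m]_r \int[P]_w (1 + cos (dotv xi (X w t - X w r)))%:E)%E.
Proof.
pose g (q : (Omega * T) * T) := (1 + cos (dotv xi (X q.1.1 q.1.2 - X q.1.1 q.2)))%:E.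
have mg : measurable_fun setT g.
  apply/measurable_EFinP; apply: measurable_funD => //.
  apply: (measurableT_comp (continuous_measurable_fun (@continuous_cos R))).
  apply: measurable_fun_dotv => //; apply: measurable_fun_subv.
    apply: (measurableT_comp mX (g := fun q : (Omega * T) * T => (q.1.2, q.1.1))).
    apply/measurable_fun_pair.
      exact: (measurableT_comp measurable_snd measurable_fst).
    exact: (measurableT_comp measurable_fst measurable_fst).
  apply: (measurableT_comp mX (g := fun q : (Omega * T) * T => (q.2, q.1.1))).
  apply/measurable_fun_pair; first exact: measurable_snd.
  exact: (measurableT_comp measurable_fst measurable_fst).
have g0 q : (0 <= g q)%E by exact: cos_ge0D1.
have mG := @measurable_fun_fubini_tonelli_F _ _ _ _ _ m _ mg g0.
rewrite /energy.
rewrite (@fubini_tonelli _ _ _ _ _ P m _ mG); last first.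
  by move=> q; apply: integral_ge0.
apply: eq_integral => t _.
rewrite (@fubini_tonelli _ _ _ _ _ P m (fun q => g ((q.1, t), q.2)))//.
apply: (measurableT_comp mg (g := fun q : Omega * T => ((q.1, t), q.2))).
apply/measurable_fun_pair; last exact: measurable_snd.
by apply/measurable_fun_pair => //; exact: measurable_fst.
Qed.

(* AM-GM: [|a| <= (a ^+ 2 / c + c) / 2]. *)
Definition amgm_energy (c : 'rV[R]_n -> R) w xi : R :=
  ((fine (energy m (X w) xi) - 1) / c xi + c xi) / 2.

Variables (W : 'rV[R]_n -> \bar R) (c : 'rV[R]_n -> R).
Hypotheses (mW : measurable_fun setT W) (W0 : forall xi, (0 <= W xi)%E).
Hypotheses (mc : measurable_fun setT c) (c0 : forall xi, 0 < c xi).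
Hypothesis cE : forall xi, (\int[P]_w energy m (X w) xi <= (1 + c xi ^+ 2)%:E)%E.
Hypothesis Wc : (\int[lebesgue_rV n]_xi (W xi * (c xi)%:E) < +oo)%E.

Lemma normr_fourier_cos_le_amgm w x xi :
  `|fourier_cos m (X w) x xi| <= amgm_energy c w xi.
Proof.
have h := sqr_fourier_cos_le_energy (mXw w) m1 x xi.
have cx := c0 xi.
rewrite /amgm_energy ler_pdivlMr// -(ler_pM2r cx) mulrDl divfK ?gt_eqF//.
apply: le_trans (lerD h (lexx _)).
rewrite -(real_normK (num_real (fourier_cos _ _ _ _))).
by have := sqr_ge0 (`|fourier_cos m (X w) x xi| - c xi); nra.
Qed.

Lemma amgm_energy_ge0 w xi : 0 <= amgm_energy c w xi.
Proof. exact: le_trans (normr_ge0 _) (normr_fourier_cos_le_amgm w 0 xi). Qed.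

Lemma measurable_amgm_energy2 :
  measurable_fun setT (fun p : 'rV[R]_n * Omega => amgm_energy c p.2 p.1).
Proof.
have mc1 : measurable_fun setT (fun p : 'rV[R]_n * Omega => c p.1).
  exact: (measurableT_comp mc measurable_fst).
apply: measurable_funM => //; apply: measurable_funD => //.
apply: measurable_funM.
  apply: measurable_funB => //.
  exact: (measurableT_comp (fine_measurable measurableT) measurable_energy).
under eq_fun do rewrite -powR_inv1 ?(ltW (c0 _))//.
exact: (measurableT_comp (measurable_powR (-1)) mc1).
Qed.

Lemma measurable_amgm_energy w : measurable_fun setT (amgm_energy c w).
Proof.
exact: (measurableT_comp measurable_amgm_energy2 (pair2_measurable w)).
Qed.

Lemma integral_amgm_energy_le xi : (\int[P]_w (amgm_energy c w xi)%:E <= (c xi)%:E)%E.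
Proof.
have cx := c0 xi; have cn : c xi != 0 by rewrite gt_eqF.
have mA : measurable_fun setT (fun w => (amgm_energy c w xi)%:E).
  apply/measurable_EFinP.
  exact: (measurableT_comp measurable_amgm_energy2 (pair1_measurable xi)).
have mE : measurable_fun setT (fun w => energy m (X w) xi).
  exact: (measurableT_comp measurable_energy (pair1_measurable xi)).
have E0 w : (0 <= energy m (X w) xi)%E.
  by apply: integral_ge0 => t _; apply: integral_ge0 => r _; exact: cos_ge0D1.
(* Adding [a = 1 / (2 c)] to both sides compensates the [- 1] in the definition: the integrand
   becomes [a] times the energy plus a constant, so only integrals of nonnegative functions are
   added. *)
pose a := (2 * c xi)^-1; have a0 : 0 <= a by rewrite invr_ge0 mulr_ge0// ltW.
have P1 r : (\int[P]_w r%:E = r%:E)%E.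
  by rewrite integral_cst//= probability_setT mule1.
rewrite -(@leeD2rE _ a%:E)// -{1}(P1 a) -ge0_integralD//; last first.
  by move=> w _; rewrite lee_fin amgm_energy_ge0.
have E w : ((amgm_energy c w xi)%:E + a%:E = a%:E * energy m (X w) xi + (c xi / 2)%:E)%E.
  rewrite -(fine_energyK (mXw w) m1) /= -EFinM -!EFinD; congr _%:E.
  by rewrite /amgm_energy /a; field.
under eq_integral do rewrite E.
have cx2 : 0 <= c xi / 2 by rewrite divr_ge0// ltW.
rewrite ge0_integralD//; last 2 first.
- by move=> w _; rewrite mule_ge0.
- exact: measurable_funeM.
rewrite ge0_integralZl// P1.
apply: (@le_trans _ _ (a%:E * (1 + c xi ^+ 2)%:E + (c xi / 2)%:E)%E).
  by rewrite leeD2r// lee_wpmul2l// lee_fin.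
rewrite -EFinM -!EFinD lee_fin le_eqVlt; apply/orP; left; apply/eqP.
by rewrite /a; field.
Qed.

(** By Tonelli the weighted integral [G] has expectation at most that of [W * c], hence is almost
    surely finite; the event is the one where it is finite. *)
Lemma almost_sure_domination : exists Omega0 : set Omega,
  [/\ measurable Omega0, P Omega0 = 1%E & forall w, Omega0 w ->
    (\int[lebesgue_rV n]_xi (W xi * (amgm_energy c w xi)%:E) < +oo)%E].
Proof.
pose g (p : 'rV[R]_n * Omega) := (W p.1 * (amgm_energy c p.2 p.1)%:E)%E.
have mg : measurable_fun setT g.
  apply: emeasurable_funM; first exact: (measurableT_comp mW measurable_fst).
  by apply/measurable_EFinP; exact: measurable_amgm_energy2.
have g0 p : (0 <= g p)%E by rewrite mule_ge0// lee_fin amgm_energy_ge0.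
pose G w := (\int[lebesgue_rV n]_xi g (xi, w))%E.
have mG : measurable_fun setT G := @measurable_fun_fubini_tonelli_G _ _ _ _ _ (lebesgue_rV n) _ mg g0.
have G0 w : (0 <= G w)%E by apply: integral_ge0.
have iG : P.-integrable setT G.
  apply/integrableP; split => //.
  under eq_integral do rewrite gee0_abs//.
  rewrite -(@fubini_tonelli _ _ _ _ _ (lebesgue_rV n) P g mg g0).
  apply: le_lt_trans Wc; apply: ge0_le_integral => //.
  - by move=> xi _; apply: integral_ge0.
  - exact: (@measurable_fun_fubini_tonelli_F _ _ _ _ _ P _ mg g0).
  - by apply: emeasurable_funM => //; exact/measurable_EFinP.
  move=> xi _; rewrite /g /= ge0_integralZl//.
  - by rewrite lee_wpmul2l// integral_amgm_energy_le.
  - apply/measurable_EFinP.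
    exact: (measurableT_comp measurable_amgm_energy2 (pair1_measurable xi)).
  - by move=> w _; rewrite lee_fin amgm_energy_ge0.
have mO : measurable [set w | (G w < +oo)%E].
  by rewrite -[X in measurable X]setTI; exact: measurable_lte.
exists [set w | (G w < +oo)%E]; split => //.
have N0 : P (~` [set w | (G w < +oo)%E]) = 0%E.
  apply/negligibleP; first exact: measurableC.
  apply: (negligibleS _ (integrable_ae measurableT iG)).
  by move=> w /= h fG; apply: h; have := fG Logic.I; rewrite ge0_fin_numE.
by have := probability_setC P (measurableC mO); rewrite setCK N0 sube0.
Qed.

End almost_sure_domination.

(** * Decay of the expected energy *)

Lemma enorm_subC {R : realType} n (x y : 'rV[R]_n) : enorm (x - y) = enorm (y - x).
Proof.
by congr Num.sqrt; apply: eq_bigr => i _; rewrite !mxE -sqrrN opprB.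
Qed.

Lemma subordination_ge0 {R : realType} (a e y : R) : (0 <= subordination a e y)%E.
Proof. by apply: integral_ge0 => u _; rewrite lee_fin expR_ge0. Qed.

(* The square of this profile bounds the excess over [1] of the expected energy. *)
Definition decay_profile {R : realType} {n : nat} (K beta : R) (xi : 'rV[R]_n) : R :=
  if enorm xi <= 1 then 1 else K * enorm xi `^ (- beta).

Section decay_profile.
Context {R : realType} {n : nat}.
Variables (K beta : R).
Hypothesis K0 : 0 < K.

Lemma decay_profile_gt0 (xi : 'rV[R]_n) : 0 < decay_profile K beta xi.
Proof.
rewrite /decay_profile; case: (lerP (enorm xi) 1) => // e1; rewrite mulr_gt0// powR_gt0//.
exact: lt_trans e1.
Qed.

Lemma measurable_decay_profile : measurable_fun setT (@decay_profile R n K beta).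
Proof.
apply: measurable_fun_ifT => //.
  by apply: measurable_fun_ler => //; exact: measurable_enorm.
apply: measurable_funM => //.
exact: (measurableT_comp (measurable_powR (- beta)) (@measurable_enorm R n)).
Qed.

Lemma integral_decay_profile_lty : (0 < n)%N -> n%:R < beta ->
  (\int[lebesgue_rV n]_xi (cst 1 xi * (decay_profile K beta xi)%:E) < +oo)%E.
Proof.
move=> n0 nb; have K1 : 0 <= 1 + K by rewrite addr_ge0// ltW.
(* [1 + K] dominates both branches of the profile, and the exponent at the origin is 0 because the
   weight is 1. *)
apply: (@integral_enorm_powR_lty _ n 0 beta (1 + K)) => //.
- by rewrite ltr0n.
- by apply: emeasurable_funM => //; apply/measurable_EFinP; exact: measurable_decay_profile.
- by move=> xi; rewrite mul1e lee_fin ltW// decay_profile_gt0.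
- move=> xi _ e1; rewrite mul1e /decay_profile e1 oppr0 powRr0 mulr1 lee_fin.
  by rewrite lerDl ltW.
- move=> xi e1; rewrite mul1e /decay_profile [enorm xi <= 1]leNgt e1 /= lee_fin.
  by rewrite ler_wpM2r ?powR_ge0// lerDr.
Qed.

Lemma measurable_subordination_enorm (alpha : R) :
  measurable_fun setT (fun xi : 'rV[R]_n => subordination alpha (-1) (enorm xi)).
Proof.
have mg := @measurable_subordination2 R n _ _ alpha (-1) (fun xi : 'rV[R]_n => xi) (@measurable_id _ _ _).
apply: (@measurable_fun_fubini_tonelli_F _ _ _ _ _ (@lebesgue_measure R) _ mg).
by move=> p; rewrite lee_fin expR_ge0.
Qed.

(** By scaling the weight is a multiple of [|xi| ^ (- alpha)]: integrability at the origin asks for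
    [alpha < n], at infinity for [alpha + beta > n]. *)
Lemma integral_subordination_decay_profile_lty (alpha : R) : (0 < n)%N ->
  0 < alpha -> n%:R - beta < alpha < n%:R ->
  (\int[lebesgue_rV n]_xi
    (subordination alpha (-1) (enorm xi) * (decay_profile K beta xi)%:E) < +oo)%E.
Proof.
move=> n0 a0 /andP[nba an]; have K1 : 0 <= 1 + K by rewrite addr_ge0// ltW.
have N1 : (-1) ^+ 2 = 1 :> R by rewrite sqrrN expr1n.
have S_ge0 := subordination_ge0 alpha (-1).
pose S := fine (subordination alpha (-1) 1).
have SE : subordination alpha (-1) 1 = S%:E.
  by rewrite fineK// ge0_fin_numE// subordination_lty.
have S0 : 0 <= S by rewrite fine_ge0.
apply: (@integral_enorm_powR_lty _ n alpha (alpha + beta) (S * (1 + K))) => //.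
- exact: ltW.
- by rewrite -ltrBlDr.
- by rewrite mulr_ge0.
- apply: emeasurable_funM; first exact: measurable_subordination_enorm.
  by apply/measurable_EFinP; exact: measurable_decay_profile.
- by move=> xi; rewrite mule_ge0// lee_fin ltW// decay_profile_gt0.
- move=> xi xi0 e1; have e0 : 0 < enorm xi by rewrite lt_neqAle enorm_ge0 eq_sym enorm_eq0 xi0.
  rewrite subordination_scale// SE /decay_profile e1 mule1 -EFinM lee_fin mulrC.
  by rewrite ler_wpM2r ?powR_ge0// ler_peMr// lerDl ltW.
- move=> xi e1; have e0 : 0 < enorm xi by exact: lt_trans e1.
  rewrite subordination_scale// SE /decay_profile [enorm xi <= 1]leNgt e1 /= -!EFinM lee_fin.
  rewrite opprD powRD; last by rewrite (gt_eqF e0) implybT.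
  have := powR_ge0 (enorm xi) (- alpha); have := powR_ge0 (enorm xi) (- beta).
  move: (_ `^ (- alpha)) (_ `^ (- beta)) => p q q0 p0.
  rewrite (_ : p * S * (K * q) = S * K * (p * q)); last by ring.
  by rewrite ler_wpM2r ?mulr_ge0// ler_wpM2l// lerDr.
Qed.

End decay_profile.

Section expected_energy.
Context {R : realType} {d : measure_display} {Omega : measurableType d}.
Variable P : probability Omega R.
Variables (k n : nat) (H : R).
Hypotheses (hk : (0 < k)%N) (H0 : 0 < H).
Variable B : 'rV[R]_k -> Omega -> 'rV[R]_n.
Hypothesis hB : fractional_brownian_field P H B.

Definition clipped_field w (t : 'rV[R]_k) : 'rV[R]_n := B (clip t) w.

Lemma measurable_clipped_field :
  measurable_fun setT (fun p : 'rV[R]_k * Omega => clipped_field p.2 p.1).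
Proof.
apply: measurable_fun_mx => i j; rewrite (ord1 i).
apply: (@measurable_clipped_path _ _ _ _ (fun t w => B t w ord0 j)).
  by move=> t ot; exact: (fbf1_measurable (fbf_component hB j) ot).
by move=> w; apply: within_continuous_coord; exact: (fbf_continuous hB).
Qed.

Lemma expected_energy_le : exists2 K, 0 < K & forall xi : 'rV[R]_n,
  (\int[P]_w energy cube_measure (clipped_field w) xi <=
   (1 + decay_profile K (k%:R / (2 * H)) xi ^+ 2)%:E)%E.
Proof.
have h0 : 0 < 2 * H by rewrite mulr_gt0.
have [C C0 hC] := integral_expR_Nenorm_powR_le hk h0.
set beta := k%:R / (2 * H).
have K20 : 0 < C * 2 `^ beta by rewrite mulr_gt0// powR_gt0.
(* The layer estimate at [l = |xi| ^ 2 / 2] is [C * l ^ (- beta) = C * 2 ^ beta * |xi| ^ (- 2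
   beta)], which must be the square of the profile. *)
exists (Num.sqrt (C * 2 `^ beta)); first by rewrite sqrtr_gt0.
move=> xi; rewrite (integral_energy P _ measurable_clipped_field).
pose l := dotv xi xi / 2.
have l0 : 0 <= l by rewrite divr_ge0// dotv_ge0.
pose e (t r : 'rV[R]_k) := expR (- (l * enorm (clip t - clip r) `^ (2 * H))).
have me2 : measurable_fun setT (fun p : 'rV[R]_k * 'rV[R]_k => e p.1 p.2).
  have mclip : measurable_fun setT (@clip R k).
    by apply: measurable_fun_mx => i j; rewrite (ord1 i); exact: measurable_clip_coord.
  apply: (measurableT_comp (@measurable_expR R)); apply: measurable_funN.
  apply: measurable_funM => //.
  apply: (measurableT_comp (measurable_powR (2 * H))).
  apply: (measurableT_comp (@measurable_enorm R k)); apply: measurable_fun_subv.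
    exact: (measurableT_comp mclip measurable_fst).
  exact: (measurableT_comp mclip measurable_snd).
have me t : measurable_fun setT (e t) by exact: (measurableT_comp me2 (pair1_measurable t)).
have e_ge0 t r : 0 <= e t r by exact: expR_ge0.
have mass1 (a : R) : (\int[@cube_measure R k]__ a%:E = a%:E)%E.
  by rewrite integral_cst// -[RHS]mule1; congr (_ * _)%E; exact: cube_measureT.
set b := (1 + _)%R.
have inner t : (\int[cube_measure]_r (1 + e t r)%:E <= b%:E)%E.
  rewrite /b /decay_profile; case: (lerP (enorm xi) 1) => e1.
    rewrite -mass1; apply: ge0_le_integral => //.
    - by move=> r _; rewrite lee_fin addr_ge0.
    - by apply/measurable_EFinP; apply: measurable_funD; [exact: measurable_cst|exact: me].
    - move=> r _; rewrite lee_fin expr1n lerD2l /e -expR0 ler_expR oppr_le0.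
      by rewrite mulr_ge0// powR_ge0.
  under eq_integral do rewrite EFinD.
  rewrite ge0_integralD//; last 2 first.
  - by move=> r _; rewrite lee_fin.
  - by apply/measurable_EFinP; exact: me.
  rewrite mass1 EFinD leeD2l//.
  rewrite ge0_integral_cube_measure; last 2 first.
  - by apply/measurable_EFinP; exact: me.
  - by move=> r; rewrite lee_fin.
  have e0 : 0 < enorm xi by exact: lt_trans e1.
  have lE : l = enorm xi ^+ 2 * 2^-1 by rewrite /l sqr_enorm.
  have lp : 0 < l by rewrite lE mulr_gt0// exprn_gt0.
  (* On the cube the integration variable is unaffected by [clip]; [clip t] remains as a fixed
     center. *)
  apply: (@le_trans _ _ (\int[lebesgue_rV k]_(r in unit_cube k)
      (expR (- (l * enorm (r - clip t) `^ (2 * H))))%:E)%E).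
    rewrite le_eqVlt; apply/orP; left; apply/eqP; apply: eq_integral => r.
    by rewrite inE => cr; rewrite /e (clip_id cr) enorm_subC.
  (* The domain is enlarged to the whole space, where the estimate is uniform in the center. *)
  apply: le_trans.
    apply: (@ge0_subset_integral _ _ _ _ _ setT) => //.
    - exact: measurable_unit_cube.
    - apply/measurable_EFinP; apply: (measurableT_comp (@measurable_expR R)).
      apply: measurable_funN; apply: measurable_funM => //.
      apply: (measurableT_comp (measurable_powR (2 * H))).
      by apply: (measurableT_comp (@measurable_enorm R k)); exact: measurable_fun_subv.
  apply: le_trans (hC l (clip t) lp) _.
  rewrite lee_fin exprMn sqr_sqrtr ?(ltW K20)// -mulrA ler_wpM2l ?(ltW C0)//.
  rewrite le_eqVlt; apply/orP; left; apply/eqP.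
  rewrite lE powRM ?sqr_ge0// mulrC -/beta; congr (_ * _).
    by rewrite -powR_inv1// -powRrM mulN1r opprK.
  rewrite -(powR_mulrn 2 (powR_ge0 _ _)) -(powR_mulrn 2 (enorm_ge0 xi)) -!powRrM.
  by congr (_ `^ _); exact: mulrC.
rewrite -mass1.
under eq_integral => t _ do under eq_integral => r _ do
  rewrite (fbf_integral_1Dcos H0 hB xi (unit_cube_orthant (clip_unit_cube r))
    (unit_cube_orthant (clip_unit_cube t))).
have mE : measurable_fun setT (fun p : 'rV[R]_k * 'rV[R]_k => (1 + e p.1 p.2)%:E).
  by apply/measurable_EFinP; apply: measurable_funD; [exact: measurable_cst|exact: me2].
apply: ge0_le_integral => //.
- by move=> t _; apply: integral_ge0 => r _; rewrite lee_fin addr_ge0 ?e_ge0.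
- apply: (@measurable_fun_fubini_tonelli_F _ _ _ _ _ cube_measure _ mE).
  by move=> p; rewrite lee_fin addr_ge0.
- by move=> t _; exact: inner.
Qed.

End expected_energy.

Theorem lemma5p5 (R : realType) (k n : nat) (hk : (0 < k)%N) (hn : (0 < n)%N)
    (d : measure_display) (Omega : measurableType d) (P : probability Omega R)
    (H : R) (hH : 0 < H < 1) (B : 'rV[R]_k -> Omega -> 'rV[R]_n)
    (hB : fractional_brownian_field P H B) :
  (forall alpha : R, 0 < alpha -> n%:R - k%:R / (2 * H) < alpha < n%:R ->
    exists Omega0 : set Omega,
      [/\ measurable Omega0, P Omega0 = 1%E &
        forall w, Omega0 w ->
          exists U : 'rV[R]_n -> R,
            [/\ forall x,
                  riesz_potential alpha (occupation_measure (B ^~ w)) x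
                  = (U x)%:E,
                C_infty n U &
                [bounded U x | x in setT]]]) /\
  (n%:R < k%:R / (2 * H) ->
    exists Omega0 : set Omega,
      [/\ measurable Omega0, P Omega0 = 1%E &
        forall w, Omega0 w ->
          exists L : 'rV[R]_n -> R,
            [/\ local_time (B ^~ w) L,
                C_infty n L &
                [bounded L x | x in setT]]]).
Proof.
have /andP[H0 _] := hH; have [K K0 hK] := expected_energy_le hk H0 hB.
have m1 : (@cube_measure R k) setT = 1%E by exact: cube_measureT.
have mX := measurable_clipped_field hB.
have mXw w : measurable_fun setT (clipped_field B w).
  exact: (measurableT_comp mX (pair2_measurable w)).
set beta := k%:R / (2 * H); set c : 'rV[R]_n -> R := decay_profile K beta.
have mc : measurable_fun setT c := measurable_decay_profile K beta.
have c0 xi : 0 < c xi by exact: decay_profile_gt0.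
(* Domination holds on every path; only the integrability of the dominating function is almost
   sure. *)
have D_ge w x xi := normr_fourier_cos_le_amgm mX m1 c0 w x xi.
have mD w : measurable_fun setT (amgm_energy cube_measure (clipped_field B) c w).
  exact: measurable_amgm_energy.
split=> [alpha a0 hab|nb].
  have [Om [mOm POm hOm]] := @almost_sure_domination _ _ _ _ _ _ P _ _ mX m1 _ _
    (measurable_subordination_enorm alpha)
    (fun xi => subordination_ge0 _ _ _) mc c0 hK
    (integral_subordination_decay_profile_lty K0 hn a0 hab).
  exists Om; split => // w Omw.
  have [rho Brho] := bounded_clipped_path (fbf_continuous hB (w := w)).
  have /andP[_ an] := hab.
  rewrite occupation_measureE.
  exact: (riesz_potential_regular (mXw w) an (mD w) (D_ge w) (hOm w Omw) Brho).
(* The weight 1 takes the place of the subordinated power, as for exponent 0. *)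
have [Om [mOm POm hOm]] := @almost_sure_domination _ _ _ _ _ _ P _ _ mX m1 (cst 1%E) _
  (measurable_cst _) (fun=> lee01) mc c0 hK (integral_decay_profile_lty K0 hn nb).
exists Om; split => // w Omw.
have [rho Brho] := bounded_clipped_path (fbf_continuous hB (w := w)).
have intD : (\int[lebesgue_rV n]_xi
    (amgm_energy cube_measure (clipped_field B) c w xi)%:E < +oo)%E.
  by have := hOm w Omw; under eq_integral do rewrite mul1e.
have [L [dL CL bL]] := local_time_regular (mXw w) (mD w) (D_ge w) intD Brho.
exists L; split => //; rewrite /local_time occupation_measureE; split => //.
apply/null_content_dominatesP => A mA A0.
rewrite (densityE dL mA); apply: null_set_integral => //.
by apply/measurable_funTS/measurable_EFinP; exact: density_measurable dL.
Qed.
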